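(* Let $D$ be an almost Dedekind domain, let $\Theta:=\{D_M\mid M\in\mathrm{Max}(D)\}$, let $\{T_\alpha\}$ be the derived sequence of $\Theta$ with associated sets $\mathcal{N}^\alpha(\Theta)$ (identified with subsets of $\mathrm{Max}(D)$ via $D_M\leftrightarrow M$), and fix an ordinal $\alpha$. If $\mathrm{Int}(D)D_M=\mathrm{Int}(D_M)$ for every $M\notin\mathcal{N}^\alpha(\Theta)$, and $\mathrm{Int}(D)T_\alpha=\mathrm{Int}(T_\alpha)$, then there is an exact sequence $$0\longrightarrow\bigoplus_{M\notin\mathcal{N}^\alpha(\Theta)}\mathrm{Pic}(\mathrm{Int}(D_M))\longrightarrow\mathrm{Pic}_{\mathrm{Int}}(D)\longrightarrow\mathrm{Pic}_{\mathrm{Int}}(T_\alpha)\longrightarrow 0.$$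
   Context: An almost Dedekind domain is an integral domain all of whose localizations at maximal ideals are discrete valuation rings; $\Theta=\{D_M\}$ is then a pre-Jaffard family of $D$. $K$ is the quotient field of $D$; for a domain $A$ with quotient field $K$, $\mathrm{Int}(A)=\{f\in K[X]\mid f(A)\subseteq A\}$, $\mathrm{Pic}(A)$ is the group of invertible fractional ideals modulo principal ones, and $\mathrm{Pic}_{\mathrm{Int}}(A):=\mathrm{Pic}(\mathrm{Int}(A))/\iota_A(\mathrm{Pic}(A))$ with $\iota_A([I])=[I\,\mathrm{Int}(A)]$. For a flat overring $T$, $\mathrm{Int}(D)T$ is the subring of $K[X]$ of finite sums $\sum f_it_i$. A family $\Theta$ of overrings of a domain $R$ (quotient field $K$) is a pre-Jaffard family of $R$ if: $\Theta=\{K\}$ or $K\notin\Theta$; every member is flat over $R$; complete (every ideal $I$ of $R$ equals $\bigcap_{T\in\Theta}IT$); independent ($TT'=K$ for distinct members); compact in the Zariski topology on overrings (subbasic opens $\{T\mid x_1,\dots,x_n\in T\}$). A Jaffard family is a locally finite pre-Jaffard family (each nonzero $x\in R$ is a nonunit in only finitely many members); a Jaffard overring of $R$ is a member of some Jaffard family of $R$. Derived sequence: $\mathcal{N}^0(\Theta)=\Theta$; $T_\alpha:=\bigcap_{T\in\mathcal{N}^\alpha(\Theta)}T$ (empty intersection $=K$); $\mathcal{N}^{\gamma+1}(\Theta)$ is the set of elements of $\mathcal{N}^\gamma(\Theta)$ that are not Jaffard overrings of $T_\gamma$; for limit $\alpha$, $\mathcal{N}^\alpha(\Theta)=\bigcap_{\beta<\alpha}\mathcal{N}^\beta(\Theta)$.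 *)

(* Defs.v *)
From Stdlib Require List.
From HB Require Import structures.
From mathcomp Require Import all_boot all_order all_algebra.
Set Implicit Arguments. Unset Strict Implicit. Unset Printing Implicit Defensive.
Import Order.TTheory GRing.Theory Num.Theory.
Local Open Scope ring_scope.

(* Finite sums  sum_i p_i q_i  with p_i in P, q_i in Q : the product PQ
   (product of ideals, extended ideal IT, compositum TT', Int(D)T ...). *)
Definition prodI (R : comPzRingType) (P Q : R -> Prop) : R -> Prop :=
  fun x => exists (n : nat) (p q : 'I_n -> R),
    (forall i, P (p i)) /\ (forall i, Q (q i)) /\ x = \sum_(i < n) p i * q i.

Definition seteq (T : Type) (P Q : T -> Prop) := forall x, P x <-> Q x.

Section Field.
Variable F : fieldType.
Implicit Types (A R T I J M : F -> Prop).

Definition is_subring A :=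
  A 1 /\ (forall x y, A x -> A y -> A (x - y)) /\
  (forall x y, A x -> A y -> A (x * y)).

Definition quotfield A :=
  forall x, exists a b, A a /\ A b /\ b != 0 /\ x = a / b.

Definition is_ideal A I :=
  (forall x, I x -> A x) /\ I 0 /\ (forall x y, I x -> I y -> I (x + y)) /\
  (forall a x, A a -> I x -> I (a * x)).

Definition maxideal A M :=
  is_ideal A M /\ ~ M 1 /\
  forall J, is_ideal A J -> (forall x, M x -> J x) -> seteq J M \/ J 1.

Definition loc A M : F -> Prop :=
  fun x => exists a s, A a /\ A s /\ ~ M s /\ x = a / s.

Definition is_DVR V :=
  is_subring V /\
  exists t, V t /\ ~ V t^-1 /\
    forall x, x != 0 -> exists (u : F) (n : nat),
      V u /\ V u^-1 /\ (x = u * t ^+ n \/ x = u / t ^+ n).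

Definition almost_dedekind D :=
  is_subring D /\ quotfield D /\ forall M, maxideal D M -> is_DVR (loc D M).

Definition overring R T := is_subring T /\ forall x, R x -> T x.

(* flatness of the R-module T (a subset of F), via the equational
   criterion of flatness: every relation is trivial *)
Definition flat R T :=
  forall (n : nat) (r t : 'I_n -> F),
    (forall i, R (r i)) -> (forall i, T (t i)) -> \sum_(i < n) r i * t i = 0 ->
    exists (m : nat) (a : 'I_n -> 'I_m -> F) (s : 'I_m -> F),
      (forall i j, R (a i j)) /\ (forall j, T (s j)) /\
      (forall i, t i = \sum_(j < m) a i j * s j) /\
      (forall j, \sum_(i < n) r i * a i j = 0).

(* Zariski topology on the set Over(R) of overrings of R: the sets
   U(x_1..x_n) = {T | x_1..x_n in T} form a (sub)basis. *)
Definition zar_open R (O : (F -> Prop) -> Prop) :=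
  forall T, overring R T -> O T ->
    exists xs : seq F, (forall x, x \in xs -> T x) /\
      forall T', overring R T' -> (forall x, x \in xs -> T' x) -> O T'.

Definition zar_compact R (Th : (F -> Prop) -> Prop) :=
  forall (Ix : Type) (O : Ix -> (F -> Prop) -> Prop),
    (forall i, zar_open R (O i)) ->
    (forall T, Th T -> exists i, O i T) ->
    exists s : list Ix, forall T, Th T -> exists i, List.In i s /\ O i T.

Definition Kfull : F -> Prop := fun _ => True.

Definition pre_jaffard R (Th : (F -> Prop) -> Prop) :=
  ((forall T, Th T <-> seteq T Kfull) \/ ~ (exists T, Th T /\ seteq T Kfull)) /\
  (forall T, Th T -> overring R T) /\
  (forall T, Th T -> flat R T) /\
  (forall I, is_ideal R I -> seteq I (fun x => forall T, Th T -> prodI I T x)) /\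
  (forall T T', Th T -> Th T' -> ~ seteq T T' -> seteq (prodI T T') Kfull) /\
  zar_compact R Th.

Definition jaffard_family R Th :=
  pre_jaffard R Th /\
  forall x, R x -> x != 0 ->
    exists s : list (F -> Prop), forall T, Th T -> ~ T x^-1 ->
      exists T', List.In T' s /\ seteq T T'.

Definition jaffard_overring R T :=
  exists Th, jaffard_family R Th /\ Th T.

(* intersection of a family of overrings (empty intersection = K) *)
Definition Tint (Th : (F -> Prop) -> Prop) : F -> Prop :=
  fun x => forall T, Th T -> T x.

Definition fracideal R I :=
  I 0 /\ (forall x y, I x -> I y -> I (x + y)) /\
  (forall r x, R r -> I x -> I (r * x)) /\
  exists d, R d /\ d != 0 /\ forall x, I x -> R (d * x).

Definition invertible R I :=
  fracideal R I /\ exists J, fracideal R J /\ seteq (prodI I J) R.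

Definition scale (x : F) I : F -> Prop := fun y => exists j, I j /\ y = x * j.

Definition pic_eqv R I J := exists x, x != 0 /\ seteq I (scale x J).

End Field.

Definition Theta (K : fieldType) (D : K -> Prop) (T : K -> Prop) :=
  exists M, maxideal D M /\ seteq T (loc D M).

(* a well-ordered index type (its elements represent ordinals) *)
Definition well_order (W : Type) (lt : W -> W -> Prop) :=
  well_founded lt /\ (forall a b c, lt a b -> lt b c -> lt a c) /\
  (forall a b, lt a b \/ a = b \/ lt b a).

(* N is the derived sequence N^w(Theta) along the well-order lt:
   N^0 = Theta, N^(g+1) = N^g minus Jaffard overrings of T_g,
   N^a = cap_{b<a} N^b for limit a; uniformly,
   N^a = Theta cap  cap_{b<a} (N^b \ {Jaffard overrings of T_b}). *)
Definition derived_seq (K : fieldType) (D : K -> Prop) (W : Type)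
    (lt : W -> W -> Prop) (N : W -> (K -> Prop) -> Prop) :=
  forall w T, N w T <->
    (Theta D T /\ forall v, lt v w -> N v T /\ ~ jaffard_overring (Tint (N v)) T).

Definition Int (K : fieldType) (A : K -> Prop) : {poly K} -> Prop :=
  fun f => forall a, A a -> A f.[a].

Definition constP (K : fieldType) (T : K -> Prop) : {poly K} -> Prop :=
  fun p => exists t, T t /\ p = t%:P.

Definition Int_ext_eq (K : fieldType) (D T : K -> Prop) :=
  seteq (prodI (Int D) (constP T)) (Int T).

Notation KX K := {fraction {poly K}}.

Definition IntF (K : fieldType) (A : K -> Prop) : KX K -> Prop :=
  fun y => exists f, Int A f /\ y = @FracField.tofrac _ f.

Definition emb (K : fieldType) (L : K -> Prop) : KX K -> Prop :=
  fun y => exists l, L l /\ y = @FracField.tofrac _ (l%:P).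

(* [I] = [J] in Pic_Int(A) = Pic(Int(A)) / iota_A(Pic(A)) *)
Definition picint_eqv (K : fieldType) (A : K -> Prop) (I J : KX K -> Prop) :=
  exists (L : K -> Prop) (x : KX K), invertible A L /\ x != 0 /\
    seteq I (scale x (prodI (prodI (emb L) (IntF A)) J)).

(* a group given by a type of representatives, the predicate of valid
   representatives, the equality of classes, the product and unit *)
Record sgroup := SGroup {
  sg_car : Type;
  sg_elem : sg_car -> Prop;
  sg_eqv : sg_car -> sg_car -> Prop;
  sg_mul : sg_car -> sg_car -> sg_car;
  sg_one : sg_car }.

Definition sg_hom (G H : sgroup) (f : sg_car G -> sg_car H) :=
  (forall a, sg_elem a -> sg_elem (f a)) /\
  (forall a b, sg_elem a -> sg_elem b -> sg_eqv a b -> sg_eqv (f a) (f b)) /\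
  (forall a b, sg_elem a -> sg_elem b -> sg_eqv (f (sg_mul a b)) (sg_mul (f a) (f b))).

Definition short_exact (A B C : sgroup) (f : sg_car A -> sg_car B)
    (g : sg_car B -> sg_car C) :=
  sg_hom f /\ sg_hom g /\
  (forall a, sg_elem a -> sg_eqv (f a) (sg_one B) -> sg_eqv a (sg_one A)) /\
  (forall b, sg_elem b ->
     (sg_eqv (g b) (sg_one C) <-> exists a, sg_elem a /\ sg_eqv (f a) b)) /\
  (forall c, sg_elem c -> exists b, sg_elem b /\ sg_eqv (g b) c).

Definition PicInt (K : fieldType) (A : K -> Prop) : sgroup :=
  @SGroup (KX K -> Prop) (invertible (IntF A)) (picint_eqv A)
    (@prodI _) (IntF A).

Definition SumPic (K : fieldType) (D : K -> Prop) (N : (K -> Prop) -> Prop)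
  : sgroup :=
  let idx := fun M => maxideal D M /\ ~ N (loc D M) in
  @SGroup ((K -> Prop) -> (KX K -> Prop))
    (fun a => (forall M, idx M -> invertible (IntF (loc D M)) (a M)) /\
       exists s : list (K -> Prop), forall M, idx M -> ~ List.In M s ->
         pic_eqv (IntF (loc D M)) (a M) (IntF (loc D M)))
    (fun a b => forall M, idx M -> pic_eqv (IntF (loc D M)) (a M) (b M))
    (fun a b M => prodI (a M) (b M))
    (fun M => IntF (loc D M)).

(* Main.v *)
(* Let [S] be a set of maximal ideals of [D], [A_S] the intersection of the [D_M] with
   [M] in [S], and [J] an invertible ideal of [Int(A_S)], scaled so that it generates
   the unit ideal of [K[X]]. The function [Phi_J(M, a) = min {v_M(f(a)) | f in J}], for
   [M] in [S] and [a] in [D], determines [J], is additive in [J], and is independent of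
   [a] exactly when [J] is extended from [A_S]. So [Pic_Int(A_S)] is the group of
   functions [Phi_J(M, a) - Phi_J(M, 0)], for [S = Max(D)], [S = N^alpha] and
   [S = {M}] alike, and the map to [Pic_Int(T_alpha)] is a restriction of functions.

   Near-idempotents of [D] modulo a nonzero constant allow such functions to be cut and
   glued along clopen sets of maximal ideals. This lifts classes from [A_S] to [D] when
   [Int(D) A_S = Int(A_S)], which gives surjectivity. A maximal ideal leaving the derived
   sequence at step [gamma] is, by flatness and independence of a Jaffard family,
   isolated in [N^gamma]; hence every class of [Int(D_M)] lifts to a class of [D]
   supported on [M] and on places of smaller level. The lift can be made additive
   because [Pic(Int(D_M))] is free: it vanishes when the residue field is infinite, and
   embeds into a group of finitely supported integer sequences when it is finite. The
   injection is the sum of these lifts: it is injective by looking at a place of highest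
   level, and it fills the kernel by well-founded induction on levels. *)

Require Import Defs.
From HB Require Import structures.
From mathcomp Require Import all_boot all_order all_algebra.
From mathcomp Require Import boolp classical_sets functions.
From mathcomp Require Import zify ring lra.
Set Implicit Arguments. Unset Strict Implicit. Unset Printing Implicit Defensive.
Import Order.TTheory GRing.Theory Num.Theory.
Local Open Scope ring_scope.

(** * Submodules and invertible submodules *)

(** A lift of a class from [loc D M] to [D] cannot in general be supported on [M] alone: isolation
    clears only the places still present when [M] leaves the derived sequence, and [M] may be a
    limit of places removed earlier. So the splitting is triangular for the level, not diagonal, and
    it rests on choices; this is why additivity of the lifts has to come from freeness. Compactness
    arguments over maximal ideals reduce to one fact: an ideal of [D] contained in no maximal ideal
    contains [1]. It yields near-idempotents, closedness of the set of surviving places, and the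
    kernel. The hypotheses on [Int] enter through denominators: if Int(D) A_S = Int(A_S) and [M] is
    in [S], every element of Int(A_S) is multiplied into Int(D) by some element of [D] outside [M].
    Finite data over [S] therefore persist near [M], and a class of [D] that vanishes on [S]
    vanishes near each place of [S]. *)

Lemma seteqE (T : Type) (P Q : T -> Prop) : seteq P Q -> P = Q.
Proof. by move=> e; apply/funext => x; apply/propext; exact: e. Qed.

Section Subrings.
Variables (F : comNzRingType) .
Implicit Types A I J : F -> Prop.

Definition subring A := A 1 /\ (forall x y, A x -> A y -> A (x - y)) /\
  (forall x y, A x -> A y -> A (x * y)).

Definition submod A I := I 0 /\ (forall x y, I x -> I y -> I (x + y)) /\
  (forall a x, A a -> I x -> I (a * x)).

(** An invertible module carried together with its inverse. The setting is a commutative ring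
    because the notion is used inside [{poly K}] as well as in fields; the bounded denominators that
    [fracideal] asks for follow once [A] has quotient field [F] ([dual_fracideal]). *)
Definition dual A J J' := submod A J /\ submod A J' /\
  (forall p q, J p -> J' q -> A (p * q)) /\ prodI J J' 1.

Lemma subring1 A : subring A -> A 1. Proof. by case. Qed.
Lemma subringB A x y : subring A -> A x -> A y -> A (x - y).
Proof. by move=> [_ [h _]]; exact: h. Qed.
Lemma subringM A x y : subring A -> A x -> A y -> A (x * y).
Proof. by move=> [_ [_ h]]; exact: h. Qed.
Lemma subring0 A : subring A -> A 0.
Proof. by move=> h; rewrite -(subrr 1); apply: subringB => //; apply: subring1. Qed.
Lemma subringN A x : subring A -> A x -> A (- x).
Proof. by move=> h hx; rewrite -sub0r; apply: subringB => //; apply: subring0. Qed.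
Lemma subringD A x y : subring A -> A x -> A y -> A (x + y).
Proof. by move=> h hx hy; rewrite -[y]opprK; apply: subringB => //; apply: subringN. Qed.
Lemma subringX A x n : subring A -> A x -> A (x ^+ n).
Proof.
move=> h hx; elim: n => [|n ih]; first by rewrite expr0; apply: subring1.
by rewrite exprS; apply: subringM.
Qed.
Lemma subring_sum A (I : Type) (r : seq I) (P : pred I) (E : I -> F) :
  subring A -> (forall i, A (E i)) -> A (\sum_(i <- r | P i) E i).
Proof.
move=> h hE; elim/big_rec : _ => [|i x _ hx]; first exact: subring0.
exact: subringD.
Qed.

Lemma submod_self A : subring A -> submod A A.
Proof.
move=> h; split; first exact: subring0.
by split=> *; [apply: subringD|apply: subringM].
Qed.

Lemma prodI_mul J J' x y : J x -> J' y -> prodI J J' (x * y).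
Proof.
move=> hx hy; exists 1%N, (fun=> x), (fun=> y); split=> //; split=> //.
by rewrite big_ord1.
Qed.

Lemma prodI0 J J' : prodI J J' 0.
Proof.
exists 0%N, (fun=> 0), (fun=> 0); split; first by case.
by split; [case|rewrite big_ord0].
Qed.

Lemma prodID J J' x y : prodI J J' x -> prodI J J' y -> prodI J J' (x + y).
Proof.
move=> [n [p [q [hp [hq ->]]]]] [n' [p' [q' [hp' [hq' ->]]]]].
exists (n + n')%N, (fun i : 'I_(n + n') => match fintype.split i with inl j => p j | inr j => p' j end),
  (fun i : 'I_(n + n') => match fintype.split i with inl j => q j | inr j => q' j end).
split; first by move=> i; case: (fintype.split i).
split; first by move=> i; case: (fintype.split i).
rewrite big_split_ord /=; congr (_ + _); apply: eq_bigr => i _.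
  by rewrite (unsplitK (inl i : 'I_n + 'I_n')).
by rewrite (unsplitK (inr i : 'I_n + 'I_n')).
Qed.

Lemma prodI_ind J J' (P : F -> Prop) :
  P 0 -> (forall x y, P x -> P y -> P (x + y)) ->
  (forall x y, J x -> J' y -> P (x * y)) -> forall z, prodI J J' z -> P z.
Proof.
move=> P0 PD PM z [n [p [q [hp [hq ->]]]]].
by elim/big_rec : _ => // i x _ hx; apply: PD => //; exact: PM.
Qed.

Lemma prodIC J J' : prodI J J' = prodI J' J.
Proof.
by apply: seteqE => x; split; elim/prodI_ind;
  [exact: prodI0|exact: prodID|move=> *; rewrite mulrC; exact: prodI_mul|
   exact: prodI0|exact: prodID|move=> *; rewrite mulrC; exact: prodI_mul].
Qed.

Lemma prodI_mono I J I' J' x : (forall y, I y -> I' y) -> (forall y, J y -> J' y) ->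
  prodI I J x -> prodI I' J' x.
Proof. by move=> h h' [n [p [q [hp [hq ->]]]]]; exists n, p, q; firstorder. Qed.

Lemma prodIA I J L : prodI (prodI I J) L = prodI I (prodI J L).
Proof.
apply: seteqE => x; split; elim/prodI_ind;
  [exact: prodI0|exact: prodID| |exact: prodI0|exact: prodID|].
- move=> {x} z y hz hy; elim/prodI_ind: hz => [|a b|a b ha hb];
    [rewrite mul0r; exact: prodI0|rewrite mulrDl; exact: prodID|].
  by rewrite -mulrA; apply: prodI_mul => //; exact: prodI_mul.
- move=> {x} z y hz hy; elim/prodI_ind: hy => [|a b|a b ha hb];
    [rewrite mulr0; exact: prodI0|rewrite mulrDr; exact: prodID|].
  by rewrite mulrA; apply: prodI_mul => //; exact: prodI_mul.
Qed.

Lemma prodI_submod A I J : submod A I -> submod A (prodI I J).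
Proof.
move=> [_ [_ hM]]; split; first exact: prodI0.
split; first by move=> *; exact: prodID.
move=> a x ha; elim/prodI_ind => [|y z|y z hy hz];
    [rewrite mulr0; exact: prodI0|rewrite mulrDr; exact: prodID|].
by rewrite mulrA; apply: prodI_mul => //; exact: hM.
Qed.

Lemma prodI_submodr A I J : submod A J -> submod A (prodI I J).
Proof. by rewrite prodIC; exact: prodI_submod. Qed.

Lemma prodI_sub A I J I' : submod A I' -> (forall x y, I x -> J y -> I' (x * y)) ->
  forall x, prodI I J x -> I' x.
Proof. by move=> [h0 [hD _]] hM x; elim/prodI_ind. Qed.

Lemma prodI_unit A J : subring A -> submod A J -> prodI A J = J.
Proof.
move=> h hJ; apply: seteqE => x; split.
  by apply: (prodI_sub hJ) => a b ha hb; case: hJ => [_ [_ hM]]; exact: hM.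
by move=> hx; rewrite -(mul1r x); apply: prodI_mul => //; apply: subring1.
Qed.

Lemma dual_sym A J J' : dual A J J' -> dual A J' J.
Proof.
move=> [h1 [h2 [h3 h4]]]; split=> //; split=> //; split; last by rewrite prodIC.
by move=> p q hp hq; rewrite mulrC; exact: h3.
Qed.

Lemma dual_one A : subring A -> dual A A A.
Proof.
move=> h; split; first exact: submod_self.
split; first exact: submod_self.
split; first by move=> *; exact: subringM.
by rewrite -[1]mulr1; apply: prodI_mul; exact: subring1.
Qed.

(** Reduces invertibility to generators; extensions of constants, restrictions and glued ideals are
    all built this way. *)
Lemma dual_gen A P Q : subring A -> (forall p q, P p -> Q q -> A (p * q)) ->
  prodI P Q 1 -> dual A (prodI P A) (prodI Q A).
Proof.
move=> hA hPQ h1; have sA := submod_self hA.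
split; first exact: prodI_submodr.
split; first exact: prodI_submodr.
split; last by apply: prodI_mono h1 => p hp; rewrite -[p]mulr1;
  apply: prodI_mul => //; exact: subring1.
move=> p q hp hq; elim/prodI_ind: hp => [|x y|x y hx hy];
  [by rewrite mul0r; exact: subring0|by rewrite mulrDl; exact: subringD|].
elim/prodI_ind: hq => [|z t|z t hz ht];
  [by rewrite mulr0; exact: subring0|by rewrite mulrDr; exact: subringD|].
by rewrite mulrACA; apply: subringM; [| exact: hPQ| exact: subringM].
Qed.

Lemma dual_mul A J J' I I' : subring A -> dual A J J' -> dual A I I' ->
  dual A (prodI J I) (prodI J' I').
Proof.
move=> hA [j1 [j2 [j3 j4]]] [i1 [i2 [i3 i4]]].
split; first exact: prodI_submod.
split; first exact: prodI_submod.
split.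
  move=> p q hp hq; elim/prodI_ind: hp => [|x y|x y hx hy];
    [by rewrite mul0r; exact: subring0|by rewrite mulrDl; exact: subringD|].
  elim/prodI_ind: hq => [|z t|z t hz ht];
    [by rewrite mulr0; exact: subring0|by rewrite mulrDr; exact: subringD|].
  by rewrite mulrACA; apply: subringM => //; [exact: j3|exact: i3].
rewrite (_ : prodI _ _ = prodI (prodI J J') (prodI I I')).
  by rewrite -[1]mulr1; apply: prodI_mul.
by rewrite !prodIA; congr prodI; rewrite -!prodIA (prodIC I).
Qed.

Lemma dual_prod A J J' : subring A -> dual A J J' -> prodI J J' = A.
Proof.
move=> hA [j1 [j2 [j3 j4]]]; apply: seteqE => x; split.
  by apply: (prodI_sub (submod_self hA)).
move=> hx; rewrite -[x]mulr1.
by have [_ [_]] := prodI_submod J' j1; apply.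
Qed.
End Subrings.

(** * Discrete valuations *)

Section Valuation.
Variable K : fieldType.
Implicit Types (V : K -> Prop) (v : K -> int).

(** Nothing is imposed on [v 0], and the ultrametric inequality is recovered from closure of [V]
    under addition ([geD]). *)
Definition is_val V v :=
  subring V /\ (forall x y, x != 0 -> y != 0 -> v (x * y) = v x + v y) /\
  (forall x, x != 0 -> (V x <-> 0 <= v x)) /\ exists t, t != 0 /\ v t = 1.

Lemma DVR_val V : is_DVR V -> exists v, is_val V v.
Proof.
move=> [hV [t [Vt [nVt ht]]]].
have hV' : subring V := hV.
have t0 : t != 0 by apply: contra_notN nVt => /eqP->; rewrite invr0; exact: subring0.
have tE (n : nat) : V (t ^+ n) by exact: subringX.
have tz (n : int) : V (t ^ n) -> 0 <= n.
  case: n => // n; rewrite NegzE -exprnN => h; case: nVt.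
  have -> : t^-1 = t ^+ n * t ^- n.+1 by rewrite exprS invfM mulrCA divff ?mulr1 // expf_neq0.
  exact: subringM.
have tz0 (n : int) : V (t ^ n) -> V (t ^ (- n)) -> n = 0.
  by move=> /tz h /tz; rewrite oppr_ge0 => h'; apply/eqP; rewrite eq_le h h'.
have ex x : exists n : int, x != 0 -> V (x / t ^ n) /\ V (t ^ n / x).
  have [->|x0] := eqVneq x 0; first by exists 0.
  have [u [n [Vu [Vu' [e|e]]]]] := ht x x0.
  - exists n%:Z => _; have tn0 : t ^ n%:Z != 0 by rewrite expfz_neq0.
    rewrite e -exprnP mulfK //; split=> //.
    by rewrite invfM mulrCA divff ?mulr1.
  - exists (- n%:Z) => _; have tn0 : t ^+ n != 0 by rewrite expf_neq0.
    rewrite e -exprnN invrK mulfVK //; split=> //.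
    by rewrite invfM invrK mulrCA mulVf ?mulr1.
have [v hv] := choice ex.
have tB a b : t ^ (a - b) = t ^ a / t ^ b by rewrite expfzDr // invr_expz.
have tn a : t ^ a != 0 by rewrite expfz_neq0.
have vE x n : x != 0 -> V (x / t ^ n) -> V (t ^ n / x) -> v x = n.
  move=> x0 h1 h2; have [h3 h4] := hv x x0.
  apply/eqP; rewrite -subr_eq0; apply/eqP; apply: tz0; rewrite ?opprB tB.
    have -> : t ^ (v x) / t ^ n = (x / t ^ n) * (t ^ v x / x) by field; rewrite x0 tn.
    exact: subringM.
  have -> : t ^ n / t ^ (v x) = (x / t ^ v x) * (t ^ n / x) by field; rewrite x0 tn.
  exact: subringM.
exists v; split=> //; split.
  move=> x y x0 y0; have [h1 h2] := hv x x0; have [h3 h4] := hv y y0.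
  apply: vE; first by rewrite mulf_neq0.
    rewrite expfzDr // invfM mulrACA; exact: subringM.
  by rewrite expfzDr // invfM mulrACA; exact: subringM.
split.
  move=> x x0; have [h1 h2] := hv x x0; split=> [Vx|].
    apply: tz; have -> : t ^ v x = (t ^ v x / x) * x by rewrite mulfVK.
    exact: subringM.
  case: (v x) h1 => // n h1 _; have -> : x = (x / t ^ n%:Z) * t ^ n%:Z by rewrite mulfVK.
  by apply: subringM => //; exact: tE.
exists t; split=> //; apply: vE => //; rewrite expr1z divff //; exact: subring1.
Qed.

Variables (V : K -> Prop) (v : K -> int).
Hypothesis hv : is_val V v.

(** The first disjunct gives [0] infinite value, whatever [w 0] is. *)
Definition vge (w : K -> int) (n : int) x := x = 0 \/ n <= w x.

Lemma valM x y : x != 0 -> y != 0 -> v (x * y) = v x + v y.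
Proof. by case: hv => _ [h _]; exact: h. Qed.

Lemma val_one : v 1 = 0.
Proof.
have := valM (oner_neq0 K) (oner_neq0 K); rewrite mulr1 => h.
by apply: (addrI (v 1)); rewrite addr0 -h.
Qed.

Lemma valV x : x != 0 -> v x^-1 = - v x.
Proof.
move=> x0; apply/eqP; rewrite -addr_eq0 addrC; apply/eqP.
by rewrite -valM ?invr_eq0 // divff // val_one.
Qed.

Lemma ge0P x : V x <-> vge v 0 x.
Proof.
have [hV [_ [h _]]] := hv; have [->|x0] := eqVneq x 0.
  by split=> _; [left|exact: subring0].
rewrite h //; split=> [|[/eqP|//]]; first by right.
by rewrite (negbTE x0).
Qed.

Lemma valX x n : x != 0 -> v (x ^+ n) = v x *+ n.
Proof.
move=> x0; elim: n => [|n ih]; first by rewrite expr0 val_one.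
by rewrite exprS valM ?expf_neq0 // ih mulrS.
Qed.

Lemma exists_val (n : int) : exists s, s != 0 /\ v s = n.
Proof.
have [_ [_ [_ [t [t0 vt]]]]] := hv.
case: n => n; first by exists (t ^+ n); rewrite expf_neq0 // valX // vt natz.
exists (t ^- n.+1); rewrite invr_eq0 expf_neq0 //.
by rewrite valV ?expf_neq0 // valX // vt NegzE natz.
Qed.

(** Division by an element of value [n] carries the ball [vge v n] to [V], so the ball inherits its
    additive closure from the ring. *)
Lemma ge_div n s x : s != 0 -> v s = n -> vge v n x <-> V (x / s).
Proof.
move=> s0 vs; rewrite ge0P; have [->|x0] := eqVneq x 0.
  by rewrite mul0r; split=> _; left.
rewrite /vge valM ?invr_eq0 // valV // vs subr_ge0; split=> -[/eqP|]; try by right.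
  by rewrite (negbTE x0).
by rewrite mulf_eq0 invr_eq0 (negbTE x0) (negbTE s0).
Qed.

Lemma geP n x : x != 0 -> vge v n x <-> n <= v x.
Proof. by move=> x0; split=> [[/eqP|//]|]; [rewrite (negbTE x0)|right]. Qed.

Lemma geD n x y : vge v n x -> vge v n y -> vge v n (x + y).
Proof.
have [s [s0 vs]] := exists_val n; rewrite !(ge_div _ s0 vs) mulrDl.
by apply: subringD; case: hv.
Qed.

Lemma geN n x : vge v n x -> vge v n (- x).
Proof.
have [s [s0 vs]] := exists_val n; rewrite !(ge_div _ s0 vs) mulNr.
by apply: subringN; case: hv.
Qed.

Lemma geB n x y : vge v n x -> vge v n y -> vge v n (x - y).
Proof. by move=> hx hy; apply: geD => //; apply: geN. Qed.

Lemma geM n m x y : vge v n x -> vge v m y -> vge v (n + m) (x * y).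
Proof.
move=> [->|hx]; first by rewrite mul0r; left.
move=> [->|hy]; first by rewrite mulr0; left.
have [->|x0] := eqVneq x 0; first by rewrite mul0r; left.
have [->|y0] := eqVneq y 0; first by rewrite mulr0; left.
by right; rewrite valM // lerD.
Qed.

Lemma ge_le n m x : m <= n -> vge v n x -> vge v m x.
Proof. by move=> h [->|hx]; [left|right; exact: le_trans hx]. Qed.

Lemma ge_sum n (I : Type) (r : seq I) (P : pred I) (E : I -> K) :
  (forall i, vge v n (E i)) -> vge v n (\sum_(i <- r | P i) E i).
Proof.
by move=> h; elim/big_rec : _ => [|i x _ hx]; [left|exact: geD].
Qed.

Lemma ge_one n : vge v n 1 -> n <= 0.
Proof. by rewrite geP ?oner_neq0 // val_one. Qed.

Lemma ge_self x : vge v (v x) x. Proof. by right. Qed.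

Lemma geMl n x y : x != 0 -> vge v n (x * y) <-> vge v (n - v x) y.
Proof.
move=> x0; have [->|y0] := eqVneq y 0; first by rewrite mulr0; split; left.
by rewrite !geP ?mulf_neq0 // valM // lerBlDl.
Qed.

Lemma ge_horner m (p : {poly K}) x :
  (forall i, vge v m p`_i) -> vge v 0 x -> vge v m p.[x].
Proof.
move=> hp hx; rewrite horner_coef; apply: ge_sum => i.
rewrite -[m]addr0; apply: geM => //.
by elim: (i : nat) => [|k ih]; [right; rewrite expr0 val_one|
  rewrite exprS -[0]addr0; apply: geM].
Qed.

Lemma poly_bounded (p : {poly K}) : exists m : int, m <= 0 /\ forall i, vge v m p`_i.
Proof.
elim/poly_ind: p => [|p c [m [m0 hm]]].
  by exists 0; split=> // i; rewrite coef0; left.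
exists (Num.min m (v c)); split; first by rewrite ge_min m0.
move=> i; rewrite coefD coefMX coefC; case: i => [|i] /=.
  by rewrite add0r; apply: (@ge_le (v c)); [rewrite ge_min lexx orbT|right].
by rewrite addr0; apply: (@ge_le m); [rewrite ge_min lexx|].
Qed.

(** [x - y] divides every [x ^+ i - y ^+ i] with integral quotient, so the coefficient bound [m]
    gives a modulus of continuity. *)
Lemma ge_horner_sub m (p : {poly K}) x y n : (forall i, vge v m p`_i) ->
  vge v 0 x -> vge v 0 y -> vge v n (x - y) -> vge v (m + n) (p.[x] - p.[y]).
Proof.
move=> hp hx hy hxy; rewrite !horner_coef -sumrB; apply: ge_sum => i.
rewrite -mulrBr; apply: geM => //; rewrite subrXX -[n]addr0; apply: geM => //.
have gX z k : vge v 0 z -> vge v 0 (z ^+ k).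
  move=> hz; elim: k => [|k ih]; first by right; rewrite expr0 val_one.
  by rewrite exprS -[0]addr0; apply: geM.
by apply: ge_sum => j; rewrite -[0]addr0; apply: geM; exact: gX.
Qed.
End Valuation.

(** * The places of an almost Dedekind domain *)

Definition vM (K : fieldType) (D M : K -> Prop) : K -> int :=
  xget (fun=> 0) [set v | is_val (loc D M) v]%classic.

Section Places.
Variables (K : fieldType) (D : K -> Prop).
Hypothesis hD : almost_dedekind D.
Implicit Types (M I : K -> Prop).

Lemma ringD : subring D. Proof. by case: hD. Qed.
Hint Resolve ringD : core.

Lemma vMP M : maxideal D M -> is_val (loc D M) (vM D M).
Proof.
move=> hM; have [_ [_ h]] := hD; have [v hv] := DVR_val (h M hM).
exact: (xgetPex (fun=> 0) (ex_intro _ v hv)).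
Qed.

Lemma ideal_in_max I : is_ideal D I -> ~ I 1 ->
  exists M, maxideal D M /\ forall x, I x -> M x.
Proof.
move=> hI nI.
pose T := {J : K -> Prop | is_ideal D J /\ ~ J 1 /\ forall x, I x -> J x}.
have T_eq (s t : T) : sval s = sval t -> s = t.
  case: s t => [s hs] [t ht] /= e; subst t; congr exist; exact: Prop_irrelevance.
pose R (s t : T) := `[< forall x, sval s x -> sval t x >].
have [//|||A hA|[J [hJ [nJ IJ]]] hmax] := @Zorn T R.
- by move=> s; apply/asboolP.
- by move=> r s t /asboolP h /asboolP h'; apply/asboolP => x /h /h'.
- by move=> s t /asboolP h /asboolP h'; apply: T_eq; apply: seteqE => x; split; auto.
(* The empty chain is bounded by [I] itself, any other chain by its union. *)
- have [[s0 As0]|nA] := pselect (exists s, A s); last first.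
    exists (exist _ I (conj hI (conj nI (fun x h => h)))) => s As.
    by case: nA; exists s.
  pose U x := exists s : T, A s /\ sval s x.
  suff hU : is_ideal D U /\ ~ U 1 /\ forall x, I x -> U x.
    exists (exist _ U hU) => s As; apply/asboolP => x sx /=; by exists s.
  split; last split.
  + split; first by move=> x [s [_ sx]]; case: (svalP s) => -[h _] _; exact: h.
    split; first by exists s0; split=> //; case: (svalP s0) => -[_ []].
    split.
      move=> x y [s [As sx]] [t [At ty]].
      have [/asboolP st|/asboolP ts] := hA s t As At.
        by exists t; split=> //; case: (svalP t) => -[_ [_ [h _]]] _; apply: h => //; exact: st.
      by exists s; split=> //; case: (svalP s) => -[_ [_ [h _]]] _; apply: h => //; exact: ts.
    move=> a x Da [s [As sx]]; exists s; split=> //.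
    by case: (svalP s) => -[_ [_ [_ h]]] _; exact: h.
  + by move=> [s [_ s1]]; case: (svalP s) => _ [].
  + by move=> x Ix; exists s0; split=> //; case: (svalP s0) => _ [_]; apply.
exists J; split=> //; split=> //; split=> // L hL JL.
have [L1|nL1] := pselect (L 1); [by right|left].
have hL' : is_ideal D L /\ ~ L 1 /\ forall x, I x -> L x by do !split => //; auto.
have := hmax (exist _ L hL').
rewrite /R /=; move=> /(_ (asboolT JL)) /(congr1 sval) /= ->.
by move=> x.
Qed.

(** Quasi-compactness of the maximal spectrum in the form used throughout: [I] collects the elements
    for which some construction works, and a local solution at each [M] yields a global one. *)
Lemma local_global I : is_ideal D I ->
  (forall M, maxideal D M -> exists d, I d /\ ~ M d) -> I 1.
Proof.
move=> hI h; apply: contrapT => nI.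
have [M [hM IM]] := ideal_in_max hI nI.
by have [d [Id]] := h M hM; case; exact: IM.
Qed.

Section OnePlace.
Variable M : K -> Prop.
Hypothesis hM : maxideal D M.

Lemma maxD x : M x -> D x. Proof. by case: hM => -[h _] _; exact: h. Qed.
Lemma max1 : ~ M 1. Proof. by case: hM => _ []. Qed.
Lemma max0 : M 0. Proof. by case: hM => -[_ []]. Qed.
Lemma maxDD x y : M x -> M y -> M (x + y).
Proof. by case: hM => -[_ [_ [h _]]] _; exact: h. Qed.
Lemma maxM a x : D a -> M x -> M (a * x).
Proof. by case: hM => -[_ [_ [_ h]]] _; exact: h. Qed.
Lemma maxMr a x : D a -> M x -> M (x * a).
Proof. by rewrite mulrC; exact: maxM. Qed.
Lemma max_comax s : D s -> ~ M s -> exists m r, M m /\ D r /\ 1 = m + s * r.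
Proof.
move=> Ds nMs; have [_ [_ h]] := hM.
pose J x := exists m r, M m /\ D r /\ x = m + s * r.
have hJ : is_ideal D J.
  split; first by move=> x [m [r [/maxD ? [? ->]]]]; apply: subringD => //; exact: subringM.
  split; first by exists 0, 0; rewrite mulr0 addr0; split; [exact: max0|split=> //; exact: subring0].
  split.
    move=> x y [m [r [? [? ->]]]] [m' [r' [? [? ->]]]]; exists (m + m'), (r + r').
    by split; [exact: maxDD|split; [exact: subringD|ring]].
  move=> a x Da [m [r [? [? ->]]]]; exists (a * m), (a * r).
  by split; [exact: maxM|split; [exact: subringM|ring]].
have MJ x : M x -> J x.
  by move=> Mx; exists x, 0; rewrite mulr0 addr0; split=> //; split=> //; exact: subring0.
have [e|//] := h J hJ MJ; case: nMs; apply/(e s).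
exists 0, 1; rewrite mulr1 add0r; split; first exact: max0.
by split=> //; exact: subring1.
Qed.

Lemma max_prime a b : D a -> D b -> ~ M a -> ~ M b -> ~ M (a * b).
Proof.
move=> Da Db nMa nMb Mab; apply: nMb.
have [m [r [Mm [Dr e]]]] := max_comax Da nMa.
rewrite -[b]mul1r e mulrDl; apply: maxDD; first exact: maxMr.
by rewrite mulrAC; apply: maxMr.
Qed.

Lemma max_neq0 s : ~ M s -> s != 0.
Proof. by move=> h; apply/eqP => e; apply: h; rewrite e; exact: max0. Qed.

Lemma loc_sub x : D x -> loc D M x.
Proof.
move=> Dx; exists x, 1; rewrite divr1; split=> //; split; first exact: subring1.
by split=> //; exact: max1.
Qed.

Lemma loc_inv s : D s -> ~ M s -> loc D M s^-1.
Proof.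
move=> Ds nMs; exists 1, s; split; first exact: subring1.
by rewrite mul1r.
Qed.

Lemma loc_denom x : loc D M x -> exists d, D d /\ ~ M d /\ D (d * x).
Proof.
move=> [a [s [Da [Ds [nMs ->]]]]]; exists s; split=> //; split=> //.
by rewrite mulrCA divff ?mulr1 //; exact: max_neq0.
Qed.

Let hv := vMP hM.

Lemma locP x : loc D M x <-> vge (vM D M) 0 x. Proof. exact: (ge0P hv). Qed.

Lemma D_ge0 x : D x -> vge (vM D M) 0 x. Proof. by move=> /loc_sub /locP. Qed.

Lemma val_unit s : D s -> ~ M s -> vM D M s = 0.
Proof.
move=> Ds nMs; have s0 := max_neq0 nMs.
have := loc_inv Ds nMs; rewrite locP (geP _ _ (invr_neq0 s0)) (valV hv) //.
have := D_ge0 Ds; rewrite (geP _ _ s0); lia.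
Qed.

Lemma max_ge1 x : M x -> vge (vM D M) 1 x.
Proof.
move=> Mx; have Dx := maxD Mx; have [->|x0] := eqVneq x 0; first by left.
have := D_ge0 Dx; rewrite !(geP _ _ x0) => x_ge0.
rewrite -gtz0_ge1 lt0r x_ge0 andbT; apply/eqP => vx.
have : loc D M x^-1 by rewrite locP (geP _ _ (invr_neq0 x0)) (valV hv) // vx.
move=> /loc_denom [d [Dd [nMd Dx']]]; apply: nMd.
by rewrite -[d](mulfVK x0); apply: maxM.
Qed.

Lemma maxP x : D x -> M x <-> vge (vM D M) 1 x.
Proof.
move=> Dx; split; first exact: max_ge1.
move=> h; apply: contrapT => nMx; have := val_unit Dx nMx.
move: h; rewrite (geP _ _ (max_neq0 nMx)); lia.
Qed.

Lemma max_ge_X m (n : nat) : M m -> vge (vM D M) n (m ^+ n).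
Proof.
move=> Mm; elim: n => [|n ih]; first by right; rewrite expr0 (val_one hv).
by rewrite exprS -add1n PoszD; apply: (geM hv) => //; exact: max_ge1.
Qed.

Lemma val_ge0 x : D x -> x != 0 -> 0 <= vM D M x.
Proof. by move=> /D_ge0 h x0; move: h; rewrite geP. Qed.

Lemma density x (n : int) : loc D M x -> exists a, D a /\ vge (vM D M) n (x - a).
Proof.
suff H (k : nat) : loc D M x -> exists a, D a /\ vge (vM D M) k (x - a).
  move=> hx; have [a [Da ha]] := H `|n|%N hx; exists a; split=> //.
  by apply: (ge_le _ ha); lia.
move=> hx; have := hx; case=> [p [s [Dp [Ds [nMs e]]]]].
have [m [r [Mm [Dr e1]]]] := max_comax Ds nMs.
have s0 := max_neq0 nMs.
(* [s * r = 1 - m], so [r * \sum_(i < k) m ^+ i] inverts [s] up to the error [m ^+ k]. *)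
exists (p * r * \sum_(i < k) m ^+ i); split.
  apply: subringM => //; first exact: subringM.
  by apply: subring_sum => // i; apply: subringX => //; exact: maxD.
have -> : x - p * r * \sum_(i < k) m ^+ i = x * m ^+ k.
  have e2 : s * r = 1 - m by rewrite e1; ring.
  have e3 := subrX1 m k.
  have -> : m ^+ k = 1 - (1 - m) * \sum_(i < k) m ^+ i.
    by rewrite -{1}[m ^+ k](subrK 1) e3; ring.
  by rewrite -e2 e; field.
rewrite -[k%:Z]add0r; apply: (geM hv); last exact: max_ge_X.
exact/locP.
Qed.
End OnePlace.

(** The denominators of [x] form an ideal of [D] that is contained in no [M]. *)
Lemma D_cap x : (forall M, maxideal D M -> loc D M x) -> D x.
Proof.
move=> hx; pose I d := D d /\ D (d * x).
suff : I 1 by rewrite /I mul1r => -[].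
apply: local_global.
  split; first by move=> d [].
  split; first by rewrite /I mul0r; split; exact: subring0.
  split.
    by move=> a b [? ?] [? ?]; rewrite /I mulrDl; split; exact: subringD.
  by move=> a b ? [? ?]; rewrite /I -mulrA; split; exact: subringM.
move=> M hM; have [d [Dd [nMd Ddx]]] := loc_denom hM (hx M hM).
by exists d.
Qed.

(** Modulo [c] some power of [d] satisfies [d ^+ n = d ^+ n.+1 * a]: locally one takes exponent [0]
    where [d] is a unit and the value of [c] where [d] lies in [M], and [local_global] makes this
    global. A power of [d * a] is then idempotent modulo [c], and it is congruent to [1] where [d]
    is a unit and to [0] elsewhere. *)
Lemma near_idempotent c d : D c -> c != 0 -> D d ->
  exists e, (exists2 y, D y & e = d * y) /\ (exists2 k, D k & e * (1 - e) = c * k) /\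
    forall M, maxideal D M ->
      (~ M d -> vge (vM D M) (vM D M c) (1 - e)) /\ (M d -> vge (vM D M) (vM D M c) e).
Proof.
move=> Dc c0 Dd.
pose I z := D z /\ exists n a b, D a /\ D b /\ z * d ^+ n = d ^+ n.+1 * a + c * b.
have dX n : D (d ^+ n) by exact: subringX.
have D0 : D 0 by exact: subring0.
have D1 : D 1 by exact: subring1.
have : I 1.
  apply: local_global.
    split; first by move=> z [].
    split.
      by split=> //; exists 0%N, 0, 0; do 2 split=> //; rewrite mul0r !mulr0 addr0.
    split.
      move=> x y [Dx [n [a [b [Da [Db e]]]]]] [Dy [n' [a' [b' [Da' [Db' e']]]]]].
      split; first exact: subringD.
      exists (n + n')%N, (a + a'), (b * d ^+ n' + b' * d ^+ n).
      split; first exact: subringD.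
      split; first by apply: subringD => //; exact: subringM.
      have -> : (x + y) * d ^+ (n + n') = (x * d ^+ n) * d ^+ n' + (y * d ^+ n') * d ^+ n.
        by rewrite exprD; ring.
      by rewrite e e' !exprS exprD; ring.
    move=> x y Dx [Dy [n [a [b [Da [Db e]]]]]]; split; first exact: subringM.
    exists n, (x * a), (x * b); split; first exact: subringM.
    by split; [exact: subringM|rewrite -mulrA e; ring].
  move=> M hM; have hv := vMP hM.
  have [Md|nMd] := pselect (M d); last first.
    exists d; split=> //; split=> //; exists 0%N, 1, 0; do 2 split=> //.
    by rewrite !mulr1 mulr0 addr0.
  have [n vn] : exists n : nat, vM D M c = n.
    by have := val_ge0 hM Dc c0; case: (vM D M c) => // n _; exists n.
  have := max_ge_X hM n Md; rewrite (ge_div hv _ c0 vn).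
  move=> /(loc_denom hM) [z [Dz [nMz h]]]; exists z; split=> //; split=> //.
  exists n, 0, (z * (d ^+ n / c)); do 2 split=> //.
  by rewrite mulr0 add0r; field.
case=> _ [n [a [b [Da [Db]]]]]; rewrite mul1r => e.
(* The exponent is raised by one so that [e] is a multiple of [d] even when [n] is [0]. *)
pose m := n.+1.
have e1 : d ^+ m = d ^+ m.+1 * a + c * (d * b) by rewrite /m 2!exprS e -!exprS; rewrite !exprS; ring.
have [b' Db' e2] : exists2 b', D b' & d ^+ m = d ^+ m * (d * a) ^+ m + c * b'.
  suff H k : exists2 b', D b' & d ^+ m = d ^+ m * (d * a) ^+ k + c * b' by exact: H.
  elim: k => [|k [b' Db' e2]]; first by exists 0; rewrite // expr0 mulr0 mulr1 addr0.
  exists (b' + (d * a) ^+ k * (d * b)).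
    apply: subringD => //; apply: subringM => //; last exact: subringM.
    by apply: subringX => //; exact: subringM.
  rewrite {1}e2 {1}e1 !exprS; ring.
exists ((d * a) ^+ m).
have De : D ((d * a) ^+ m) by apply: subringX => //; exact: subringM.
have key : (d * a) ^+ m * (1 - (d * a) ^+ m) = c * (b' * a ^+ m).
  have : d ^+ m * (1 - (d * a) ^+ m) = c * b' by rewrite mulrBr mulr1 {1}e2; ring.
  move=> h; rewrite {1}exprMn mulrAC h; ring.
split.
  exists (a * (d * a) ^+ n); last by rewrite exprS mulrA.
  by apply: subringM => //; apply: subringX => //; exact: subringM.
split; first by exists (b' * a ^+ m) => //; apply: subringM => //; exact: subringX.
move=> M hM; have hv := vMP hM; split=> [nMd|Md].
  have : d ^+ m * (1 - (d * a) ^+ m) = c * b' by rewrite mulrBr mulr1 {1}e2; ring.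
  have d0 := max_neq0 hM nMd.
  move=> h; have : vge (vM D M) (vM D M c) (d ^+ m * (1 - (d * a) ^+ m)).
    rewrite h -[vM D M c]addr0; apply: (geM hv); last exact: (D_ge0 hM).
    exact: ge_self.
  by rewrite (geMl hv) ?expf_neq0 // (valX hv) // (val_unit hM Dd nMd) mul0rn subr0.
have Me : M ((d * a) ^+ m).
  by rewrite exprS; apply: (maxMr hM); [apply: subringX => //; exact: subringM|apply: (maxMr hM)].
have nM1e : ~ M (1 - (d * a) ^+ m).
  by move=> h; apply: (max1 hM); rewrite -[1](subrK ((d * a) ^+ m)); apply: (maxDD hM).
have D1e : D (1 - (d * a) ^+ m) by exact: subringB.
have : vge (vM D M) (vM D M c) ((1 - (d * a) ^+ m) * (d * a) ^+ m).
  rewrite mulrC key -[vM D M c]addr0; apply: (geM hv); first exact: ge_self.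
  by apply: (D_ge0 hM); apply: subringM => //; exact: subringX.
by rewrite (geMl hv) ?(max_neq0 hM nM1e) // (val_unit hM D1e nM1e) subr0.
Qed.
End Places.

(** * Value functions of invertible ideals *)

Lemma invertible_dual (F : fieldType) (A I : F -> Prop) : subring A ->
  invertible A I -> exists I', dual A I I'.
Proof.
move=> hA [[I0 [ID [IM _]]] [I' [[I0' [ID' [IM' _]]] e]]]; exists I'.
split; first by split.
split; first by split.
split; last by apply/e; exact: subring1.
by move=> p q hp hq; apply/e; exact: prodI_mul.
Qed.

Lemma dual_nonzero (F : comNzRingType) (A I I' : F -> Prop) : dual A I I' ->
  exists2 q, I' q & q != 0.
Proof.
move=> [_ [_ [_ h1]]]; apply: contrapT => h.
suff : (1 : F) = 0 by apply/eqP; exact: oner_neq0.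
elim/prodI_ind: h1 => [//|x y -> ->|x y _ hy]; first by rewrite addr0.
have [->|y0] := eqVneq y 0; first by rewrite mulr0.
by case: h; exists y.
Qed.

Lemma dual_fracideal (F : fieldType) (A I I' : F -> Prop) : subring A ->
  quotfield A -> dual A I I' -> fracideal A I.
Proof.
move=> hA hq h; have [[I0 [ID IM]] [[I0' [ID' IM']] [hp _]]] := h.
do 3 split=> //.
have [q hq' q0] := dual_nonzero h.
have [a [b [Aa [Ab [b0 e]]]]] := hq q.
exists a; split=> //; split.
  by apply: contraNneq q0 => a0; rewrite e a0 mul0r.
move=> x hx; have -> : a * x = b * (x * q) by rewrite e; field.
by apply: subringM => //; exact: hp.
Qed.

Lemma dual_invertible (F : fieldType) (A I I' : F -> Prop) : subring A ->
  quotfield A -> dual A I I' -> invertible A I.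
Proof.
move=> hA hq h; split; first exact: (dual_fracideal hA hq h).
exists I'; split; first exact: (dual_fracideal hA hq (dual_sym h)).
by rewrite (dual_prod hA h).
Qed.

(** The inverse is the whole colon module: multiply an expression of [1] in [prodI I I'] by [q]. *)
Lemma dual_colon (F : comNzRingType) (A I I' : F -> Prop) q : dual A I I' ->
  (forall p, I p -> A (p * q)) -> I' q.
Proof.
move=> [_ [[h0 [hD hM]] [_ h1]]] hq; rewrite -[q]mul1r.
elim/prodI_ind: h1 => [|x y|x y hx hy]; first by rewrite mul0r.
  by rewrite mulrDl; exact: hD.
by rewrite mulrAC; apply: hM => //; exact: hq.
Qed.

Section IntegerValued.
Variables (K : fieldType) (D : K -> Prop).
Hypothesis hD : almost_dedekind D.
Let hR := ringD hD.
Hint Resolve hR : core.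
Implicit Types (S : (K -> Prop) -> Prop) (M : K -> Prop) (J I : {poly K} -> Prop).

Definition capS S : K -> Prop := fun x => forall M, S M -> loc D M x.
(** Polynomials are evaluated at points of [D] rather than of [capS S], so that value functions for
    different [S] have the same arguments. By density of [D] in each [loc D M] this is still the
    ring of integer-valued polynomials of [capS S] ([Int_capS]). *)
Definition IntS S : {poly K} -> Prop :=
  fun f => forall M a, S M -> D a -> vge (vM D M) 0 f.[a].

Definition maxset S := forall M, S M -> maxideal D M.

Lemma capS_ring S : maxset S -> subring (capS S).
Proof.
move=> hS; split; first by move=> M /hS hM; apply: (loc_sub hD hM); exact: subring1.
split=> x y hx hy M SM; have hM := hS M SM.
  by rewrite (locP hD hM); apply: (geB (vMP hD hM)); rewrite -(locP hD hM); auto.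
by rewrite (locP hD hM) -[0]addr0; apply: (geM (vMP hD hM)); rewrite -(locP hD hM); auto.
Qed.

Lemma capS_D S : maxset S -> forall x, D x -> capS S x.
Proof. by move=> hS x Dx M /hS hM; exact: loc_sub. Qed.

Lemma quot_D : quotfield D. Proof. by case: hD => _ []. Qed.

Lemma capS_quot S : maxset S -> quotfield (capS S).
Proof.
move=> hS x; have [a [b [Da [Db [b0 e]]]]] := quot_D x.
by exists a, b; split; [exact: capS_D|split; [exact: capS_D|]].
Qed.

Lemma IntS_ring S : maxset S -> subring (IntS S).
Proof.
move=> hS; split.
  by move=> M a /hS hM Da; rewrite hornerC; apply: (D_ge0 hD hM); exact: subring1.
split=> f g hf hg M a SM Da; have hM := hS M SM.
  by rewrite hornerD hornerN; apply: (geB (vMP hD hM)); auto.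
by rewrite hornerM -[0]addr0; apply: (geM (vMP hD hM)); auto.
Qed.

Lemma IntSC S c : maxset S -> capS S c -> IntS S c%:P.
Proof. by move=> hS hc M a SM Da; rewrite hornerC -(locP hD (hS M SM)); exact: hc. Qed.

Lemma Int_capS S : maxset S -> Int (capS S) = IntS S.
Proof.
move=> hS; apply: seteqE => f; split.
  move=> hf M a SM Da; have hM := hS M SM.
  by rewrite -(locP hD hM); apply: (hf a) => //; exact: capS_D.
move=> hf x hx M SM; have hM := hS M SM; have hv := vMP hD hM.
have [m [_ hm]] := poly_bounded (vM D M) f.
(* With [a] this close to [x], the coefficient bound [m] leaves [f.[x] - f.[a]] integral. *)
have [a [Da ha]] := density hD hM (- m) (hx M SM).
rewrite (locP hD hM) -[f.[x]](subrK f.[a]); apply: (geD hv); last exact: hf.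
rewrite -(subrr m); apply: (ge_horner_sub hv) => //; last exact: (D_ge0 hD hM).
by rewrite -(locP hD hM); exact: hx.
Qed.

Lemma IntS_mono S S' f : (forall M, S' M -> S M) -> IntS S f -> IntS S' f.
Proof. by move=> h hf M a /h SM Da; exact: hf. Qed.

Lemma clear_denom (f : {poly K}) : exists r, D r /\ r != 0 /\ forall i, D (r * f`_i).
Proof.
elim/poly_ind: f => [|f c [r [Dr [r0 h]]]].
  exists 1; split; first exact: subring1.
  split; first exact: oner_neq0.
  by move=> i; rewrite coef0 mulr0; exact: subring0.
have [a [b [Da [Db [b0 e]]]]] := quot_D c.
exists (r * b); split; first exact: subringM.
split; first by rewrite mulf_neq0.
move=> i; rewrite coefD coefMX coefC; case: i => [|i] /=.
  rewrite add0r e; have -> : r * b * (a / b) = r * a by field.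
  exact: subringM.
by rewrite addr0 mulrAC; exact: subringM.
Qed.

Lemma IntS_coef S (f : {poly K}) : maxset S -> (forall i, D f`_i) -> IntS S f.
Proof.
move=> hS h M a SM Da; have hM := hS M SM.
by apply: (ge_horner (vMP hD hM)) => [i|]; apply: (D_ge0 hD hM).
Qed.

Lemma clear_IntS (f : {poly K}) : exists r, D r /\ r != 0 /\
  forall S, maxset S -> IntS S (r%:P * f).
Proof.
have [r [Dr [r0 h]]] := clear_denom f; exists r; do 2 split=> //.
by move=> S hS; apply: IntS_coef => // i; rewrite coefCM.
Qed.

(** When [prodI J J'] contains [1] the two lower bounds are sharp and determine [n] ([isval_uniq]).
    In this form, exchanging [J] and [J'] just changes the sign. *)
Definition isval M a J J' n :=
  (forall p, J p -> vge (vM D M) n p.[a]) /\ (forall q, J' q -> vge (vM D M) (- n) q.[a]).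

(* For dual [J] and [J'] the fractional ideal [{p(a) : p in J}] of the valuation ring
   at [M] consists of the elements of value at least [Phi J J' M a]. *)
Definition Phi J J' M a : int := xget 0 [set n | isval M a J J' n]%classic.

Lemma val_compare M a (P Q : {poly K} -> Prop) n m : maxideal D M -> prodI P Q 1 ->
  (forall p, P p -> vge (vM D M) n p.[a]) -> (forall q, Q q -> vge (vM D M) m q.[a]) ->
  n + m <= 0.
Proof.
move=> hM h1 hp hq; have hv := vMP hD hM; apply: (ge_one hv).
rewrite -(hornerC 1 a) polyC1; elim/prodI_ind: h1 => [|x y|x y hx hy].
- by rewrite horner0; left.
- by rewrite hornerD; exact: (geD hv).
- by rewrite hornerM; apply: (geM hv); auto.
Qed.

Lemma isval_uniq M a J J' n m : maxideal D M -> prodI J J' 1 ->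
  isval M a J J' n -> isval M a J J' m -> n = m.
Proof.
move=> hM h1 [h2 h3] [h4 h5].
have := val_compare hM h1 h2 h5; have := val_compare hM h1 h4 h3; lia.
Qed.

Lemma isval_ex S M a J J' : maxset S -> dual (IntS S) J J' -> S M -> D a ->
  exists n, isval M a J J' n.
Proof.
move=> hS [_ [_ [hB [n [p [q [hp [hq e]]]]]]]] SM Da.
have hM := hS M SM; have hv := vMP hD hM.
(* The terms sum to [1], so one of them has value at most [0] at [a]; integrality makes that value
   [0], and then [p i] attains the minimum over [J] and [q i] the one over [J']. *)
have [i hi] : exists i, ~ vge (vM D M) 1 (p i * q i).[a].
  apply: contrapT => h; suff : vge (vM D M) 1 1 by move/(ge_one hv).
  rewrite -(hornerC 1 a) polyC1 e horner_sum; apply: (ge_sum hv) => i.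
  by apply: contrapT => h'; apply: h; exists i.
have pq0 : (p i * q i).[a] != 0 by apply/eqP => h; apply: hi; rewrite h; left.
have := pq0; rewrite hornerM mulf_eq0 negb_or => /andP[p0 q0].
have h0 : vM D M (p i).[a] + vM D M (q i).[a] = 0.
  rewrite -(valM hv) // -hornerM; have := hB _ _ (hp i) (hq i) _ _ SM Da.
  move: hi; rewrite !geP //; move: (vM _ _ _) => z h1 h2; lia.
exists (vM D M (p i).[a]); split=> [r hr|r hr].
  have := hB _ _ hr (hq i) _ _ SM Da; rewrite hornerM mulrC (geMl hv) //.
  by rewrite -h0 addrK.
by have := hB _ _ (hp i) hr _ _ SM Da; rewrite hornerM (geMl hv) // sub0r.
Qed.

Section Value.
Variables (S : (K -> Prop) -> Prop).
Hypothesis hS : maxset S.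

Lemma PhiP M a J J' : dual (IntS S) J J' -> S M -> D a ->
  isval M a J J' (Phi J J' M a).
Proof.
by move=> h SM Da; have [n hn] := isval_ex hS h SM Da; exact: (xgetPex 0 (ex_intro _ n hn)).
Qed.

Lemma PhiE M a J J' n : dual (IntS S) J J' -> S M -> D a ->
  isval M a J J' n -> Phi J J' M a = n.
Proof.
move=> h SM Da; have [_ [_ [_ h1]]] := h.
exact: isval_uniq (hS SM) h1 (PhiP h SM Da).
Qed.

Lemma isval_gen M a (P Q : {poly K} -> Prop) n : S M -> D a ->
  (forall p, P p -> vge (vM D M) n p.[a]) -> (forall q, Q q -> vge (vM D M) (- n) q.[a]) ->
  isval M a (prodI P (IntS S)) (prodI Q (IntS S)) n.
Proof.
move=> SM Da hP hQ; have hv := vMP hD (hS SM).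
split=> p; elim/prodI_ind => [|x y|x y hx hy].
- by rewrite horner0; left.
- by rewrite hornerD; exact: (geD hv).
- by rewrite hornerM -[n]addr0; apply: (geM hv); [exact: hP|exact: hy].
- by rewrite horner0; left.
- by rewrite hornerD; exact: (geD hv).
- by rewrite hornerM -[- n]addr0; apply: (geM hv); [exact: hQ|exact: hy].
Qed.

Lemma Phi_mul M a J J' I I' : dual (IntS S) J J' -> dual (IntS S) I I' -> S M -> D a ->
  Phi (prodI J I) (prodI J' I') M a = Phi J J' M a + Phi I I' M a.
Proof.
move=> hJ hI SM Da; have hv := vMP hD (hS SM).
have [j1 j2] := PhiP hJ SM Da; have [i1 i2] := PhiP hI SM Da.
apply: PhiE => //; first by apply: dual_mul => //; exact: IntS_ring.
split=> p; elim/prodI_ind => [|x y|x y hx hy].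
- by rewrite horner0; left.
- by rewrite hornerD; exact: (geD hv).
- by rewrite hornerM; apply: (geM hv); auto.
- by rewrite horner0; left.
- by rewrite hornerD; exact: (geD hv).
- by rewrite hornerM opprD; apply: (geM hv); auto.
Qed.

Lemma Phi_sym M a J J' : dual (IntS S) J J' -> S M -> D a ->
  Phi J' J M a = - Phi J J' M a.
Proof.
move=> h SM Da; have [h1 h2] := PhiP h SM Da; apply: PhiE => //; first exact: dual_sym.
by split=> //; rewrite opprK.
Qed.

Lemma Phi_one M a : S M -> D a -> Phi (IntS S) (IntS S) M a = 0.
Proof.
move=> SM Da; apply: PhiE => //; first by apply: dual_one; exact: IntS_ring.
by rewrite /isval oppr0; split=> p hp; exact: hp.
Qed.

(** The value function determines the ideal: such a [p] multiplies [J'] into the ring, and [J] is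
    the colon of [J']. *)
Lemma dual_det J J' p : dual (IntS S) J J' ->
  (forall M a, S M -> D a -> vge (vM D M) (Phi J J' M a) p.[a]) -> J p.
Proof.
move=> h hp; apply: (dual_colon (dual_sym h)) => q hq M a SM Da.
have hv := vMP hD (hS SM); have [_ h2] := PhiP h SM Da.
rewrite hornerM -(subrr (Phi J J' M a)) addrC; apply: (geM hv); auto.
Qed.

Lemma const_dual L L' : dual (capS S) L L' ->
  dual (IntS S) (prodI (constP L) (IntS S)) (prodI (constP L') (IntS S)) /\
  forall M a, S M -> D a ->
    Phi (prodI (constP L) (IntS S)) (prodI (constP L') (IntS S)) M a =
    Phi (prodI (constP L) (IntS S)) (prodI (constP L') (IntS S)) M 0.
Proof.
move=> [l1 [l2 [l3 l4]]]; have hB := IntS_ring hS.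
have h1 : IntS S 1 by exact: subring1.
have hd : dual (IntS S) (prodI (constP L) (IntS S)) (prodI (constP L') (IntS S)).
  apply: (dual_gen hB).
    move=> _ _ [l [hl ->]] [l' [hl' ->]]; rewrite -polyCM; apply: IntSC => //.
    exact: l3.
  case: l4 => n [p [q [hp [hq e]]]].
  exists n, (fun i => (p i)%:P), (fun i => (q i)%:P); split; first by move=> i; exists (p i).
  split; first by move=> i; exists (q i).
  by rewrite -polyC1 e rmorph_sum /=; apply: eq_bigr => i _; rewrite -polyCM.
split=> // M a SM Da; apply: PhiE => //.
have D0 : D 0 by exact: subring0.
have [i1 i2] := PhiP hd SM D0; apply: isval_gen => // _ [l [hl ->]].
  have := i1 l%:P; rewrite !hornerC; apply.
  by rewrite -[l%:P]mulr1; apply: prodI_mul => //; exists l.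
have := i2 l%:P; rewrite !hornerC; apply.
by rewrite -[l%:P]mulr1; apply: prodI_mul => //; exists l.
Qed.

Lemma eval0_dual J J' : dual (IntS S) J J' ->
  dual (capS S) (fun x => exists p, J p /\ x = p.[0]) (fun x => exists p, J' p /\ x = p.[0]).
Proof.
move=> [j1 [j2 [j3 j4]]]; have D0 : D 0 by exact: subring0.
have hsub I : submod (IntS S) I -> submod (capS S) (fun x => exists p, I p /\ x = p.[0]).
  move=> [i1 [i2 i3]]; split; first by exists 0; rewrite horner0.
  split.
    by move=> x y [p [hp ->]] [q [hq ->]]; exists (p + q); rewrite hornerD; split; auto.
  move=> a x ha [p [hp ->]]; exists (a%:P * p); rewrite hornerM hornerC; split=> //.
  by apply: i3 => //; exact: IntSC.
split; first exact: hsub.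
split; first exact: hsub.
split.
  move=> _ _ [p [hp ->]] [q [hq ->]] M SM; rewrite (locP hD (hS SM)) -hornerM.
  exact: j3.
case: j4 => n [p [q [hp [hq e]]]].
exists n, (fun i => (p i).[0]), (fun i => (q i).[0]).
split; first by move=> i; exists (p i).
split; first by move=> i; exists (q i).
by rewrite -(hornerC 1 0) polyC1 e horner_sum; apply: eq_bigr => i _; rewrite hornerM.
Qed.

(** Take for [L] the values at [0] of the elements of [J]. Its extension has the same value function
    as [J], and [dual_det] gives both inclusions. *)
Lemma const_char J J' : dual (IntS S) J J' ->
  (forall M a, S M -> D a -> Phi J J' M a = Phi J J' M 0) ->
  exists L L', dual (capS S) L L' /\ J = prodI (constP L) (IntS S).
Proof.
move=> h hc; have D0 : D 0 by exact: subring0.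
have hL := eval0_dual h; set L := fun x => _ in hL; set L' := fun x => _ in hL.
exists L, L'; split=> //.
have [hd hdc] := const_dual hL.
have e M a : S M -> D a ->
    Phi (prodI (constP L) (IntS S)) (prodI (constP L') (IntS S)) M a = Phi J J' M a.
  move=> SM Da; rewrite hdc // hc //; apply: PhiE => //.
  have [h1 h2] := PhiP h SM D0.
  by apply: isval_gen => // _ [_ [[r [hr ->]] ->]]; rewrite hornerC; [exact: h1|exact: h2].
apply: seteqE => p; split=> hp.
  apply: (dual_det hd) => M a SM Da; rewrite e //.
  by have [h1 _] := PhiP h SM Da; exact: h1.
apply: (dual_det h) => M a SM Da; rewrite -e //.
by have [h1 _] := PhiP hd SM Da; exact: h1.
Qed.
End Value.

Lemma restrict_dual S S' J J' : maxset S -> maxset S' -> (forall M, S' M -> S M) ->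
  dual (IntS S) J J' ->
  dual (IntS S') (prodI J (IntS S')) (prodI J' (IntS S')) /\
  forall M a, S' M -> D a -> Phi (prodI J (IntS S')) (prodI J' (IntS S')) M a = Phi J J' M a.
Proof.
move=> hS hS' sub hJ; have [j1 [j2 [j3 j4]]] := hJ.
have hB := IntS_ring hS'.
have hd : dual (IntS S') (prodI J (IntS S')) (prodI J' (IntS S')).
  by apply: dual_gen => // p q hp hq; apply: (IntS_mono sub); exact: j3.
split=> // M a S'M Da; apply: (PhiE hS') => //.
by have [i1 i2] := PhiP hS hJ (sub _ S'M) Da; exact: isval_gen.
Qed.
End IntegerValued.

(** * Fractional ideals of the field of rational functions *)

Local Open Scope quotient_scope.

Lemma fraction_ex (R : idomainType) (x : {fraction R}) :
  exists n m : R, m != 0 /\ x = FracField.tofrac n / FracField.tofrac m.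
Proof.
elim/quotW: x => r; exists (frac r).1, (frac r).2; rewrite denom_ratioP; split=> //.
have d0 : (frac r).2 != 0 by exact: denom_ratioP.
apply: (canRL (mulfK _)); first by rewrite tofrac_eq0.
unlock FracField.tofrac; rewrite -[LHS]FracField.pi_mul; apply/eqmodP; apply/eqP.
by rewrite /FracField.mulf /= !numden_Ratio ?mulf_neq0 ?oner_neq0 //; ring.
Qed.

(* Working in an abstract field [F] containing [{poly K}] keeps conversion from
   unfolding the quotient construction of [{fraction {poly K}}]. *)
Section FractionIdeals.
Variables (K F : fieldType) (tf : {rmorphism {poly K} -> F}).
Hypothesis tf_inj : injective tf.
Implicit Types (A B J I : {poly K} -> Prop) (x y : F).

Definition imF x J : F -> Prop := fun y => exists p, J p /\ y = x * tf p.

Lemma tf_eq0 p : (tf p == 0) = (p == 0).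
Proof. by rewrite -(inj_eq tf_inj) rmorph0. Qed.

Lemma imF_scale x y J : scale x (imF y J) = imF (x * y) J.
Proof.
apply: seteqE => z; split=> [[_ [[p [hp ->]] ->]]|[p [hp ->]]].
  by exists p; rewrite mulrA.
by exists (y * tf p); rewrite mulrA; split=> //; exists p.
Qed.

Lemma imF_prod x y J I : prodI (imF x J) (imF y I) = imF (x * y) (prodI J I).
Proof.
apply: seteqE => z; split.
  elim/prodI_ind => [|a b|_ _ [p [hp ->]] [q [hq ->]]].
  - by exists 0; rewrite rmorph0 mulr0; split=> //; exact: prodI0.
  - move=> [p [hp ->]] [q [hq ->]]; exists (p + q); rewrite rmorphD mulrDr.
    by split=> //; exact: prodID.
  - by exists (p * q); rewrite rmorphM mulrACA; split=> //; exact: prodI_mul.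
move=> [w [hw ->]]; elim/prodI_ind: hw => [|a b ha hb|p q hp hq].
- by rewrite rmorph0 mulr0; exact: prodI0.
- by rewrite rmorphD mulrDr; exact: prodID.
- by rewrite rmorphM mulrACA; apply: prodI_mul; [exists p|exists q].
Qed.

Lemma imF_ring B : subring B -> subring (imF 1 B).
Proof.
move=> hB; split; first by exists 1; rewrite rmorph1 mulr1; split=> //; exact: subring1.
split=> _ _ [p [hp ->]] [q [hq ->]].
  exists (p - q); rewrite rmorphB !mul1r; split=> //; exact: (subringB hB).
by exists (p * q); rewrite rmorphM !mul1r; split=> //; exact: (subringM hB).
Qed.

Lemma imF_dual B x J J' : subring B -> x != 0 -> dual B J J' ->
  dual (imF 1 B) (imF x J) (imF x^-1 J').
Proof.
move=> hB x0 [j1 [j2 [j3 j4]]].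
have hsub y I : submod B I -> submod (imF 1 B) (imF y I).
  move=> [i1 [i2 i3]]; split; first by exists 0; rewrite rmorph0 mulr0.
  split=> [_ _ [p [hp ->]] [q [hq ->]]|_ _ [p [hp ->]] [q [hq ->]]].
    by exists (p + q); rewrite rmorphD mulrDr; split; auto.
  by exists (p * q); rewrite rmorphM mul1r mulrCA; split; auto.
split; first exact: hsub.
split; first exact: hsub.
split.
  move=> _ _ [p [hp ->]] [q [hq ->]]; exists (p * q); split; first exact: j3.
  by rewrite rmorphM mulrACA divff.
by rewrite imF_prod divff //; exists 1; rewrite rmorph1 mulr1.
Qed.

(* [x] is a generator of the principal fractional ideal [I K[X]]. *)
Lemma invertible_imF B (I : F -> Prop) : subring B -> invertible (imF 1 B) I ->
  exists x J J', x != 0 /\ dual B J J' /\ I = imF x J.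
Proof.
move=> hB /(invertible_dual (imF_ring hB)) [I' hI].
have [i1 [i2 [i3 i4]]] := hI.
have [q0 Iq0 q00] := dual_nonzero hI.
have [y0 Iy0 y00] := dual_nonzero (dual_sym hI).
have pol y z : I y -> I' z -> exists f, y * z = tf f.
  by move=> hy hz; have [f [_ e]] := i3 y z hy hz; exists f; rewrite e mul1r.
(* [W] is [I K[X]]. Multiplication by [q0] turns it into the ideal [P] of [{poly K}]; an element [g]
   of least degree generates [P], so [g / q0] generates [W]. *)
pose W := prodI (fun z => exists u, z = tf u) I.
pose P f := W (tf f / q0).
have PM u f : P f -> P (u * f).
  rewrite /P rmorphM -mulrA; elim/prodI_ind => [|a b ha hb|_ b [v ->] hb].
  - by rewrite mulr0; exact: prodI0.
  - by rewrite mulrDr; exact: prodID.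
  - by rewrite mulrA -rmorphM; apply: prodI_mul => //; exists (u * v).
have PB f g : P f -> P g -> P (f - g).
  move=> hf hg; rewrite /P rmorphB mulrBl; apply: prodID => //.
  by rewrite -mulNr -rmorphN -mulN1r; exact: PM.
have IP y f : I y -> y * q0 = tf f -> P f.
  move=> hy e; rewrite /P; have -> : tf f / q0 = 1 * y.
    rewrite -e.
    rewrite mul1r.
    exact: (mulfK q00).
  by apply: prodI_mul; [exists 1; rewrite rmorph1|exact: hy].
have [f0 e0] := pol _ _ Iy0 Iq0.
have f00 : f0 != 0.
  by apply: contraNneq (mulf_neq0 y00 q00) => h; rewrite e0 h rmorph0.
pose Q n := `[< exists2 g, P g & g != 0 /\ size g = n >].
have exQ : exists n, Q n by exists (size f0); apply/asboolP; exists f0 => //; exact: (IP y0).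
case: (ex_minnP exQ) => n /asboolP [g Pg [g0 sg]] hmin.
have gdiv f : P f -> f = f %/ g * g.
  move=> Pf; rewrite {1}(divp_eq f g); suff -> : f %% g = 0 by rewrite addr0.
  apply/eqP; apply: contraT => r0.
  have : Q (size (f %% g)).
    apply/asboolP; exists (f %% g) => //.
    have -> : f %% g = f - f %/ g * g by rewrite {2}(divp_eq f g) addrC addKr.
    by apply: PB => //; exact: PM.
  by move/hmin; rewrite -sg leqNgt ltn_modp g0.
pose x := tf g / q0.
have x0 : x != 0 by rewrite /x mulf_neq0 ?invr_eq0 // tf_eq0.
have Ix y : I y -> exists p, y = x * tf p.
  move=> hy; have [f e] := pol _ _ hy Iq0; have Pf := IP _ _ hy e.
  exists (f %/ g); apply: (mulIf q00); rewrite e (gdiv f Pf) rmorphM /x.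
  by rewrite mulpK //; field.
have Ix' z : I' z -> exists q, z = x^-1 * tf q.
  move=> hz; suff [q e] : exists q, x * z = tf q.
    by exists q; rewrite -e mulrA mulVf // mul1r.
  have : W x by exact: Pg.
  elim/prodI_ind => [|a b|_ b [u ->] hb].
  - by exists 0; rewrite mul0r rmorph0.
  - by move=> [q eq] [q' eq']; exists (q + q'); rewrite mulrDl eq eq' rmorphD.
  - by have [f e] := pol _ _ hb hz; exists (u * f); rewrite -mulrA e rmorphM.
pose J p := I (x * tf p); pose J' q := I' (x^-1 * tf q).
exists x, J, J'; split=> //.
have hsub y (I0 : F -> Prop) : submod (imF 1 B) I0 -> submod B (fun p => I0 (y * tf p)).
  move=> [k1 [k2 k3]]; split; first by rewrite rmorph0 mulr0.
  split=> [p q|p q]; first by rewrite rmorphD mulrDr; auto.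
  by move=> hp hq; rewrite rmorphM mulrCA; apply: k3 => //; exists p; rewrite mul1r.
split; last first.
  apply: seteqE => y; split=> [hy|[p [hp ->]]]; last exact: hp.
  by have [p e] := Ix y hy; exists p; rewrite /J -e.
split; first exact: hsub.
split; first exact: hsub.
split.
  move=> p q hp hq; have [f [hf e]] := i3 _ _ hp hq.
  suff -> : p * q = f by [].
  by apply: tf_inj; rewrite -[RHS]mul1r -e rmorphM mulrACA divff // mul1r.
suff [w hw e] : exists2 w, prodI J J' w & (1 : F) = tf w.
  by have <- : w = 1 by apply: tf_inj; rewrite -e rmorph1.
elim/prodI_ind: i4 => [|a b [w hw ->] [w' hw' ->]|a b ha hb].
- by exists 0; [exact: prodI0|rewrite rmorph0].
- by exists (w + w'); [exact: prodID|rewrite rmorphD].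
- have [p e] := Ix a ha; have [q e'] := Ix' b hb; exists (p * q).
    by apply: prodI_mul; rewrite /J /J' -?e -?e'.
  by rewrite e e' rmorphM mulrACA divff // mul1r.
Qed.

(** The ratio [y / x] is a polynomial because [1] lies in [prodI I I'], and so is its inverse by
    symmetry. The units of [K[X]] are the nonzero constants, whence [k]. *)
Lemma imF_eq B x y J J' I I' : dual B J J' -> dual B I I' ->
  x != 0 -> y != 0 -> imF x J = imF y I ->
  exists k : K, k != 0 /\ y = x * tf k%:P /\ (forall p, I p -> J (k%:P * p)) /\
    (forall p, J p -> exists2 r, I r & p = k%:P * r) /\
    (forall q, J' q -> I' (k%:P * q)).
Proof.
have key x0 y0 J0 I0 I0' : x0 != 0 -> dual B I0 I0' -> imF x0 J0 = imF y0 I0 ->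
    exists w, y0 / x0 = tf w.
  move=> x00 [_ [_ [_ h1]]] e.
  suff : forall z, prodI I0 I0' z -> exists w, y0 / x0 * tf z = tf w.
    by move/(_ 1 h1) => [w]; rewrite rmorph1 mulr1; exists w.
  move=> z; elim/prodI_ind => [|a b [w ew] [w' ew']|a b ha hb].
  - by exists 0; rewrite rmorph0 mulr0.
  - by exists (w + w'); rewrite !rmorphD mulrDr ew ew'.
  - have : imF y0 I0 (y0 * tf a) by exists a.
    rewrite -e => -[j [_ ej]]; exists (j * b).
    by rewrite !rmorphM mulrA; congr (_ * _); rewrite mulrAC ej mulrAC divff // mul1r.
move=> hJ hI x0 y0 e.
have [w ew] := key _ _ _ _ _ x0 hI e.
have [w' ew'] := key _ _ _ _ _ y0 hJ (esym e).
have ww : w * w' = 1.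
  by apply: tf_inj; rewrite rmorphM -ew -ew' rmorph1; field; rewrite x0 y0.
have /andP[/eqP sw _] : (size w == 1%N) && (size w' == 1%N).
  by rewrite -size_mul_eq1 ww size_poly1.
have [k k0 ek] : exists2 k, k != 0 & w = k%:P by apply/size_poly1P; rewrite sw.
have ey : y = x * tf k%:P by rewrite -ek -ew mulrC mulfVK.
exists k; split=> //; split=> //.
have h1 p : I p -> J (k%:P * p).
  move=> hp; have : imF y I (y * tf p) by exists p.
  rewrite -e => -[j [hj ej]]; suff -> : k%:P * p = j by [].
  by apply: tf_inj; apply: (mulfI x0); rewrite -ej rmorphM mulrA -ey.
split=> //; split.
  move=> p hp; have : imF x J (x * tf p) by exists p.
  rewrite e => -[r [hr er]]; exists r => //.
  by apply: tf_inj; apply: (mulfI x0); rewrite er rmorphM mulrA -ey.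
move=> q hq; apply: (dual_colon hI) => p hp.
by rewrite mulrCA mulrA; have [_ [_ [h _]]] := hJ; apply: h => //; exact: h1.
Qed.
End FractionIdeals.

(** * The group of normalised value functions *)

Section Classes.
Variables (K : fieldType) (D : K -> Prop).
Hypothesis hD : almost_dedekind D.
Let hR := ringD hD.
Hint Resolve hR : core.
Implicit Types (M : K -> Prop) (J I : {poly K} -> Prop).
Local Notation Gam := ((K -> Prop) -> K -> int).

Lemma gamD (f g : Gam) M a : (f + g) M a = f M a + g M a. Proof. by []. Qed.
Lemma gamN (f : Gam) M a : (- f) M a = - f M a. Proof. by []. Qed.
Lemma gam0 M a : (0 : Gam) M a = 0. Proof. by []. Qed.
Definition gamE := (gamD, gamN, gam0).

(* Subtracting the value at [0] forgets the ideals extended from constants. *)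
Definition norm_Phi (S : (K -> Prop) -> Prop) J J' : Gam := fun M a =>
  if `[< S M /\ D a >] then Phi D J J' M a - Phi D J J' M 0 else 0.

Lemma norm_Phi_in S J J' M a : S M -> D a ->
  norm_Phi S J J' M a = Phi D J J' M a - Phi D J J' M 0.
Proof. by move=> SM Da; rewrite /norm_Phi asboolT. Qed.

Lemma norm_Phi_out S J J' M a : ~ (S M /\ D a) -> norm_Phi S J J' M a = 0.
Proof. by move=> h; rewrite /norm_Phi asboolF. Qed.

Lemma zero_D : D 0. Proof. exact: subring0. Qed.
Hint Resolve zero_D : core.

Lemma norm_Phi_eq S J J' (f : Gam) :
  (forall M a, S M -> D a -> f M a = Phi D J J' M a - Phi D J J' M 0) ->
  (forall M a, ~ (S M /\ D a) -> f M a = 0) -> f = norm_Phi S J J'.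
Proof.
move=> h1 h2; apply/funext => M; apply/funext => a.
have [[SM Da]|h] := pselect (S M /\ D a); first by rewrite h1 // norm_Phi_in.
by rewrite h2 // norm_Phi_out.
Qed.

Definition valueG S : Gam -> Prop := fun f =>
  exists J J', dual (IntS D S) J J' /\ f = norm_Phi S J J'.

Section OneSet.
Variable S : (K -> Prop) -> Prop.
Hypothesis hS : maxset D S.
Local Notation B := (IntS D S).
Let hB : subring B := IntS_ring hD hS.

Lemma norm_Phi_mul J J' I I' : dual B J J' -> dual B I I' ->
  norm_Phi S (prodI J I) (prodI J' I') = norm_Phi S J J' + norm_Phi S I I'.
Proof.
move=> hJ hI; apply: esym; apply: norm_Phi_eq => M a.
  move=> SM Da; rewrite /= !gamE !norm_Phi_in // !(Phi_mul hD hS hJ hI) //; ring.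
by move=> h; rewrite !gamE !norm_Phi_out.
Qed.

Lemma norm_Phi_sym J J' : dual B J J' -> norm_Phi S J' J = - norm_Phi S J J'.
Proof.
move=> hJ; apply: esym; apply: norm_Phi_eq => M a.
  move=> SM Da; rewrite !gamE norm_Phi_in // !(Phi_sym hD hS hJ) //; ring.
by move=> h; rewrite !gamE norm_Phi_out // oppr0.
Qed.

Lemma norm_Phi_one : norm_Phi S B B = 0.
Proof.
apply: esym; apply: norm_Phi_eq => // M a SM Da.
by rewrite !gamE !(Phi_one hD hS) // subrr.
Qed.

Lemma valueG0 : valueG S 0.
Proof. by exists B, B; rewrite norm_Phi_one; split=> //; exact: dual_one. Qed.

Lemma valueGD f g : valueG S f -> valueG S g -> valueG S (f + g).
Proof.
move=> [J [J' [hJ ->]]] [I [I' [hI ->]]]; exists (prodI J I), (prodI J' I').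
by rewrite norm_Phi_mul //; split=> //; exact: dual_mul.
Qed.

Lemma valueGN f : valueG S f -> valueG S (- f).
Proof.
move=> [J [J' [hJ ->]]]; exists J', J; rewrite (norm_Phi_sym hJ); split=> //.
exact: dual_sym.
Qed.

Lemma valueGB f g : valueG S f -> valueG S g -> valueG S (f - g).
Proof. by move=> hf hg; apply: valueGD => //; exact: valueGN. Qed.

Lemma norm_Phi0_const J J' M a : dual B J J' -> norm_Phi S J J' = 0 -> S M -> D a ->
  Phi D J J' M a = Phi D J J' M 0.
Proof.
move=> hJ h SM Da; apply/eqP; rewrite -subr_eq0 -(norm_Phi_in _ _ SM Da) h.
by rewrite !gamE.
Qed.
End OneSet.

Lemma valueG_restrict S S' f : maxset D S -> maxset D S' -> (forall M, S' M -> S M) ->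
  valueG S f -> valueG S' (fun M a => if `[< S' M >] then f M a else 0).
Proof.
move=> hS hS' sub [J [J' [hJ ->]]].
have [hd e] := restrict_dual hD hS hS' sub hJ.
exists (prodI J (IntS D S')), (prodI J' (IntS D S')); split=> //.
apply: norm_Phi_eq => M a.
  by move=> S'M Da; rewrite asboolT // !e // norm_Phi_in //; exact: sub.
move=> h; case: asboolP => // S'M; rewrite norm_Phi_out // => -[_ Da]; exact: h.
Qed.

Section Fractions.
Variables (F : fieldType) (tf : {rmorphism {poly K} -> F}).
Hypothesis tf_inj : injective tf.
Hypothesis tf_quot : forall x, exists n m, m != 0 /\ x = tf n / tf m.
Variable S : (K -> Prop) -> Prop.
Hypothesis hS : maxset D S.
Local Notation B := (IntS D S).
Let hB : subring B := IntS_ring hD hS.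
Implicit Types (U V : F -> Prop).

(* [U] ranges over fractional ideals in [F] and [f] over normalised value functions;
   [f] depends on [U] only, since [x] is unique up to a nonzero constant. *)
Definition clrel U (f : Gam) := exists x J J',
  x != 0 /\ dual B J J' /\ U = imF tf x J /\ f = norm_Phi S J J'.

Definition pic_rel U V := exists (L : K -> Prop) (x : F),
  invertible (capS D S) L /\ x != 0 /\
  seteq U (scale x (prodI (prodI (imF tf 1 (constP L)) (imF tf 1 B)) V)).

Lemma imF_quot : quotfield (imF tf 1 B).
Proof.
move=> x; have [n [m [m0 e]]] := tf_quot x.
have [r [Dr [r0 hr]]] := clear_IntS hD n; have [s [Ds [s0 hs]]] := clear_IntS hD m.
have constB c p : D c -> B p -> B (c%:P * p).
  move=> Dc hp; apply: (subringM hB) => //; apply: IntSC => //; exact: capS_D.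
exists (tf (r%:P * (s%:P * n))), (tf (r%:P * (s%:P * m))).
split; first by exists (r%:P * (s%:P * n)); rewrite mul1r mulrCA; split=> //; apply: constB => //; exact: hr.
split; first by exists (r%:P * (s%:P * m)); rewrite mul1r; split=> //; apply: constB => //; exact: hs.
have rp0 : r%:P != 0 by rewrite polyC_eq0.
have sp0 : s%:P != 0 by rewrite polyC_eq0.
split; first by rewrite (tf_eq0 tf_inj) !mulf_neq0.
rewrite e !rmorphM; field.
by rewrite !(tf_eq0 tf_inj) m0 sp0 rp0.
Qed.

Lemma cl_invertible U f : clrel U f -> invertible (imF tf 1 B) U.
Proof.
move=> [x [J [J' [x0 [hJ [-> _]]]]]].
apply: (dual_invertible (imF_ring tf hB) imF_quot).
exact: (imF_dual _ hB x0 hJ).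
Qed.

Lemma cl_G U f : clrel U f -> valueG S f.
Proof. by move=> [x [J [J' [_ [hJ [_ ->]]]]]]; exists J, J'. Qed.

Lemma valueG_cl f : valueG S f -> exists U, clrel U f.
Proof.
by move=> [J [J' [hJ ->]]]; exists (imF tf 1 J), 1, J, J'; rewrite oner_neq0.
Qed.

Lemma cl_ex U : invertible (imF tf 1 B) U -> exists f, clrel U f.
Proof.
move=> /(invertible_imF tf_inj hB) [x [J [J' [x0 [hJ e]]]]].
by exists (norm_Phi S J J'), x, J, J'.
Qed.

Lemma cl_mul U V f g : clrel U f -> clrel V g -> clrel (prodI U V) (f + g).
Proof.
move=> [x [J [J' [x0 [hJ [-> ->]]]]]] [y [I [I' [y0 [hI [-> ->]]]]]].
exists (x * y), (prodI J I), (prodI J' I').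
rewrite mulf_neq0 // imF_prod norm_Phi_mul //; split=> //; split=> //.
exact: dual_mul.
Qed.

Lemma cl_one : clrel (imF tf 1 B) 0.
Proof.
exists 1, B, B; rewrite oner_neq0 norm_Phi_one //; split=> //; split; first exact: (dual_one hB).
by [].
Qed.

(** If the functions agree, the value function of [prodI J I'] does not depend on the point, so this
    ideal is extended from some [L] by [const_char]. Conversely, [L] and the scalar [k] change a
    value function by a quantity independent of the point, which the normalisation at [0]
    removes. *)
Lemma cl_eqv U V f g : clrel U f -> clrel V g -> pic_rel U V <-> f = g.
Proof.
move=> [x [J [J' [x0 [hJ [-> ->]]]]]] [y [I [I' [y0 [hI [-> ->]]]]]].
split; last first.
  move=> e.
  have hP : dual B (prodI J I') (prodI J' I) by apply: dual_mul => //; exact: dual_sym.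
  have hc M a : S M -> D a -> Phi D (prodI J I') (prodI J' I) M a =
      Phi D (prodI J I') (prodI J' I) M 0.
    move=> SM Da; apply: (norm_Phi0_const hP) => //.
    rewrite norm_Phi_mul //; last exact: dual_sym.
    by rewrite (norm_Phi_sym hS hI) e subrr.
  have [L [L' [hL eL]]] := const_char hD hS hP hc.
  exists L, (x / y); split; first exact: (dual_invertible (capS_ring hD hS) (capS_quot hD hS) hL).
  split; first by rewrite mulf_neq0 ?invr_eq0.
  rewrite !imF_prod imF_scale -eL prodIA (prodIC I') (dual_prod hB hI) prodIC.
  rewrite prodI_unit //; last by case: hJ.
  by rewrite !mul1r mulfVK.
move=> [L [z [hL [z0 /seteqE e]]]].
have [L' dL] := invertible_dual (capS_ring hD hS) hL.
have [dC hC] := const_dual hD hS dL.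
rewrite !imF_prod imF_scale !mul1r in e.
have dP := dual_mul hB dC hI.
have [k [k0 [_ [h1 [h2 h3]]]]] := imF_eq tf_inj hJ dP x0 (mulf_neq0 z0 y0) e.
have key M a : S M -> D a -> Phi D J J' M a = vM D M k +
    Phi D (prodI (prodI (constP L) B) I) (prodI (prodI (constP L') B) I') M a.
  move=> SM Da; have hv := vMP hD (hS SM); have [p1 p2] := PhiP hD hS dP SM Da.
  apply: (PhiE hD hS hJ) => //; split=> p.
    move=> /h2 [r hr ->]; rewrite hornerM hornerC; apply: (geM hv); first exact: ge_self.
    exact: p1.
  move=> /h3 /p2; rewrite hornerM hornerC (geMl hv) // opprD addrC.
  by rewrite [X in vge _ X]addrC.
apply: norm_Phi_eq => M a h.
  move=> Da; rewrite norm_Phi_in // !key // !(Phi_mul hD hS dC hI) // (hC M a) //; ring.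
by rewrite norm_Phi_out.
Qed.

Lemma cl_fun U f g : clrel U f -> clrel U g -> f = g.
Proof. by move=> hf hg; apply/(cl_eqv hf hg); apply/(cl_eqv hf hf). Qed.

(** Over one place, value functions with the same normalisation differ by a single integer, and that
    integer is the value of some [k] in [K]. This reflects triviality of the Picard group of a
    discrete valuation ring, so dividing by it changes nothing. *)
Lemma cl_local M U V f g : S = eq M -> clrel U f -> clrel V g ->
  pic_eqv (imF tf 1 B) U V <-> f = g.
Proof.
move=> eS hf hg; have SM : S M by rewrite eS.
have hv := vMP hD (hS SM).
have [x [J [J' [x0 [hJ [eU ef]]]]]] := hf.
have [y [I [I' [y0 [hI [eV eg]]]]]] := hg.
split=> [[z [z0 /seteqE e]]|e].
  apply: (cl_fun hf); exists (z * y), I, I'; split; first by rewrite mulf_neq0.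
  by rewrite e eV imF_scale.
have [k [k0 vk]] := exists_val hv (Phi D J J' M 0 - Phi D I I' M 0).
have hk a : D a -> Phi D J J' M a = vM D M k + Phi D I I' M a.
  move=> Da; have : f M a = g M a by rewrite e.
  by rewrite ef eg !norm_Phi_in // vk => h; rewrite -(subrK (Phi D J J' M 0) (Phi D J J' M a)) h; ring.
have kF : tf k%:P != 0 by rewrite (tf_eq0 tf_inj) polyC_eq0.
exists (x / y * tf k%:P); split; first by rewrite !mulf_neq0 ?invr_eq0.
have kk : k%:P * k^-1%:P = 1 :> {poly K} by rewrite -polyCM divff.
rewrite eU eV imF_scale => u; split=> [[p [hp ->]]|[p [hp ->]]].
  exists (k^-1%:P * p); split; last first.
    rewrite -[p in LHS]mul1r -kk -mulrA rmorphM; field; exact/andP.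
  apply: (dual_det hD hS hI) => M' a; rewrite eS => <- Da.
  have [h1 _] := PhiP hD hS hJ SM Da; have := h1 p hp.
  by rewrite hk // hornerM hornerC (geMl hv) ?invr_eq0 // (valV hv) // opprK addrC.
exists (k%:P * p); split; last by rewrite rmorphM; field; exact: y0.
apply: (dual_det hD hS hJ) => M' a; rewrite eS => <- Da.
have [h1 _] := PhiP hD hS hI SM Da; have := h1 p hp.
by rewrite hk // hornerM hornerC (geMl hv) // addrAC subrr add0r.
Qed.
End Fractions.
End Classes.

(** * Gluing over the maximal spectrum *)

Section Gluing.
Variables (K : fieldType) (D : K -> Prop).
Hypothesis hD : almost_dedekind D.
Let hR := ringD hD.
Let hD0 := zero_D hD.
Let hD1 := subring1 hR.
Hint Resolve hR hD0 hD1 : core.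
Implicit Types (M : K -> Prop) (J I : {poly K} -> Prop).
Local Notation Gam := ((K -> Prop) -> K -> int).
Local Notation Bmax := (IntS D (maxideal D)).
Local Notation Gmax := (valueG D (maxideal D)).

Lemma maxset_max : maxset D (maxideal D). Proof. by []. Qed.
Let hmax := maxset_max.
Hint Resolve hmax : core.

Lemma maxset1 M : maxideal D M -> maxset D (eq M). Proof. by move=> hM _ <-. Qed.

Lemma capS_max : capS D (maxideal D) = D.
Proof.
by apply: seteqE => x; split; [exact: D_cap|exact: capS_D].
Qed.

Let hB : subring Bmax := IntS_ring hD hmax.
Hint Resolve hB : core.

Lemma BmaxC c : D c -> Bmax c%:P.
Proof. by move=> Dc; apply: IntSC; rewrite ?capS_max. Qed.

Lemma BmaxZ c f : D c -> Bmax f -> Bmax (c%:P * f).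
Proof. by move=> Dc hf; apply: (subringM hB) => //; exact: BmaxC. Qed.

Lemma clear_seq (s : seq {poly K}) : exists r, D r /\ r != 0 /\
  forall f, f \in s -> Bmax (r%:P * f).
Proof.
elim: s => [|f s [r [Dr [r0 h]]]]; first by exists 1; rewrite oner_neq0.
have [t [Dt [t0 ht]]] := clear_IntS hD f.
exists (r * t); split; first exact: subringM.
split; first by rewrite mulf_neq0.
move=> g; rewrite inE polyCM => /orP[/eqP->|/h hg].
  by rewrite -mulrA; apply: BmaxZ => //; exact: ht.
by rewrite mulrAC mulrC; apply: BmaxZ.
Qed.

(** A compactness condition on the places of [S] containing [c]: elements of [I] that avoid these
    places one at a time can be replaced by one element avoiding them all. *)
Definition separated S := forall (I : K -> Prop) c, is_ideal D I ->
  (forall M, S M -> exists d, I d /\ ~ M d) -> D c -> c != 0 ->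
  exists d, I d /\ forall M, S M -> M c -> ~ M d.

Lemma separated1 M : separated (eq M).
Proof. by move=> I c _ /(_ M erefl) [d [Id nMd]] _ _; exists d; split=> // _ <-. Qed.

Definition extends_to S := forall f, IntS D S f -> prodI Bmax (constP (capS D S)) f.

Section Glue.
Variables (S : (K -> Prop) -> Prop) (J J' : {poly K} -> Prop).
Hypotheses (hS : maxset D S) (hJ : dual (IntS D S) J J').
Variables (n : nat) (p q : 'I_n -> {poly K}).
Hypotheses (hp : forall i, J (p i)) (hq : forall i, J' (q i)).
Hypothesis hpq : 1 = \sum_(i < n) p i * q i.

(* [J] is generated by the [p i], with inverse generated by the [q i]; replacing
   [p] by [e p] and adding [1 - e], where [e] is nearly idempotent, keeps the value
   function where [e] is close to [1] and trivialises it where [e] is close to [0]. *)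
Lemma glue : exists c, D c /\ c != 0 /\
  forall d, D d -> (forall i j, Bmax (d%:P * (p i * q j))) ->
  exists g, Gmax g /\
    (forall M a, S M -> (M c -> ~ M d) -> g M a = norm_Phi D S J J' M a) /\
    (forall M a, maxideal D M -> M d -> g M a = 0).
Proof.
have [r [Dr [r0 hr]]] := clear_seq (codom p).
have {}hr i : Bmax (r%:P * p i) by apply: hr; exact: codom_f.
have [s [Ds [s0 hs]]] := clear_seq (codom q).
have {}hs i : Bmax (s%:P * q i) by apply: hs; exact: codom_f.
(* [r] makes the [p i] integer-valued on [D] and [s] does so for the [q i]; an [e] idempotent modulo
   [s * r] can absorb both denominators. *)
have c0 : s * r != 0 by rewrite mulf_neq0.
have Dc : D (s * r) by exact: subringM.
exists (s * r); split=> //; split=> // d Dd hd.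
have [e [[y Dy ey] [[k Dk ek] he]]] := near_idempotent hD Dc c0 Dd.
have De : D e by rewrite ey; exact: subringM.
have D1e : D (1 - e) by exact: subringB.
(* The factor [r] keeps the products with the generator [1] of [Q] integer-valued. It shifts the
   value function by [vM D M r], which does not depend on the point and disappears on
   normalisation. *)
pose P x := (exists i, x = (e * r)%:P * p i) \/ exists2 z, D z & x = (z * (1 - e))%:P.
pose Q x := (exists i, x = (e / r)%:P * q i) \/ x = 1.
have hPQ x z : P x -> Q z -> Bmax (x * z).
  move=> [[i ->]|[w Dw ->]] [[j ->]|->].
  - have -> : (e * r)%:P * p i * ((e / r)%:P * q j) = (e * y)%:P * (d%:P * (p i * q j)).
      rewrite mulrACA !mulrA -!polyCM -!mulrA; congr (_%:P * _).
      by rewrite {2}ey; field.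
    by apply: BmaxZ => //; exact: subringM.
  - by rewrite mulr1 polyCM -mulrA; exact: BmaxZ.
  - have -> : (w * (1 - e))%:P * ((e / r)%:P * q j) = (w * k)%:P * (s%:P * q j).
      rewrite !mulrA -!polyCM; congr (_%:P * _).
      have -> : w * (1 - e) * (e / r) = w * (e * (1 - e)) / r by ring.
      by rewrite ek; field.
    by apply: BmaxZ => //; exact: subringM.
  - by rewrite mulr1; apply: BmaxC; exact: subringM.
have h1 : prodI P Q 1.
  (* This is [1 = e * e + (1 + e) * (1 - e)]. *)
  have -> : (1 : {poly K}) = \sum_(i < n) ((e * r)%:P * p i) * ((e / r)%:P * q i)
      + ((1 + e) * (1 - e))%:P * 1.
    have -> : \sum_(i < n) (e * r)%:P * p i * ((e / r)%:P * q i) = (e * r * (e / r))%:P.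
      rewrite -[RHS]mulr1 hpq mulr_sumr; apply: eq_bigr => i _.
      by rewrite mulrACA -polyCM.
    by rewrite mulr1 -polyCD -polyC1; congr (_%:P); field.
  apply: prodID.
    exists n, (fun i => (e * r)%:P * p i), (fun i => (e / r)%:P * q i).
    by split; [move=> i; left; exists i|split=> // i; left; exists i].
  apply: prodI_mul; last by right.
  by right; exists (1 + e) => //; exact: subringD.
have hdu := dual_gen hB hPQ h1; exists (norm_Phi D (maxideal D) (prodI P Bmax) (prodI Q Bmax)).
have PE M a m : maxideal D M -> D a ->
    (forall x, P x -> vge (vM D M) m x.[a]) -> (forall x, Q x -> vge (vM D M) (- m) x.[a]) ->
    Phi D (prodI P Bmax) (prodI Q Bmax) M a = m.
  by move=> hM Da hP hQ; apply: (PhiE hD hmax hdu) => //; exact: isval_gen.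
split; first by exists (prodI P Bmax), (prodI Q Bmax).
have eD0 M a z : maxideal D M -> D a -> Bmax z -> vge (vM D M) 0 z.[a] by move=> hM Da; exact.
split=> [M a SM Md|M a hM Md]; last first.
  have [[_ Da]|h] := pselect (maxideal D M /\ D a); last by rewrite norm_Phi_out.
  suff E b : D b -> Phi D (prodI P Bmax) (prodI Q Bmax) M b = 0 by rewrite norm_Phi_in // !E // subrr.
  move=> Db; have hv := vMP hD hM; apply: PE => // x.
    move=> [[i ->]|[z Dz ->]]; apply: eD0 => //.
      by rewrite polyCM -mulrA; exact: BmaxZ.
    by apply: BmaxC; exact: subringM.
  rewrite oppr0 => -[[i ->]|->]; last by apply: eD0 => //; exact: (subring1 hB).
  have -> : (e / r)%:P * q i = (e / (s * r))%:P * (s%:P * q i).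
    by rewrite mulrA -polyCM; congr (_%:P * _); field; rewrite r0 s0.
  rewrite hornerM hornerC -[0]addr0; apply: (geM hv); last exact: eD0.
  have [_ /(_ Md) hge] := he M hM.
  by apply/(ge0P hv); rewrite -(ge_div hv _ c0 erefl).
have hM := hS SM; have hv := vMP hD hM.
have [[_ Da]|h] := pselect (S M /\ D a); last first.
  rewrite (norm_Phi_out _ _ h) norm_Phi_out // => -[_ Da]; exact: h.
have h1e : vge (vM D M) (vM D M (s * r)) (1 - e).
  have [Mc|nMc] := pselect (M (s * r)).
    by have [h _] := he M hM; apply: h; exact: Md.
  by rewrite (val_unit hD hM Dc nMc); exact: (D_ge0 hD hM).
suff E b : D b -> Phi D (prodI P Bmax) (prodI Q Bmax) M b = vM D M r + Phi D J J' M b.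
  by rewrite !norm_Phi_in // !E //; ring.
move=> Db; have [j1 j2] := PhiP hD hS hJ SM Db; apply: PE => // x.
  move=> [[i ->]|[z Dz ->]].
    rewrite hornerM hornerC; apply: (geM hv); last exact: j1.
    rewrite -[vM _ _ _]add0r; apply: (geM hv); first exact: (D_ge0 hD hM).
    exact: ge_self.
  rewrite hornerC -[_ + _]add0r; apply: (geM hv); first exact: (D_ge0 hD hM).
  (* [s] is the sum of the [p i * (s%:P * q i)], so [Phi] is at most the value of [s], and the
     generators built from [1 - e] do not lower the minimum. *)
  apply: ge_le h1e; rewrite (valM hv) // addrC lerD2r.
  rewrite -(geP (vM D M) _ s0) -[s](hornerC _ b) -[s%:P]mulr1 hpq mulr_sumr horner_sum.
  apply: (ge_sum hv) => i; rewrite mulrCA hornerM -[Phi _ _ _ _ _]addr0.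
  by apply: (geM hv); [exact: j1|exact: eD0].
rewrite opprD => -[[i ->]|->].
  rewrite hornerM hornerC; apply: (geM hv); last exact: j2.
  rewrite -[- vM _ _ _]add0r -(valV hv) //; apply: (geM hv); first exact: (D_ge0 hD hM).
  exact: ge_self.
have h : - Phi D J J' M b <= vM D M r.
  rewrite -(geP (vM D M) _ r0) -[r](hornerC _ b) -[r%:P]mulr1 hpq mulr_sumr horner_sum.
  apply: (ge_sum hv) => i; rewrite mulrA hornerM -[- Phi _ _ _ _ _]add0r.
  by apply: (geM hv); [exact: eD0|exact: j2].
rewrite -polyC1 hornerC; right; rewrite (val_one hv) addrC subr_le0 //.
Qed.
End Glue.

(** Over all of [Max(D)] the products [p i * q j] are already integer-valued, so [glue] applies with
    every [d]. *)
Lemma patch_class f d : Gmax f -> D d -> Gmax (fun M a => if `[< M d >] then 0 else f M a).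
Proof.
move=> [J [J' [hJ ->]]] Dd; have [_ [_ [j3 [n [p [q [hp [hq e]]]]]]]] := hJ.
have [c [Dc [c0 h]]] := glue hmax hJ hp hq e.
have [|g [hg [g1 g2]]] := h d Dd.
  by move=> i j; apply: BmaxZ => //; exact: j3.
suff <- : g = (fun M a => if `[< M d >] then 0 else norm_Phi D (maxideal D) J J' M a) by [].
apply/funext => M; apply/funext => a.
have [hM|nM] := pselect (maxideal D M).
  by case: asboolP => Md; [exact: g2|apply: g1].
case: hg => I [I' [_ ->]]; rewrite norm_Phi_out; last by case.
by rewrite norm_Phi_out; [case: asboolP|case].
Qed.

Lemma finite_support f : Gmax f -> exists c, D c /\ c != 0 /\
  forall M a, ~ M c -> f M a = 0.
Proof.
move=> [J [J' [hJ ->]]]; have [_ [_ [j3 [n [p [q [hp [hq e]]]]]]]] := hJ.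
have [c [Dc [c0 h]]] := glue hmax hJ hp hq e.
exists c; split=> //; split=> // M a nMc.
(* With [d = 0] the glued function vanishes everywhere, yet it agrees with [f] outside the places
   containing [c]. *)
have [|g [hg [g1 g2]]] := h 0 hD0.
  by move=> i j; rewrite mul0r; exact: subring0.
have [hM|nM] := pselect (maxideal D M); last by rewrite norm_Phi_out // => -[].
by rewrite -g1 // g2 //; exact: (max0 hM).
Qed.

Section Extends.
Variable S : (K -> Prop) -> Prop.
Hypotheses (hS : maxset D S) (hE : extends_to S).

(** The coefficients from [capS D S] lie in [loc D M], so the finitely many that occur have a common
    denominator outside [M]. *)
Lemma denom_extends M f : S M -> IntS D S f -> exists d, D d /\ ~ M d /\ Bmax (d%:P * f).
Proof.
move=> SM /hE; have hM := hS SM; elim/prodI_ind => [|x y|x _ hx [t [ht ->]]].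
- by exists 1; split=> //; split; [exact: (max1 hM)|rewrite mulr0; exact: subring0].
- move=> [d [Dd [nd hd]]] [d' [Dd' [nd' hd']]]; exists (d * d').
  split; first exact: subringM.
  split; first exact: (max_prime hD hM).
  rewrite mulrDr polyCM; apply: (subringD hB).
    by rewrite mulrAC mulrC; exact: BmaxZ.
  by rewrite -mulrA; exact: BmaxZ.
- have [d [Dd [nd hd]]] := loc_denom hM (ht M SM).
  exists d; split=> //; split=> //.
  rewrite mulrCA -polyCM mulrC; exact: BmaxZ.
Qed.

(** The ideal of common denominators of all [p i * q j] leaves every [M] in [S] by [denom_extends].
    Separation turns this into a single [d], to which [glue] applies. *)
Lemma lift_class f : separated S -> valueG D S f ->
  exists g, Gmax g /\ forall M a, S M -> g M a = f M a.
Proof.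
move=> sS [J [J' [hJ ->]]]; have [_ [_ [j3 [n [p [q [hp [hq e]]]]]]]] := hJ.
have [c [Dc [c0 h]]] := glue hS hJ hp hq e.
pose I d := D d /\ forall i j, Bmax (d%:P * (p i * q j)).
have hI : is_ideal D I.
  split; first by move=> x [].
  split; first by split=> // i j; rewrite mul0r; exact: subring0.
  split.
    move=> x y [Dx hx] [Dy hy]; split=> [|i j]; first exact: subringD.
    by rewrite polyCD mulrDl; exact: (subringD hB).
  move=> a x Da [Dx hx]; split=> [|i j]; first exact: subringM.
  by rewrite polyCM -mulrA; exact: BmaxZ.
have [M SM|d [[Dd hd] hdS]] := sS I c hI _ Dc c0.
  have hM := hS SM.
  have [t ht] : exists t : 'I_n * 'I_n -> K, forall ij, D (t ij) /\ ~ M (t ij) /\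
      Bmax ((t ij)%:P * (p ij.1 * q ij.2)).
    suff /choice[t ht] : forall ij : 'I_n * 'I_n, exists x, D x /\ ~ M x /\
      Bmax (x%:P * (p ij.1 * q ij.2)) by exists t.
    by move=> ij; apply: denom_extends => //; exact: j3.
  exists (\prod_ij t ij); split; last first.
    suff [] : D (\prod_ij t ij) /\ ~ M (\prod_ij t ij) by [].
    elim/big_rec: _ => [|ij x _ [Dx nx]]; first by split=> //; exact: (max1 hM).
    have [D1 [n1 _]] := ht ij.
    by split; [exact: subringM|exact: (max_prime hD hM)].
  split=> [|i j].
    elim/big_rec: _ => // ij x _ Dx; have [D1 _] := ht ij; exact: subringM.
  rewrite (bigD1 (i, j)) //= polyCM mulrAC mulrC; apply: BmaxZ; last first.
    by have [_ [_]] := ht (i, j).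
  elim/big_rec: _ => // ij x _ Dx; have [D1 _] := ht ij; exact: subringM.
by have [g [hg [g1 _]]] := h d Dd hd; exists g; split=> // M a SM; apply: g1 => //; exact: hdS.
Qed.

(** Over [S] the ideal behaves as if extended from constants, so [J] and [J'] acquire there the
    constants [l] and [l'], whose product is a unit at [M]. Denominators outside [M] bring multiples
    of them into [J] and [J'] themselves; where the product [e] of these multiples is a unit, they
    bound the value function from both sides by the same integer. *)
Lemma open_zero f M : Gmax f -> (forall M a, S M -> f M a = 0) -> S M ->
  exists e, D e /\ ~ M e /\ forall M' a, ~ M' e -> f M' a = 0.
Proof.
move=> [J [J' [hJ ->]]] h0 SM; have hM := hS SM; have hv := vMP hD hM.
have [j1 [j2 [j3 [n [p [q [hp [hq e]]]]]]]] := hJ.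
have hB' := IntS_ring hD hS.
have [hd hdE] := restrict_dual hD hmax hS hS hJ.
have hc M' a : S M' -> D a -> Phi D J J' M' a = Phi D J J' M' 0.
  move=> SM' Da; have := h0 M' a SM'; rewrite norm_Phi_in //; last exact: hS.
  by move/eqP; rewrite subr_eq0 => /eqP.
have hden (I : {poly K} -> Prop) f0 : submod Bmax I -> prodI I (IntS D S) f0 ->
    exists d, D d /\ ~ M d /\ I (d%:P * f0).
  move=> hI; have [i1 [i2 i3]] := hI; elim/prodI_ind => [|x y|x y hx hy].
  - by exists 1; split=> //; split; [exact: (max1 hM)|rewrite mulr0].
  - move=> [d [Dd [nd hd1]]] [d' [Dd' [nd' hd1']]]; exists (d * d').
    split; first exact: subringM.
    split; first exact: (max_prime hD hM).
    rewrite mulrDr polyCM; apply: i2.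
      by rewrite mulrAC mulrC; apply: i3 => //; exact: BmaxC.
    by rewrite -mulrA; apply: i3 => //; exact: BmaxC.
  - have [d [Dd [nd hdy]]] := denom_extends SM hy; exists d; split=> //; split=> //.
    by rewrite mulrCA mulrC; apply: i3.
have [i hi] : exists i, ~ vge (vM D M) 1 (p i * q i).[0].
  apply: contrapT => h; suff : vge (vM D M) 1 1 by move/(ge_one hv).
  rewrite -[X in vge _ _ X](hornerC 1 0) polyC1 e horner_sum; apply: (ge_sum hv) => i.
  by apply: contrapT => h'; apply: h; exists i.
pose l := (p i).[0]; pose l' := (q i).[0].
have hl : prodI J (IntS D S) l%:P.
  apply: (dual_det hD hS hd) => M' a SM' Da; rewrite hdE // hornerC hc //.
  by have [h _] := PhiP hD hmax hJ (hS SM') hD0; exact: h.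
have hl' : prodI J' (IntS D S) l'%:P.
  apply: (dual_det hD hS (dual_sym hd)) => M' a SM' Da.
  rewrite (Phi_sym hD hS hd) // hdE // hornerC hc //.
  by have [_ h] := PhiP hD hmax hJ (hS SM') hD0; exact: h.
have [d [Dd [nd hdl]]] := hden _ _ j1 hl.
have [d' [Dd' [nd' hdl']]] := hden _ _ j2 hl'.
rewrite -polyCM in hdl; rewrite -polyCM in hdl'.
have De : D (d * l * (d' * l')).
  have := j3 _ _ hdl hdl'; rewrite -polyCM => hb; rewrite -capS_max => M' hM'.
  by rewrite (locP hD hM') -(hornerC (_ * _) 0); exact: hb.
exists (d * l * (d' * l')); split=> //; split.
  have pq0 : l * l' != 0 by apply/eqP => h; apply: hi; rewrite hornerM -/l -/l' h; left.
  rewrite (maxP hD hM De) mulrACA (geMl hv) //; last by rewrite mulf_neq0 ?(max_neq0 hM).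
  rewrite (valM hv) ?(max_neq0 hM) // !(val_unit hD hM) // subr0 => h.
  by apply: hi; rewrite hornerM; exact: h.
move=> M' a nMe; have [hM'|nM'] := pselect (maxideal D M'); last by rewrite norm_Phi_out // => -[].
have [[_ Da]|na] := pselect (maxideal D M' /\ D a); last by rewrite norm_Phi_out.
have hv' := vMP hD hM'.
have := max_neq0 hM' nMe; rewrite mulf_eq0 negb_or => /andP[l0 l'0].
suff E b : D b -> Phi D J J' M' b = vM D M' (d * l) by rewrite norm_Phi_in // !E // subrr.
move=> Db; have [p1 p2] := PhiP hD hmax hJ hM' Db.
have := p1 _ hdl; have := p2 _ hdl'; rewrite !hornerC !geP //.
have := val_unit hD hM' De nMe; rewrite (valM hv') //.
move: (vM D M' (d * l)) (vM D M' (d' * l')) (Phi D J J' M' b) => u v w; lia.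
Qed.
End Extends.
End Gluing.

(** * Jaffard overrings are isolated points *)

Section Isolation.
Variables (K : fieldType) (D : K -> Prop).
Hypothesis hD : almost_dedekind D.
Let hR := ringD hD.
Hint Resolve hR : core.
Variable NN : (K -> Prop) -> Prop.
Hypothesis NNTheta : forall T, NN T -> Theta D T.
Local Notation R := (Tint NN).

Lemma Theta_loc T : Theta D T -> exists2 M, maxideal D M & T = loc D M.
Proof. by move=> [M [hM /seteqE e]]; exists M. Qed.

Lemma Tint_D x : D x -> R x.
Proof.
by move=> Dx T /NNTheta /Theta_loc [M hM ->]; exact: loc_sub.
Qed.

Lemma Tint_ring : subring R.
Proof.
split; first by apply: Tint_D; exact: (subring1 hR).
by split=> x y hx hy T hT; have := hx T hT; have := hy T hT;
  have [M hM ->] := Theta_loc (NNTheta hT); rewrite !(locP hD hM) => h1 h2;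
  [apply: (geB (vMP hD hM))|rewrite -[0]addr0; apply: (geM (vMP hD hM))].
Qed.

Lemma clear_fam n (p : 'I_n -> K) : exists r, D r /\ r != 0 /\ forall i, D (r * p i).
Proof.
have [r [Dr [r0 h]]] := clear_denom hD (\poly_(k < n) (if insub k is Some i then p i else 0)).
exists r; split=> //; split=> // i; have := h i.
by rewrite coef_poly ltn_ord insubT //= => hi; rewrite (_ : Sub _ _ = i) // ; apply: val_inj.
Qed.

Section AtM.
Variables (M : K -> Prop) (T : K -> Prop) (c : K).
Hypotheses (hM : maxideal D M) (RM : forall x, R x -> loc D M x).
Hypotheses (fM : flat R (loc D M)) (oT : overring R T).
Hypotheses (hTM : seteq (prodI T (loc D M)) (@Kfull K)) (Dc : D c) (c0 : c != 0).

(** Independence writes [c^-1] as a sum of [p i * q i]. After clearing the [p i] by [r] this becomes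
    a linear relation between [1] and the [q i] in [loc D M], with coefficients [r] and
    [- (c * (r * p i))] in [R]. Flatness trivialises it: [1] is expressed through a row of elements
    of [R], one of which is a unit at [M], and the column of that entry [a] exhibits [a / c] as a
    combination of the [p i]. *)
Lemma flat_unit : exists a, R a /\ a != 0 /\ vM D M a = 0 /\ T (a / c).
Proof.
have hv := vMP hD hM; have [hT RT] := oT; have hT' : subring T := hT.
have [n [p [q [hp [hq e]]]]] : prodI T (loc D M) c^-1 by apply/hTM.
have [r [Dr [r0 hr]]] := clear_fam p.
pose rr (i : 'I_n.+1) := if unlift ord0 i is Some j then - (c * (r * p j)) else r.
pose tt (i : 'I_n.+1) := if unlift ord0 i is Some j then q j else 1.
have [i|i||m [a [s [ha [hs [ht hz]]]]]] := fM (r := rr) (t := tt).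
- apply: Tint_D; rewrite /rr; case: unliftP => [j _|//].
  by apply: subringN => //; exact: subringM.
- rewrite /tt; case: unliftP => [j _|_]; first exact: hq.
  by apply: (loc_sub hD hM); exact: subring1.
- rewrite big_ord_recl /rr /tt unlift_none mulr1.
  have -> : \sum_(i < n) (if unlift ord0 (lift ord0 i) is Some j then - (c * (r * p j)) else r) *
      (if unlift ord0 (lift ord0 i) is Some j then q j else 1) = - (c * r) * \sum_(i < n) p i * q i.
    by rewrite mulr_sumr; apply: eq_bigr => i _; rewrite liftK; ring.
  by rewrite -e; field.
have [j hj] : exists j, ~ vge (vM D M) 1 (a ord0 j * s j).
  apply: contrapT => h; suff : vge (vM D M) 1 1 by move/(ge_one hv).
  have := ht ord0; rewrite /tt unlift_none => ->; apply: (ge_sum hv) => j.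
  by apply: contrapT => h'; apply: h; exists j.
have a0 : a ord0 j != 0 by apply/eqP => h; apply: hj; rewrite h mul0r; left.
have s0 : s j != 0 by apply/eqP => h; apply: hj; rewrite h mulr0; left.
exists (a ord0 j); split; first exact: ha.
split=> //; split.
  have := RM (ha ord0 j); have := hs j; rewrite !(locP hD hM) !geP //.
  move: hj; rewrite geP ?mulf_neq0 // (valM hv) //.
  move: (vM D M (a ord0 j)) (vM D M (s j)) => u w; lia.
have := hz j; rewrite big_ord_recl /rr unlift_none.
have -> : \sum_(i < n) (if unlift ord0 (lift ord0 i) is Some j then - (c * (r * p j)) else r) *
      a (lift ord0 i) j = - (c * r) * \sum_(i < n) p i * a (lift ord0 i) j.
  by rewrite mulr_sumr; apply: eq_bigr => i _; rewrite liftK; ring.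
set S := \sum_(i < n) _ => h.
have -> : a ord0 j / c = S.
  apply: (mulfI (mulf_neq0 c0 r0)); apply/eqP; rewrite -subr_eq0; apply/eqP.
  by rewrite -h; field.
apply: subring_sum => // i; apply: subringM => //; exact: RT.
Qed.
End AtM.

(** Completeness for the contraction [P] of the maximal ideal of [loc D M] gives [T] with
    [prodI P T] proper. If some [x] in [T] were outside [loc D M], flatness applied to
    [r1 - r2 * x = 0] would express [1] through elements [a] of [R] with [a * x] in [R]; all of
    these lie in [P], a contradiction. *)
Lemma contains_member Th M : pre_jaffard R Th -> maxideal D M -> NN (loc D M) ->
  exists2 T, Th T & forall x, T x -> loc D M x.
Proof.
move=> [_ [hov [hfl [hcomp _]]]] hM hN; have hv := vMP hD hM.
have RM x : R x -> loc D M x by apply.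
pose P x := R x /\ vge (vM D M) 1 x.
have hRr := Tint_ring.
have hP : is_ideal R P.
  split; first by move=> x [].
  split; first by split; [exact: (subring0 hRr)|left].
  split.
    by move=> x y [Rx hx] [Ry hy]; split; [exact: (subringD hRr)|exact: (geD hv)].
  move=> a x Ra [Rx hx]; split; first exact: (subringM hRr).
  rewrite -[1]add0r; apply: (geM hv) => //; rewrite -(locP hD hM); exact: RM.
have [T hT nT] : exists2 T, Th T & ~ prodI P T 1.
  apply: contrapT => h; suff [_ /(ge_one hv)] : P 1 by [].
  apply/(hcomp P hP) => T hT; apply: contrapT => h'; apply: h; by exists T.
exists T => // x Tx; apply: contrapT => nx; apply: nT.
have [hTr RT] := hov T hT.
have [r1 [r2 [D1 [D2 [r20 e]]]]] := quot_D hD x.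
have [|||m [a [s [ha [hs [ht hz]]]]]] := hfl T hT 2%N
  (fun i => if i == ord0 then r1 else - r2) (fun i => if i == ord0 then 1 else x).
- by move=> i; apply: Tint_D; case: ifP => _ //; exact: subringN.
- by move=> i; case: ifP => _ //; exact: (subring1 hTr).
- by rewrite big_ord_recl big_ord1 /= e; field.
have := ht ord0 => /= ->.
exists m, (a ord0), s; split=> [j|//]; split; first exact: ha.
apply: contrapT => nj; apply: nx; rewrite (locP hD hM).
have a0 : a ord0 j != 0 by apply/eqP => h; apply: nj; rewrite h; left.
have := hz j; rewrite big_ord_recl big_ord1 /= => h.
have h2 : a ord0 j * x = a (lift ord0 ord0) j.
  apply: (mulfI r20); apply/eqP; rewrite -subr_eq0; apply/eqP; rewrite -h e; by field.
have := RM _ (ha (lift ord0 ord0) j); rewrite -h2 (locP hD hM) (geMl hv) //.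
apply: ge_le; have := RM _ (ha ord0 j); rewrite (locP hD hM).
move: nj; rewrite !geP //; move: (vM D M (a ord0 j)) => u; lia.
Qed.

Lemma loc_inj M M' : maxideal D M -> maxideal D M' ->
  (forall x, loc D M x -> loc D M' x) -> M' = M.
Proof.
move=> hM hM' h; have hv := vMP hD hM'.
have sub x : M' x -> M x.
  move=> M'x; apply: contrapT => nMx; have x0 := max_neq0 hM nMx.
  have := h _ (loc_inv hD (maxD hM' M'x) nMx).
  have := max_ge1 hD hM' M'x; rewrite (locP hD hM') !geP ?invr_eq0 // (valV hv) //.
  move: (vM D M' x) => u; lia.
have [_ [_ /(_ M)]] := hM'; case; [by case: hM|exact: sub|by move/seteqE|].
by move/(max1 hM).
Qed.

(** By local finiteness [c] is a nonunit in finitely many members only, and multiplying the elements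
    from [flat_unit] gives [a], a unit at [M], with [a / c] in every member except [loc D M]. The
    localization at any other place of [NN] contains such a member, so [c] divides [a] there. *)
Lemma isolated M c : maxideal D M -> NN (loc D M) -> jaffard_overring R (loc D M) ->
  D c -> c != 0 -> exists e, D e /\ ~ M e /\
    forall M', maxideal D M' -> M' <> M -> NN (loc D M') -> M' c -> M' e.
Proof.
move=> hM hN [Th [[hpre hfin] ThM]] Dc c0; have hv := vMP hD hM.
have [_ [hov [hfl [hcomp [hind _]]]]] := hpre.
have RM x : R x -> loc D M x by apply.
have [s hs] := hfin c (Tint_D Dc) c0.
have hRr := Tint_ring.
have [a [Ra [a0 [va ha]]]] : exists a, R a /\ a != 0 /\ vM D M a = 0 /\
    forall T, List.In T s -> Th T -> T <> loc D M -> T (a / c).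
  elim: s {hs} => [|T s [a [Ra [a0 [va ha]]]]].
    by exists 1; rewrite oner_neq0 (val_one hv); split=> //; exact: (subring1 hRr).
  have [[hT nT]|h] := pselect (Th T /\ T <> loc D M); last first.
    exists a; split=> //; split=> //; split=> // T' [<-|/ha //].
    by move=> hT nT; case: h.
  have [|b [Rb [b0 [vb hb]]]] := flat_unit hM RM (hfl _ ThM) (hov T hT) _ Dc c0.
    by apply: hind => // /seteqE.
  exists (a * b); split; first exact: (subringM hRr).
  split; first by rewrite mulf_neq0.
  split; first by rewrite (valM hv) // va vb.
  move=> T' hin hT' nT'; have [hTr RT] := hov T' hT'; have hTr' : subring T' := hTr.
  case: hin => [e|hin].
    by rewrite -mulrA; apply: subringM => //; [exact: RT|rewrite -e].
  by rewrite mulrAC; apply: subringM => //; [exact: ha|exact: RT].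
have {}ha T : Th T -> T <> loc D M -> T (a / c).
  move=> hT nT; have [hTr RT] := hov T hT; have hTr' : subring T := hTr.
  have [Tc|nTc] := pselect (T c^-1); first by apply: subringM => //; exact: RT.
  have [T' [hin /seteqE eT]] := hs T hT nTc.
  by apply: ha => //; rewrite eT.
have [d [Dd [nd Dda]]] := loc_denom hM (RM a Ra).
exists (d * a); split=> //; split.
  have d0 := max_neq0 hM nd; rewrite (maxP hD hM Dda) geP ?mulf_neq0 //.
  by rewrite (valM hv) // va (val_unit hD hM Dd nd).
move=> M' hM' nM' hN' M'c; have hv' := vMP hD hM'.
have [T hT TM'] := contains_member hpre hM' hN'.
have nT : T <> loc D M by move=> e; apply: nM'; apply: loc_inj => // x; rewrite -e; exact: TM'.
have := TM' _ (ha T hT nT); rewrite (locP hD hM') => hac.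
rewrite (maxP hD hM' Dda); have -> : d * a = d * (c * (a / c)) by field.
rewrite -[1]add0r; apply: (geM hv'); first exact: D_ge0.
by rewrite -[1]addr0; apply: (geM hv') => //; exact: max_ge1.
Qed.
End Isolation.

(** * Lifting from a subgroup of a free abelian group *)

Section FreeSection.
Variables (E X : zmodType) (A : E -> Prop) (P : X -> Prop).
Variables (rho : X -> E) (c : nat -> E -> int).
Hypotheses (A0 : A 0) (AB : forall u w, A u -> A w -> A (u - w)).
Hypotheses (P0 : P 0) (PB : forall x y, P x -> P y -> P (x - y)).
Hypothesis rhoB : forall x y, rho (x - y) = rho x - rho y.
Hypothesis cB : forall i u w, c i (u - w) = c i u - c i w.
Hypothesis rho_onto : forall u, A u -> exists2 x, P x & rho x = u.
Hypothesis c_fin : forall u, A u -> exists n, forall i, (n <= i)%N -> c i u = 0.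
Hypothesis c_inj : forall u, A u -> (forall i, c i u = 0) -> u = 0.

Lemma subr_closed_mulz (V : zmodType) (Q : V -> Prop) u (m : int) :
  Q 0 -> (forall x y, Q x -> Q y -> Q (x - y)) -> Q u -> Q (u *~ m).
Proof.
move=> Q0 QB Qu.
have QN x : Q x -> Q (- x) by move=> Qx; rewrite -sub0r; exact: QB.
have Qn n : Q (u *+ n).
  elim: n => [|n ih]; first by rewrite mulr0n.
  by rewrite mulrS -[u *+ n]opprK; apply: QB => //; exact: QN.
case: m => n; first exact: Qn.
by rewrite NegzE mulrNz; apply: QN; exact: Qn.
Qed.

Lemma additive_mulz (V W : zmodType) (f : V -> W) u (m : int) :
  (forall x y, f (x - y) = f x - f y) -> f (u *~ m) = f u *~ m.
Proof.
move=> fB; pose f' : {additive V -> W} := HB.pack f (GRing.isZmodMorphism.Build _ _ f fB).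
exact: (raddfMz f').
Qed.

Let rho0 : rho 0 = 0.
Proof. by rewrite -[X in rho X](subrr 0) rhoB subrr. Qed.

Let c0 i : c i 0 = 0.
Proof. by rewrite -[X in c i X](subrr 0) cB subrr. Qed.

Let tail k u := A u /\ forall i, (k <= i)%N -> c i u = 0.

Let tail0 k : tail k 0.
Proof. by split=> // i _; exact: c0. Qed.

Let tailB k u w : tail k u -> tail k w -> tail k (u - w).
Proof.
move=> [Au hu] [Aw hw]; split; first exact: AB.
by move=> i hi; rewrite cB hu // hw // subrr.
Qed.

Let tailD k u w : tail k u -> tail k w -> tail k (u + w).
Proof.
by move=> hu hw; rewrite -[w]opprK; apply: tailB => //; rewrite -sub0r; apply: tailB.
Qed.

(** The [k]-th coordinate of the first component generates the group of [k]-th coordinates of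
    [tail k.+1]. When that group is zero the pair [(0, 0)] serves, as [0] divides [0]. *)
Lemma leading_basis k : exists bx : E * X, tail k.+1 bx.1 /\ P bx.2 /\ rho bx.2 = bx.1 /\
  forall u, tail k.+1 u -> (c k bx.1 %| c k u)%Z.
Proof.
pose Q n := `[< exists u, tail k.+1 u /\ (0 < n)%N /\ c k u = n%:Z >].
have [exQ|nQ] := pselect (exists n, Q n); last first.
  exists (0, 0); split; first exact: tail0.
  split=> //; split; first exact: rho0.
  move=> u hu; suff -> : c k u = 0 by rewrite dvdz0.
  apply: contrapT => h; apply: nQ.
  have [ck|ck|//] := ltgtP (c k u) 0; last first.
    by exists `|c k u|%N; apply/asboolP; exists u; do 2 split=> //; lia.
  exists `|c k u|%N; apply/asboolP; exists (0 - u); split; first exact: tailB.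
  rewrite cB c0.
  by split; lia.
case: (ex_minnP exQ) => n /asboolP [b [hb [n0 cb]]] hmin.
have [x Px rx] := rho_onto hb.1.
exists (b, x) => /=; do 3 split=> //; move=> u hu.
pose w := u - b *~ (c k u %/ c k b)%Z.
have hw : tail k.+1 w by apply: tailB => //; apply: subr_closed_mulz => //; exact: tailB.
have cw : c k w = (c k u %% c k b)%Z.
  by rewrite /w cB (additive_mulz _ _ (cB k)) mulrzz mulrC /modz.
apply/dvdz_mod0P; apply: contrapT => h0.
have b0 : c k b != 0 by rewrite cb; lia.
have m0 := modz_ge0 (c k u) b0.
have ml : (c k u %% c k b)%Z < n%:Z by have := ltz_pmod (c k u) (d := n%:Z); rewrite cb; apply; lia.
have : Q `|c k w|%N.
  apply/asboolP; exists w; split=> //; rewrite cw; split; last by lia.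
  by rewrite lt0n absz_eq0; apply/eqP.
by move=> /hmin; rewrite cw; lia.
Qed.

(** The classical proof that a subgroup of a free abelian group of countable rank is free, as a
    recursion: the top coordinate of [u] is removed by subtracting a multiple of [b k], and the same
    multiple of the preimage [x k] is recorded. Division is exact on [tail k.+1], which makes the
    quotients [m k] additive. *)
Lemma free_section : exists s : E -> X,
  (forall u, A u -> P (s u) /\ rho (s u) = u) /\
  (forall u w, A u -> A w -> s (u + w) = s u + s w).
Proof.
have [bx hbx] := choice leading_basis.
pose b k := (bx k).1; pose x k := (bx k).2.
have rhoD u w : rho (u + w) = rho u + rho w.
  by rewrite -{1}[w]opprK rhoB -[- w]sub0r rhoB rho0 sub0r opprK.
have cD i u w : c i (u + w) = c i u + c i w.
  by rewrite -{1}[w]opprK cB -[- w]sub0r cB c0 sub0r opprK.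
have PD u w : P u -> P w -> P (u + w).
  by move=> hu hw; rewrite -[w]opprK; apply: PB => //; rewrite -sub0r; exact: PB.
pose m k u := (c k u %/ c k (b k))%Z.
pose fix S (k : nat) (u : E) {struct k} : X :=
  if k is k'.+1 then S k' (u - b k' *~ m k' u) + x k' *~ m k' u else 0.
have hm k u : tail k.+1 u -> tail k (u - b k *~ m k u).
  move=> hu; have [hb [_ [_ hdv]]] := hbx k.
  have h : tail k.+1 (u - b k *~ m k u).
    by apply: tailB => //; apply: (subr_closed_mulz _ (tail0 _) (@tailB _)).
  split; first by case: h.
  move=> i; rewrite leq_eqVlt => /orP[/eqP<-|]; last by case: h => _; exact.
  rewrite cB (additive_mulz _ _ (cB k)) mulrzz mulrC /m divzK ?subrr //.
  exact: hdv.
have S1 k u : tail k u -> P (S k u) /\ rho (S k u) = u.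
  elim: k u => [|k ih] u hu /=.
    by case: hu => Au hu; split=> //; rewrite rho0 (c_inj Au) // => i; exact: hu.
  have [h1 h2] := ih _ (hm k u hu); have [_ [Px [rx _]]] := hbx k.
  split; first by apply: PD => //; exact: subr_closed_mulz.
  by rewrite rhoD h2 (additive_mulz _ _ rhoB) rx subrK.
have S2 k u w : tail k u -> tail k w -> S k (u + w) = S k u + S k w.
  elim: k u w => [|k ih] u w hu hw /=; first by rewrite addr0.
  have em : m k (u + w) = m k u + m k w.
    by rewrite /m cD divzDl //; have [_ [_ [_ h]]] := hbx k; exact: h.
  have -> : u + w - b k *~ m k (u + w) = (u - b k *~ m k u) + (w - b k *~ m k w).
    by rewrite em mulrzDr opprD addrACA.
  rewrite ih; [|exact: hm|exact: hm].
  by rewrite em mulrzDr addrACA.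
(* Starting the recursion higher changes nothing, so elements with different bounds can be compared
   at a common one. *)
have S3 k u : tail k u -> S k.+1 u = S k u.
  move=> [_ hu] /=; have -> : m k u = 0 by rewrite /m hu // div0z.
  by rewrite !mulr0z subr0 addr0.
have S4 k j u : tail k u -> S (k + j)%N u = S k u.
  move=> hu; elim: j => [|j ih]; first by rewrite addn0.
  rewrite addnS S3 //; split; first by case: hu.
  by move=> i hi; case: hu => _; apply; lia.
have [n hn] : exists n : E -> nat, forall u, A u -> tail (n u) u.
  suff /choice[n hn] : forall u, exists n, A u -> tail n u by exists n.
  move=> u; have [Au|nA] := pselect (A u); last by exists 0%N.
  by have [n hn] := c_fin Au; exists n.
exists (fun u => S (n u) u); split=> [u Au|u w Au Aw]; first exact: S1 (hn u Au).
have Auw : A (u + w) by case: (tailD (k := maxn (n u) (n w)) (u := u) (w := w)) => //;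
  split=> // i hi; [case: (hn u Au)|case: (hn w Aw)] => _; apply; lia.
pose N := maxn (n (u + w)) (maxn (n u) (n w)).
have up v : A v -> (n v <= N)%N -> S (n v) v = S N v /\ tail N v.
  move=> Av le; split; first by rewrite -(subnKC le) S4 //; exact: hn.
  by split=> // i hi; have [_] := hn v Av; apply; exact: leq_trans hi.
have [|-> _] := up _ Auw; first by rewrite leq_maxl.
have [|-> hu] := up _ Au; first by rewrite !leq_max leqnn orbT.
have [|-> hw] := up _ Aw; first by rewrite !leq_max leqnn !orbT.
exact: S2.
Qed.
End FreeSection.

(** * Coordinates on the local class groups *)

Section LocalCoordinates.
Variables (K : fieldType) (D M : K -> Prop).
Hypotheses (hD : almost_dedekind D) (hM : maxideal D M).
Let hR := ringD hD.
Let hv := vMP hD hM.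
Hint Resolve hR : core.
Local Notation v := (vM D M).
Local Notation mge := (vge v).
Local Notation SM := (eq M).

Lemma geD0 x : D x -> mge 0 x. Proof. exact: D_ge0. Qed.

Lemma poly_bounded_seq (s : seq {poly K}) : exists m : int, m <= 0 /\
  forall f, f \in s -> forall i, mge m f`_i.
Proof.
elim: s => [|f s [m [m0 h]]]; first by exists 0.
have [n [n0 hn]] := poly_bounded v f.
exists (Num.min m n); split; first by rewrite ge_min m0.
move=> g; rewrite inE => /orP[/eqP->|/h hg] i.
  by apply: (ge_le _ (hn i)); rewrite ge_min lexx orbT.
by apply: (ge_le _ (hg i)); rewrite ge_min lexx.
Qed.

Section Family.
Variables (n : nat) (p q : 'I_n -> {poly K}).
Hypothesis hpq : 1 = \sum_(i < n) p i * q i.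

Lemma family_compare a m k : (forall i, mge m (p i).[a]) -> (forall i, mge k (q i).[a]) ->
  m + k <= 0.
Proof.
move=> hp hq; apply: (ge_one hv).
rewrite -[X in vge _ _ X](hornerC 1 a) polyC1 hpq horner_sum; apply: (ge_sum hv) => i.
by rewrite hornerM; apply: (geM hv).
Qed.
End Family.

(** [Phi] is controlled by the finitely many [p i] and [q i]: if all their coefficients have value
    at least [m], it lies between [m] and [- m]. *)
Lemma Phi_continuous J J' : dual (IntS D SM) J J' ->
  exists n : int, forall a b, D a -> D b -> mge n (a - b) -> Phi D J J' M a = Phi D J J' M b.
Proof.
move=> hJ; have [_ [_ [_ [n [p [q [hp [hq e]]]]]]]] := hJ.
have [m [m0 hm]] := poly_bounded_seq (codom p ++ codom q).
have mp i : forall j, mge m (p i)`_j by apply: hm; rewrite mem_cat codom_f.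
have mq i : forall j, mge m (q i)`_j by apply: hm; rewrite mem_cat codom_f orbT.
have hP a : D a -> isval D M a J J' (Phi D J J' M a).
  by move=> Da; exact: (PhiP hD (maxset1 hM) hJ erefl Da).
have le1 a : D a -> Phi D J J' M a + m <= 0.
  move=> Da; have [h1 _] := hP a Da; apply: (family_compare e (a := a)) => i; first exact: h1.
  by apply: (ge_horner hv) => //; exact: geD0.
have le2 a : D a -> m - Phi D J J' M a <= 0.
  move=> Da; have [_ h2] := hP a Da; apply: (family_compare e (a := a)) => i; last exact: h2.
  by apply: (ge_horner hv) => //; exact: geD0.
(* At this distance the [p i] and [q i] change by terms of value at least [- m], which is no less
   than [Phi] and its opposite, so the bounds at one point carry over to the other. *)
exists (- m - m) => a b Da Db hab.
have [h1 h2] := hP a Da; have [h3 h4] := hP b Db.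
have hba : mge (- m - m) (b - a) by rewrite -[b - a]opprB; exact: (geN hv).
have near (f : {poly K}) u : (forall i, mge m f`_i) -> u <= - m -> mge u f.[a] -> mge u f.[b].
  move=> hf hu ha; rewrite -[f.[b]](subrK f.[a]); apply: (geD hv) => //.
  have := ge_horner_sub hv hf (geD0 Db) (geD0 Da) hba; apply: ge_le.
  by move: hu; rewrite addrA subrr add0r.
have la := le1 a Da; have la' := le2 a Da.
apply/eqP; rewrite eq_le; apply/andP; split.
  rewrite -subr_le0; apply: (family_compare e (a := b)) => i; last exact: h4.
  by apply: near => //; [lia|exact: h1].
rewrite -subr_le0; apply: (family_compare e (a := b)) => i; first exact: h3.
by apply: near => //; [lia|exact: h2].
Qed.

Lemma ge_total x y : (forall n, mge n x -> mge n y) \/ (forall n, mge n y -> mge n x).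
Proof.
have [->|x0] := eqVneq x 0; first by right=> *; left.
have [->|y0] := eqVneq y 0; first by left=> *; left.
have [h|h] := leP (v x) (v y); [left|right] => n; rewrite !geP // => h'.
  exact: le_trans h' h.
exact: le_trans h' (ltW h).
Qed.

Definition finite_residue := exists l : seq K, (forall r, r \in l -> D r) /\
  forall x, D x -> exists2 r, r \in l & M (x - r).

(** Digit expansion in a uniformizer [t] chosen in [D]. *)
Lemma residues_mod_power n : finite_residue -> exists l : seq K,
  (forall r, r \in l -> D r) /\ forall x, D x -> exists2 r, r \in l & mge n%:Z (x - r).
Proof.
move=> [l [lD hl]].
have [t [Dt [t0 vt]]] : exists t, D t /\ t != 0 /\ v t = 1.
  have [s [s0 vs]] := exists_val hv 1.
  have [|d [Dd [nd Dds]]] := loc_denom hM (x := s).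
    by rewrite (locP hD hM) geP // vs.
  have d0 := max_neq0 hM nd.
  by exists (d * s); rewrite mulf_neq0 // (valM hv) // vs (val_unit hD hM Dd nd).
elim: n => [|n [L [LD hL]]].
  exists [:: 0]; split=> [r|x Dx]; first by rewrite inE => /eqP->; exact: subring0.
  by exists 0; rewrite ?inE // subr0; exact: geD0.
exists [seq r + t * y | r <- l, y <- L]; split.
  move=> _ /allpairsP[[r y] /= [hr hy ->]].
  by apply: subringD => //; [exact: lD|apply: subringM => //; exact: LD].
move=> x Dx; have [r hr Mxr] := hl x Dx.
have hloc : loc D M ((x - r) / t).
  by rewrite -(ge_div hv _ t0 vt); exact: (max_ge1 hD hM).
have [z [Dz hz]] := density hD hM n hloc.
have [y hy hzy] := hL z Dz.
exists (r + t * y); first by apply/allpairsP; exists (r, y).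
have -> : x - (r + t * y) = t * (((x - r) / t - z) + (z - y)) by field.
rewrite -add1n PoszD; apply: (geM hv); last exact: (geD hv).
by have := ge_self v t; rewrite vt.
Qed.

Lemma dense_sequence : finite_residue -> exists a : nat -> K, (forall i, D (a i)) /\
  forall n : nat, exists k, forall x, D x -> exists2 i, (i < k)%N & mge n%:Z (x - a i).
Proof.
move=> fr; have [L hL] := choice (fun n => residues_mod_power n fr).
(* The lists [L n] for all precisions are merged into one sequence; indices that code no entry give
   [0]. *)
pose a i := if @unpickle (nat * nat)%type i is Some (n, j) then nth 0 (L n) j else 0.
exists a; split=> [i|n].
  rewrite /a; case: unpickle => [[n j]|]; last exact: subring0.
  have [h|h] := ltnP j (size (L n)); last by rewrite nth_default //; exact: subring0.
  by have [hl _] := hL n; apply: hl; exact: mem_nth.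
exists (\max_(j < size (L n)) pickle (n, j : nat)).+1 => x Dx.
have [_ h] := hL n; have [r hr hxr] := h x Dx.
pose j := index r (L n); have jl : (j < size (L n))%N by rewrite index_mem.
exists (pickle (n, j)).
  by rewrite ltnS; exact: (leq_bigmax (Ordinal jl)).
by rewrite /a pickleK nth_index.
Qed.

(** The nearest earlier term is taken so that the increment of a uniformly continuous function from
    [a p] to [a i] vanishes as soon as any earlier term is close enough to [a i]. *)
Lemma nearest_predecessor (a : nat -> K) i : exists p, (0 < i)%N -> (p < i)%N /\
  forall n, (exists2 j, (j < i)%N & mge n (a i - a j)) -> mge n (a i - a p).
Proof.
suff H k : exists p, (0 < k)%N -> (p < k)%N /\
    forall n, (exists2 j, (j < k)%N & mge n (a i - a j)) -> mge n (a i - a p) by exact: H.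
elim: k => [|k [p hp]]; first by exists 0%N.
have [k0|k0] := posnP k.
  by exists 0%N => _; split=> // n [j]; rewrite k0 ltnS leqn0 => /eqP->.
have [pk hpk] := hp k0.
have [h|h] := ge_total (a i - a p) (a i - a k).
  exists k => _; split=> // n [j]; rewrite ltnS leq_eqVlt => /orP[/eqP->//|jk hj].
  by apply: h; apply: hpk; exists j.
exists p => _; split; first exact: ltnW.
move=> n [j]; rewrite ltnS leq_eqVlt => /orP[/eqP->|jk] hj; first exact: h.
by apply: hpk; exists j.
Qed.

Fixpoint incongruent (l : seq K) : Prop :=
  if l is x :: l' then D x /\ (forall r, r \in l' -> ~ M (x - r)) /\ incongruent l' else True.

Lemma incongruent_D l r : incongruent l -> r \in l -> D r.
Proof.
elim: l => // x l ih [Dx [_ hl]]; rewrite inE => /orP[/eqP->//|]; exact: ih.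
Qed.

Lemma incongruent_filter (P : pred K) l : incongruent l -> incongruent (filter P l).
Proof.
elim: l => // x l ih [Dx [hx hl]] /=; case: ifP => _; last exact: ih.
split=> //; split; last exact: ih.
by move=> r; rewrite mem_filter => /andP[_]; exact: hx.
Qed.

Lemma incongruent_ex n : ~ finite_residue -> exists l, incongruent l /\ size l = n.
Proof.
move=> nf; elim: n => [|n [l [hl sl]]]; first by exists [::].
apply: contrapT => nx; apply: nf; exists l; split; first by move=> r; exact: incongruent_D.
move=> x Dx; apply: contrapT => h; apply: nx; exists (x :: l); rewrite /= sl.
by split=> //; split=> //; split=> // r hr Mr; apply: h; exists r.
Qed.

(* Newton interpolation: the divided differences have unit denominators. *)
Lemma interpolation_bound n (f : {poly K}) l : incongruent l -> (size f <= size l)%N ->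
  (forall r, r \in l -> mge n f.[r]) -> forall b, D b -> mge n f.[b].
Proof.
elim: l f => [|x l ih] f /=.
  by rewrite leqn0 size_poly_eq0 => _ /eqP-> _ b _; rewrite horner0; left.
move=> [Dx [hx hl]] sf hf b Db.
have : root (f - f.[x]%:P) x by rewrite rootE hornerD hornerN hornerC subrr.
move=> /factor_theorem [g eg].
have ef : f = g * ('X - x%:P) + f.[x]%:P by rewrite -eg subrK.
have fE z : f.[z] = g.[z] * (z - x) + f.[x].
  by rewrite {1}ef hornerD hornerM hornerXsubC hornerC.
have sg : (size g <= size l)%N.
  have [->|g0] := eqVneq g 0; first by rewrite size_poly0.
  have : (size (f - f.[x]%:P)%R <= (size l).+1)%N.
    apply: leq_trans (size_polyD _ _) _; rewrite geq_max sf size_polyN.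
    by apply: leq_trans (size_polyC_leq1 _) _.
  by rewrite eg size_Mmonic ?monicXsubC // size_XsubC addn2.
have hg r : r \in l -> mge n g.[r].
  move=> rl; have Dr := incongruent_D hl rl.
  have nrx : ~ M (r - x).
    move=> h; apply: (hx r rl); rewrite -[x - r]opprB -mulN1r; apply: (maxM hM) => //.
    by apply: subringN => //; exact: subring1.
  have Drx : D (r - x) by exact: subringB.
  have : mge n ((r - x) * g.[r]).
    have -> : (r - x) * g.[r] = f.[r] - f.[x] by rewrite (fE r); ring.
    by apply: (geB hv); apply: hf; rewrite inE ?eqxx ?rl ?orbT.
  by rewrite (geMl hv) ?(max_neq0 hM nrx) // (val_unit hD hM Drx nrx) subr0.
rewrite fE; apply: (geD hv); last by apply: hf; rewrite inE eqxx.
rewrite -[n]addr0; apply: (geM hv); first exact: (ih _ hl sg hg).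
by apply: geD0; exact: subringB.
Qed.

(** Pigeonhole on [d + d] incongruent points, where [d] bounds the sizes of the [p i] and [q i]. If
    [Phi] exceeds its value at [b] on [d] of them, interpolating the [p i] gives an impossible bound
    at [b]; otherwise interpolating the [q i] bounds [Phi] at [a] by its value at [b]. *)
Lemma Phi_infinite_residue J J' a b : ~ finite_residue -> dual (IntS D SM) J J' ->
  D a -> D b -> Phi D J J' M a <= Phi D J J' M b.
Proof.
move=> nf hJ Da Db; have [_ [_ [_ [n [p [q [hp [hq e]]]]]]]] := hJ.
have hP x : D x -> isval D M x J J' (Phi D J J' M x).
  by move=> Dx; exact: (PhiP hD (maxset1 hM) hJ erefl Dx).
pose d := maxn (\max_(i < n) size (p i)) (\max_(i < n) size (q i)).
have dp i : (size (p i) <= d)%N by rewrite leq_max (leq_bigmax i).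
have dq i : (size (q i) <= d)%N by rewrite leq_max (leq_bigmax i) orbT.
clearbody d; have [l [hl sl]] := incongruent_ex (d + d) nf.
rewrite leNgt; apply/negP => lt.
pose A x := (Phi D J J' M b + 1 <= Phi D J J' M x).
have : (d <= size (filter A l))%N || (d <= size (filter (predC A) l))%N.
  have := count_predC A l; rewrite !size_filter sl.
  move: (count _ _) (count _ _) => u w; lia.
case/orP => hd.
  have := family_compare e (a := b) (m := Phi D J J' M b + 1) (k := - Phi D J J' M b).
  rewrite addrAC subrr add0r => h; suff : (1 : int) <= 0 by [].
  apply: h => i; last by have [_ h2] := hP b Db; exact: h2.
  apply: (interpolation_bound (incongruent_filter A hl)) => //.
    exact: leq_trans (dp i) hd.
  move=> r; rewrite mem_filter => /andP[Ar rl].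
  have [h1 _] := hP r (incongruent_D hl rl); exact: (ge_le Ar (h1 _ (hp i))).
have : Phi D J J' M a - Phi D J J' M b <= 0.
  apply: (family_compare e (a := a)) => i; first by have [h1 _] := hP a Da; exact: h1.
  apply: (interpolation_bound (incongruent_filter (predC A) hl)) => //.
    exact: leq_trans (dq i) hd.
  move=> r; rewrite mem_filter => /andP[Ar rl].
  have [_ h2] := hP r (incongruent_D hl rl); apply: (ge_le _ (h2 _ (hq i))).
  by rewrite lerN2; move: Ar; rewrite /= /A -ltNge ltzD1.
by rewrite subr_le0 leNgt lt.
Qed.

(* If the residue field is finite, [a] enumerates a dense subset of [D] and a class
   is recovered from its increments along the forest [i -> p i]; almost all
   increments vanish by uniform continuity. *)
Lemma local_coordinates : exists c : nat -> (K -> int) -> int,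
  (forall i (u w : K -> int), c i (u - w) = c i u - c i w) /\
  (forall f, valueG D SM f -> exists n, forall i, (n <= i)%N -> c i (f M) = 0) /\
  (forall f, valueG D SM f -> (forall i, c i (f M) = 0) -> f M = 0).
Proof.
have [fr|nf] := pselect finite_residue; last first.
  (* The local group is trivial in this case, so zero coordinates separate its elements. *)
  exists (fun _ _ => 0); split; first by move=> *; rewrite subrr.
  split; first by move=> f _; exists 0%N.
  move=> f [J [J' [hJ ->]]] _; apply/funext => a.
  have [[_ Da]|na] := pselect (M = M /\ D a); last by rewrite norm_Phi_out.
  rewrite norm_Phi_in //; apply/eqP; rewrite subr_eq0; apply/eqP.
  by apply: le_anti; rewrite !Phi_infinite_residue //; exact: subring0.
have [a [aD ha]] := dense_sequence fr.
have [p hp] := choice (nearest_predecessor a).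
exists (fun i u => if i is 0%N then u (a 0%N) else u (a i) - u (a (p i))).
split; first by move=> [|i] u w; rewrite !fctE //=; ring.
have phi_eq f : valueG D SM f -> exists n : nat, forall x y, D x -> D y -> mge n%:Z (x - y) -> f M x = f M y.
  move=> [J [J' [hJ ->]]]; have [n hn] := Phi_continuous hJ.
  exists `|n|%N => x y Dx Dy hxy; rewrite !norm_Phi_in //; congr (_ - _).
  by apply: hn => //; apply: ge_le hxy; lia.
split=> f hf; have [n hn] := phi_eq f hf; have [k hk] := ha n.
  exists k.+1 => -[//|i]; rewrite ltnS => ki.
  have [pi hpi] := hp i.+1 erefl.
  apply/eqP; rewrite subr_eq0; apply/eqP; apply: hn => //; apply: hpi.
  by have [j jk hj] := hk (a i.+1) (aD _); exists j => //; lia.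
move=> hc.
have h0 i : f M (a i) = 0.
  elim/ltn_ind: i => -[_|i ih]; first exact: (hc 0%N).
  have [pi _] := hp i.+1 erefl.
  by have := hc i.+1 => /eqP; rewrite subr_eq0 => /eqP->; exact: ih.
apply/funext => x; have [Dx|nx] := pselect (D x).
  by have [i _ hi] := hk x Dx; rewrite (hn x (a i)) //; exact: h0.
by case: hf => J [J' [_ ->]]; rewrite norm_Phi_out // => -[].
Qed.
End LocalCoordinates.

(** * Classes of fractional ideals *)

Section PicInt.
Variables (K : fieldType) (D : K -> Prop).
Hypothesis hD : almost_dedekind D.
Variable S : (K -> Prop) -> Prop.
Hypothesis hS : maxset D S.
Local Notation A := (capS D S).
Local Notation Gam := ((K -> Prop) -> K -> int).
Local Notation tf := (@FracField.tofrac {poly K} : {rmorphism {poly K} -> {fraction {poly K}}}).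
Implicit Types I J : KX K -> Prop.

Lemma tofrac_inj : injective tf.
Proof. by move=> p q /eqP; rewrite tofrac_eq => /eqP. Qed.

Lemma IntF_imF : IntF A = imF tf 1 (IntS D S).
Proof.
rewrite /IntF (Int_capS hD hS); apply: seteqE => y.
by split=> -[p [hp ->]]; exists p; rewrite mul1r.
Qed.

Lemma emb_imF (L : K -> Prop) : emb L = imF tf 1 (constP L).
Proof.
apply: seteqE => y; split=> [[l [hl ->]]|[_ [[l [hl ->]] ->]]].
  by exists l%:P; rewrite mul1r; split=> //; exists l.
by exists l; rewrite mul1r.
Qed.

Lemma picint_rel I J : picint_eqv A I J <-> pic_rel D tf S I J.
Proof.
rewrite /picint_eqv IntF_imF /pic_rel.
by split=> -[L [x h]]; exists L, x; move: h; rewrite emb_imF.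
Qed.

Definition class I : Gam := xget 0 [set f | clrel D tf S I f]%classic.

Lemma classP I : invertible (IntF A) I -> clrel D tf S I (class I).
Proof.
rewrite IntF_imF => /(cl_ex hD tofrac_inj hS) [f hf].
exact: (xgetPex 0 (ex_intro _ f hf)).
Qed.

Lemma classE I f : clrel D tf S I f -> class I = f.
Proof.
by move=> hf; apply: (cl_fun hD tofrac_inj hS _ hf); exact: (xgetPex 0 (ex_intro _ f hf)).
Qed.

Lemma clrel_invertible I f : clrel D tf S I f -> invertible (IntF A) I.
Proof. by rewrite IntF_imF; exact: (cl_invertible hD tofrac_inj (@fraction_ex _) hS). Qed.

Lemma class_eqv I J : invertible (IntF A) I -> invertible (IntF A) J ->
  picint_eqv A I J <-> class I = class J.
Proof.
by move=> hI hJ; rewrite picint_rel; apply: (cl_eqv hD tofrac_inj hS); exact: classP.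
Qed.

Lemma class_mul I J : invertible (IntF A) I -> invertible (IntF A) J ->
  invertible (IntF A) (prodI I J) /\ class (prodI I J) = class I + class J.
Proof.
move=> hI hJ; have h := cl_mul hD hS (classP hI) (classP hJ).
by split; [exact: clrel_invertible h|exact: classE].
Qed.

Lemma class_one : invertible (IntF A) (IntF A) /\ class (IntF A) = 0.
Proof.
have h : clrel D tf S (IntF A) 0 by rewrite IntF_imF; exact: cl_one.
by split; [exact: clrel_invertible h|exact: classE].
Qed.

Lemma class_G I : invertible (IntF A) I -> valueG D S (class I).
Proof. by move/classP/cl_G. Qed.

Lemma valueG_class f : valueG D S f -> exists I, invertible (IntF A) I /\ class I = f.
Proof.
move=> /(@valueG_cl _ _ _ tf _ _) [I hI]; exists I.
by split; [exact: clrel_invertible hI|exact: classE].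
Qed.

Lemma class_local M I J : S = eq M -> invertible (IntF A) I -> invertible (IntF A) J ->
  pic_eqv (IntF A) I J <-> class I = class J.
Proof.
move=> eS hI hJ; rewrite {1}IntF_imF.
by apply: (cl_local hD tofrac_inj hS eS); exact: classP.
Qed.
End PicInt.

(** * The transfinite argument *)

Section Assembly.
Variables (K : fieldType) (D : K -> Prop) (W : Type) (lt : W -> W -> Prop).
Variables (N : W -> (K -> Prop) -> Prop) (alpha : W).
Hypothesis hD : almost_dedekind D.
Hypothesis hlt : well_order lt.
Hypothesis hN : derived_seq D lt N.
Hypothesis hU : forall M, maxideal D M -> ~ N alpha (loc D M) -> Int_ext_eq D (loc D M).
Hypothesis hT : Int_ext_eq D (Tint (N alpha)).
Let hR := ringD hD.
Hint Resolve hR : core.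
Local Notation Gam := ((K -> Prop) -> K -> int).
Local Notation Gmax := (valueG D (maxideal D)).
Implicit Types (M : K -> Prop) (g : Gam).

(** * Levels of places and closedness of the surviving set *)

Definition inU M := maxideal D M /\ ~ N alpha (loc D M).
Definition stay M := maxideal D M /\ N alpha (loc D M).
Definition level M w := N w (loc D M) /\ jaffard_overring (Tint (N w)) (loc D M).

Lemma lt_trans a b c : lt a b -> lt b c -> lt a c.
Proof. by case: hlt => _ [h _]; exact: h. Qed.

Lemma lt_total a b : lt a b \/ a = b \/ lt b a.
Proof. by case: hlt => _ [_ h]; exact: h. Qed.

Lemma N_Theta w T : N w T -> Theta D T.
Proof. by move=> /hN []. Qed.

Lemma level_not M v w : level M v -> lt v w -> ~ N w (loc D M).
Proof. by move=> [_ hj] vw /hN [_ /(_ v vw) [_]]; apply. Qed.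

Lemma level_uniq M v w : level M v -> level M w -> v = w.
Proof.
move=> hv hw; case: (lt_total v w) => [vw|[//|wv]].
  by case: (level_not hv vw); case: hw.
by case: (level_not hw wv); case: hv.
Qed.

(** If no stage below [w] removes [M], induction keeps [M] in every earlier [N v], and the uniform
    recursion then puts it into [N w]; successors and limits are treated alike. *)
Lemma not_N_level M w : maxideal D M -> ~ N w (loc D M) -> exists2 v, lt v w & level M v.
Proof.
move=> hM; case: hlt => hwf _; elim/(well_founded_ind hwf): w => w ih nN.
apply: contrapT => h; apply: nN; apply/hN; split; first by exists M.
move=> v vw; have Nv : N v (loc D M).
  apply: contrapT => /(ih v vw) [u uv hu]; apply: h; exists u => //.
  exact: lt_trans uv vw.
by split=> // hj; apply: h; exists v.
Qed.

Lemma inU_level M : inU M -> exists2 v, lt v alpha & level M v.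
Proof. by move=> [hM nN]; exact: not_N_level. Qed.

Lemma isolated_level M w c : maxideal D M -> level M w -> D c -> c != 0 ->
  exists e, D e /\ ~ M e /\ forall M', maxideal D M' -> M' <> M -> M' c -> ~ M' e ->
    exists2 v, lt v w & level M' v.
Proof.
move=> hM [hNM hj] Dc c0.
have [e [De [ne he]]] := isolated hD (@N_Theta w) hM hNM hj Dc c0.
exists e; split=> //; split=> // M' hM' nM' M'c nM'e; apply: not_N_level => // hN'.
by apply: nM'e; exact: he.
Qed.

Lemma maxset_stay : maxset D stay. Proof. by move=> M []. Qed.

Lemma Tint_stay : Tint (N alpha) = capS D stay.
Proof.
apply: seteqE => x; split=> h; first by move=> M [_ hM]; exact: h.
move=> T NT; have [M hM eT] := Theta_loc (N_Theta NT); rewrite eT; apply: h.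
by split=> //; rewrite -eT.
Qed.

Lemma capS1 M : capS D (eq M) = loc D M.
Proof. by apply: seteqE => x; split=> [|h _ <-//]; exact. Qed.

Lemma extends_Int S : maxset D S -> Int_ext_eq D (capS D S) -> extends_to D S.
Proof.
move=> hS /seteqE e f; rewrite -(Int_capS hD hS) -e.
by rewrite -{1}(capS_max hD) (Int_capS hD (@maxset_max K D)).
Qed.

Lemma extendsU M : inU M -> extends_to D (eq M).
Proof.
move=> [hM nN]; apply: extends_Int; first exact: maxset1.
by rewrite capS1; exact: hU.
Qed.

Lemma extends_stay : extends_to D stay.
Proof. by apply: extends_Int; [exact: maxset_stay|rewrite -Tint_stay]. Qed.

(** A removed place containing [c] has, among the places containing [c], a neighbourhood without
    surviving ones ([isolated_level]), given by an element of [Z]. Hence [1] lies in [I + Z + c D],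
    and its component in [I] is the required [d], the other two lying in every surviving place that
    contains [c]. *)
Lemma separated_stay : separated D stay.
Proof.
move=> I c hI hS Dc c0; have [I_D [I0 [ID IM]]] := hI.
pose Z x := D x /\ forall M, stay M -> M c -> M x.
pose J x := exists d e k, I d /\ Z e /\ D k /\ x = d + e + c * k.
have D0 : D 0 by exact: subring0.
have Z0 : Z 0 by split=> // M [hM _] _; exact: max0 hM.
have hJ : is_ideal D J.
  split.
    move=> _ [d [e [k [Id [[De _] [Dk ->]]]]]].
    by apply: subringD => //; [apply: subringD => //; exact: I_D|exact: subringM].
  split; first by exists 0, 0, 0; do 3 split=> //; rewrite mulr0 !addr0.
  split.
    move=> _ _ [d [e [k [Id [[De Ze] [Dk ->]]]]]] [d' [e' [k' [Id' [[De' Ze'] [Dk' ->]]]]]].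
    exists (d + d'), (e + e'), (k + k'); split; first exact: ID.
    split; last by split; [exact: subringD|ring].
    split; first exact: subringD.
    by move=> M SM Mc; have [hM _] := SM; apply: (maxDD hM); [exact: Ze|exact: Ze'].
  move=> a _ Da [d [e [k [Id [[De Ze] [Dk ->]]]]]].
  exists (a * d), (a * e), (a * k); split; first exact: IM.
  split; last by split; [exact: subringM|ring].
  split; first exact: subringM.
  by move=> M SM Mc; have [hM _] := SM; apply: (maxM hM) => //; exact: Ze.
have : J 1.
  apply: (local_global hJ) => M hM.
  have [NM|nN] := pselect (N alpha (loc D M)).
    have [d [Id nd]] := hS M (conj hM NM); exists d; split=> //.
    by exists d, 0, 0; do 3 split=> //; rewrite mulr0 !addr0.
  have [Mc|nMc] := pselect (M c); last first.
    exists c; split=> //; exists 0, 0, 1; do 3 split=> //; last by rewrite !add0r mulr1.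
    exact: subring1.
  have [v va hv] := not_N_level hM nN.
  have [e [De [ne he]]] := isolated_level hM hv Dc c0.
  exists e; split=> //; exists 0, e, 0; split=> //; split; last by split=> //; rewrite mulr0 add0r addr0.
  split=> // M' [hM' NM'] M'c; apply: contrapT => nM'e.
  have nM' : M' <> M by move=> e'; apply: nN; rewrite -e'.
  have [u uv hu] := he M' hM' nM' M'c nM'e.
  by apply: (level_not hu _ NM'); exact: lt_trans uv va.
move=> [d [e [k [Id [[De Ze] [Dk e1]]]]]]; exists d; split=> // M SM Mc Md.
have [hM _] := SM; apply: (max1 hM); rewrite e1.
by apply: (maxDD hM); [apply: (maxDD hM) => //; exact: Ze|exact: (maxMr hM)].
Qed.

Lemma Gmax_out g M a : Gmax g -> ~ maxideal D M -> g M a = 0.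
Proof. by move=> [J [J' [_ ->]]] nM; rewrite norm_Phi_out // => -[]. Qed.

Lemma valueG_component f g M : maxideal D M -> valueG D (eq M) f -> valueG D (eq M) g -> f M = g M -> f = g.
Proof.
move=> hM [J [J' [_ ->]]] [I [I' [_ ->]]] h; apply/funext => M'; apply/funext => a.
have [<-|n] := pselect (M = M'); first by rewrite h.
by rewrite !norm_Phi_out // => -[].
Qed.

(** * Additive lifts from a single place *)

Definition localG M (u : K -> int) := exists2 f, valueG D (eq M) f & f M = u.

Lemma localG0 M : maxideal D M -> localG M 0.
Proof. by move=> hM; exists 0 => //; apply: (valueG0 hD); exact: maxset1. Qed.

Lemma localGB M u w : maxideal D M -> localG M u -> localG M w -> localG M (u - w).
Proof.
move=> hM [f hf <-] [g hg <-]; exists (f - g) => //.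
by apply: (valueGB hD) => //; exact: maxset1.
Qed.

Lemma localGD M u w : maxideal D M -> localG M u -> localG M w -> localG M (u + w).
Proof.
move=> hM [f hf <-] [g hg <-]; exists (f + g) => //.
by apply: (valueGD hD) => //; exact: maxset1.
Qed.

Lemma Gmax_local g M : maxideal D M -> Gmax g -> localG M (g M).
Proof.
move=> hM hg; exists (fun M' a => if `[< M = M' >] then g M' a else 0).
  by apply: (valueG_restrict hD _ _ _ hg) => // [|M' <- //]; exact: maxset1.
by apply/funext => a; rewrite asboolT.
Qed.

Definition lower M M' := exists v w, level M v /\ level M' w /\ lt v w.

Definition near_only M g := Gmax g /\
  forall M' a, M' <> M -> g M' a <> 0 -> lower M' M.

(** Lift from the single place, bound the support by [c], and cut away the places containing the [e]
    of [isolated_level]; besides [M] only lower levels remain. *)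
Lemma near_only_onto M u : inU M -> localG M u -> exists2 g, near_only M g & g M = u.
Proof.
move=> UM [f hf <-]; have [hM nN] := UM; have [v va hv] := inU_level UM.
have [g [hg gM]] := lift_class hD (maxset1 hM) (extendsU UM) (@separated1 K D M) hf.
have [c [Dc [c0 hc]]] := finite_support hD hg.
have [e [De [ne he]]] := isolated_level hM hv Dc c0.
exists (fun M' a => if `[< M' e >] then 0 else g M' a); last first.
  by apply/funext => a; rewrite asboolF //; exact: gM.
split; first exact: patch_class.
move=> M' a nM'; case: asboolP => // nM'e gM'.
have hM' : maxideal D M' by apply: contrapT => h; apply: gM'; exact: Gmax_out.
have M'c : M' c by apply: contrapT => h; apply: gM'; exact: hc.
by have [w wv hw] := he M' hM' nM' M'c nM'e; exists w, v.
Qed.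

Lemma section_ex M : exists s : (K -> int) -> Gam, inU M ->
  (forall u, localG M u -> near_only M (s u) /\ s u M = u) /\
  (forall u w, localG M u -> localG M w -> s (u + w) = s u + s w).
Proof.
have [UM|nU] := pselect (inU M); last by exists (fun=> 0).
have [hM _] := UM.
have [c [cB [cfin cinj]]] := local_coordinates hD hM.
have [||||||||s [h1 h2]] := @free_section (K -> int) Gam (localG M) (near_only M)
   (fun g => g M) c _ _ _ _ _ cB.
- exact: localG0.
- by move=> u w; exact: localGB.
- by split=> //; exact: (valueG0 hD).
- move=> x y [Gx hx] [Gy hy]; split; first exact: (valueGB hD).
  move=> M' a nM' hxy; have [ex|nx] := pselect (x M' a = 0); last exact: hx nM' nx.
  apply: (hy M' a nM') => ey; apply: hxy.
  by rewrite !gamE ex ey subrr.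
- by [].
- by move=> u; exact: near_only_onto.
- by move=> u [f hf <-]; exact: cfin.
- by move=> u [f hf <-]; exact: cinj.
by exists s.
Qed.

Definition sec : (K -> Prop) -> (K -> int) -> Gam := projT1 (choice section_ex).

Lemma sec_near M u : inU M -> localG M u -> near_only M (sec M u).
Proof. by move=> UM hu; have [h _] := projT2 (choice section_ex) M UM; case: (h u hu). Qed.

Lemma sec_at M u : inU M -> localG M u -> sec M u M = u.
Proof. by move=> UM hu; have [h _] := projT2 (choice section_ex) M UM; case: (h u hu). Qed.

Lemma secD M u w : inU M -> localG M u -> localG M w -> sec M (u + w) = sec M u + sec M w.
Proof. by move=> UM; have [_] := projT2 (choice section_ex) M UM; exact. Qed.

Lemma sec0 M : inU M -> sec M 0 = 0.
Proof.
move=> UM; have h0 := localG0 UM.1; have := secD UM h0 h0.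
by rewrite addr0 => /eqP; rewrite -subr_eq0 opprD addrA subrr sub0r oppr_eq0 => /eqP.
Qed.

Lemma secB M u w : inU M -> localG M u -> localG M w -> sec M (u - w) = sec M u - sec M w.
Proof.
move=> UM hu hw; have h := secD UM (localGB UM.1 hu hw) hw.
by rewrite subrK in h; rewrite h addrK.
Qed.

(** * Finite sums of lifts *)

Definition carries (l : seq (K -> Prop)) (phi : (K -> Prop) -> K -> int) :=
  uniq l /\ (forall M, M \in l -> inU M) /\
  forall M, inU M -> localG M (phi M) /\ (phi M <> 0 -> M \in l).

Definition total l (phi : (K -> Prop) -> K -> int) : Gam := \sum_(M <- l) sec M (phi M).

(** Since [sec M 0 = 0], both sums reduce to the support of [phi], which the two lists share. *)
Lemma total_indep l l' phi : carries l phi -> carries l' phi -> total l phi = total l' phi.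
Proof.
have key k : carries k phi -> total k phi = \sum_(M <- [seq M <- k | phi M != 0]) sec M (phi M).
  move=> [_ [kU _]]; rewrite /total big_filter [RHS]big_mkcond /=.
  apply: eq_big_seq => M Mk; case: eqP => //= ->; exact/sec0/kU.
move=> hl hl'; rewrite (key l hl) (key l' hl'); apply: perm_big.
case: hl => ul [lU hl]; case: hl' => ul' [lU' hl'].
apply: uniq_perm; rewrite ?filter_uniq // => M; rewrite !mem_filter.
case: eqP => //= n0; apply/idP/idP => Ml.
  by have [_] := hl' M (lU M Ml); apply.
by have [_] := hl M (lU' M Ml); apply.
Qed.

Lemma carries_widen l k phi : carries l phi -> (forall M, M \in k -> inU M) ->
  carries (undup (l ++ k)) phi.
Proof.
move=> [ul [lU hl]] kU; split; first exact: undup_uniq.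
split=> M; first by rewrite mem_undup mem_cat => /orP[]; [exact: lU|exact: kU].
by move=> /hl [h1 h2]; split=> // /h2; rewrite mem_undup mem_cat => ->.
Qed.

Lemma total_add l l' phi psi : carries l phi -> carries l' psi ->
  exists2 k, carries k (phi + psi) & total k (phi + psi) = total l phi + total l' psi.
Proof.
move=> hl hl'; have [_ [lU _]] := hl; have [_ [lU' _]] := hl'.
have h1 := carries_widen hl lU'.
have h2 : carries (undup (l ++ l')) psi.
  have [ul [kU hk]] := carries_widen hl' lU.
  split; first exact: undup_uniq.
  split=> M; first by rewrite mem_undup mem_cat => /orP[]; [exact: lU|exact: lU'].
  by move=> /hk [h hm]; split=> // /hm; rewrite !mem_undup !mem_cat orbC.
have [uk [kU k1]] := h1; have [_ [_ k2]] := h2.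
exists (undup (l ++ l')).
  split=> //; split=> // M UM; have [p1 p2] := k1 M UM; have [q1 q2] := k2 M UM.
  split; first by apply: localGD => //; case: UM.
  move=> hn; apply: contrapT => hM; apply: hn.
  have e1 : phi M = 0 by apply: contrapT => /p2.
  have e2 : psi M = 0 by apply: contrapT => /q2.
  by apply/funext => a; rewrite gamD e1 e2.
rewrite (total_indep hl h1) (total_indep hl' h2) /total -big_split /=.
apply: eq_big_seq => M /kU UM; apply: secD => //; first by case: (k1 M UM).
by case: (k2 M UM).
Qed.

Lemma total_opp l phi : carries l phi -> carries l (- phi) /\ total l (- phi) = - total l phi.
Proof.
move=> [ul [lU hl]]; have hN0 M : inU M -> localG M (- phi M).
  move=> UM; have [h _] := hl M UM; rewrite -sub0r; apply: localGB => //; try by case: UM.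
  by apply: localG0; case: UM.
split.
  split=> //; split=> // M UM; split; first exact: hN0.
  move=> hn; have [_] := hl M UM; apply => h0; apply: hn.
  by apply/funext => a; rewrite gamN h0.
rewrite /total -sumrN; apply: eq_big_seq => M /lU UM.
have [h _] := hl M UM; have -> : (- phi) M = 0 - phi M by rewrite sub0r.
by rewrite secB ?sec0 ?sub0r //; apply: localG0; case: UM.
Qed.

Definition reached g := exists l phi, carries l phi /\ total l phi = g.

Lemma reached0 : reached 0.
Proof.
exists [::], 0; split; last by rewrite /total big_nil.
by split=> //; split=> // M UM; split=> //; apply: localG0; case: UM.
Qed.

Lemma reachedD g h : reached g -> reached h -> reached (g + h).
Proof.
move=> [l [phi [hl <-]]] [l' [psi [hl' <-]]].
by have [k hk e] := total_add hl hl'; exists k, (phi + psi).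
Qed.

Lemma reachedB g h : reached g -> reached h -> reached (g - h).
Proof.
move=> hg [l [phi [hl <-]]]; apply: reachedD => //.
by have [h1 h2] := total_opp hl; exists l, (- phi).
Qed.

Lemma reached_sec M u : inU M -> localG M u -> reached (sec M u).
Proof.
move=> UM hu; pose phi M' : K -> int := if `[< M' = M >] then u else 0.
have eM : phi M = u by rewrite /phi asboolT.
exists [:: M], phi; split; last by rewrite /total big_seq1 eM.
split=> //; split=> M'; first by rewrite inE => /eqP->.
move=> UM'; rewrite /phi; case: asboolP => [->|n]; first by split=> // _; rewrite inE.
by split=> //; apply: localG0; case: UM'.
Qed.

Lemma Gmax_sum (l : seq (K -> Prop)) (F : (K -> Prop) -> Gam) :
  (forall M, M \in l -> Gmax (F M)) -> Gmax (\sum_(M <- l) F M).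
Proof.
elim: l => [|M l ih] h; first by rewrite big_nil; exact: (valueG0 hD).
rewrite big_cons; apply: (valueGD hD) => //; first by apply: h; rewrite inE eqxx.
by apply: ih => M' M'l; apply: h; rewrite inE M'l orbT.
Qed.

Lemma total_Gmax l phi : carries l phi -> Gmax (total l phi).
Proof.
move=> [_ [lU hl]]; apply: Gmax_sum => M /lU UM.
by have [h _] := hl M UM; case: (sec_near UM h).
Qed.

Lemma sum_app (l : seq (K -> Prop)) (F : (K -> Prop) -> Gam) M a :
  (\sum_(M' <- l) F M') M a = \sum_(M' <- l) F M' M a.
Proof.
elim: l => [|M' l ih]; first by rewrite !big_nil.
by rewrite !big_cons gamD ih.
Qed.

(** The lifts live on places of level below [alpha], and a surviving place has no such level. *)
Lemma total_stay l phi M a : carries l phi -> stay M -> total l phi M a = 0.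
Proof.
move=> [_ [lU hl]] [hM NM]; rewrite /total sum_app big_seq big1 // => M' /lU UM'.
have [h _] := hl M' UM'; have [_ hn] := sec_near UM' h.
apply: contrapT => n0; have nM : M <> M' by move=> e; case: UM' => _; rewrite -e.
have [v [w [hv [hw vw]]]] := hn M a nM n0.
have [w' wa hw'] := inU_level UM'.
rewrite -(level_uniq hw hw') in wa.
by apply: (level_not hv _ NM); exact: lt_trans vw wa.
Qed.

Lemma top_element (l : seq (K -> Prop)) : l <> [::] -> (forall M, M \in l -> inU M) ->
  exists2 M, M \in l & forall M', M' \in l -> ~ lower M M'.
Proof.
elim: l => // M l ih _ lU; have [v _ hv] := inU_level (lU M (mem_head _ _)).
have nself : ~ lower M M.
  move=> [v1 [v2 [h1 [h2 h]]]]; rewrite (level_uniq h1 h2) in h.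
  by apply: (level_not h2 h); case: h2.
have [l0|ln] := eqVneq l [::].
  exists M; first exact: mem_head.
  by move=> M'; rewrite l0 inE => /eqP->.
have [|M1 l1 h1] := ih (elimN eqP ln); first by move=> M' h; apply: lU; rewrite inE h orbT.
have [w _ hw] : exists2 w, lt w alpha & level M1 w by apply: inU_level; apply: lU; rewrite inE l1 orbT.
have [h|h] := pselect (lower M1 M).
  exists M; first exact: mem_head.
  move=> M'; rewrite inE => /orP[/eqP->//|M'l hMM'].
  apply: (h1 M' M'l); have [v1 [v2 [k1 [k2 k3]]]] := h; have [w1 [w2 [j1 [j2 j3]]]] := hMM'.
  exists v1, w2; split=> //; split=> //; apply: (lt_trans k3).
  by rewrite (level_uniq k2 j1).
exists M1; first by rewrite inE l1 orbT.
by move=> M'; rewrite inE => /orP[/eqP->//|]; exact: h1.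
Qed.

Lemma total_inj l phi : carries l phi -> total l phi = 0 -> forall M, inU M -> phi M = 0.
Proof.
move=> hc t0; have [ul [lU hl]] := hc; pose k := [seq M <- l | phi M != 0].
have [k0|kn] := pselect (k = [::]).
  move=> M UM; apply: contrapT => n0; have [_ /(_ n0) Ml] := hl M UM.
  by have : M \in k; [rewrite mem_filter Ml andbT; apply/eqP|rewrite k0].
have [|M Mk hM] := top_element kn; first by move=> M; rewrite mem_filter => /andP[_]; exact: lU.
have := Mk; rewrite mem_filter => /andP[/eqP n0 Ml]; case: n0.
have UM := lU M Ml; have [hphi _] := hl M UM.
apply/funext => a; have : total l phi M a = 0 by rewrite t0.
rewrite /total sum_app (bigD1_seq M) //= sec_at // big_seq_cond big1; first by rewrite addr0.
move=> M' /andP[M'l /eqP nM']; have UM' := lU M' M'l; have [hphi' _] := hl M' UM'.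
have [e0|n0] := pselect (phi M' = 0); first by rewrite e0 sec0.
have [_ hn] := sec_near UM' hphi'; apply: contrapT => ns.
have M'k : M' \in k by rewrite mem_filter M'l andbT; apply/eqP.
by apply: (hM M' M'k); apply: (hn M a) => // e; apply: nM'.
Qed.

(** * Cutting value functions, and the kernel *)

Definition cut d g : Gam := fun M a => if `[< M d >] then 0 else g M a.

Lemma cut_in d g M a : M d -> cut d g M a = 0.
Proof. by move=> h; rewrite /cut asboolT. Qed.

Lemma cut_out d g M a : ~ M d -> cut d g M a = g M a.
Proof. by move=> h; rewrite /cut asboolF. Qed.

Lemma cut_Gmax d g : D d -> Gmax g -> Gmax (cut d g).
Proof. by move=> Dd hg; exact: patch_class. Qed.

Lemma Gmax_ext g h : Gmax g -> Gmax h ->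
  (forall M a, maxideal D M -> g M a = h M a) -> g = h.
Proof.
move=> hg hh e; apply/funext => M; apply/funext => a.
by have [hM|nM] := pselect (maxideal D M); [exact: e|rewrite !Gmax_out].
Qed.

Lemma max_or M x y : maxideal D M -> D x -> D y -> M (x * y) -> M x \/ M y.
Proof.
move=> hM Dx Dy Mxy; have [Mx|nx] := pselect (M x); [by left|right].
by apply: contrapT => ny; exact: (max_prime hD hM Dx Dy nx ny).
Qed.

(* The set of [d] such that every further localization of [g] away from [d] is
   reached is an ideal, and it is contained in no maximal ideal. *)
Lemma reached_below w g : w = alpha \/ lt w alpha -> Gmax g ->
  (forall M a, g M a <> 0 -> exists2 v, lt v w & level M v) -> reached g.
Proof.
case: hlt => hwf _; elim/(well_founded_ind hwf): w g => w ih g wa hg hsupp.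
have va v : lt v w -> lt v alpha by move=> vw; case: wa => [<-//|]; exact: lt_trans.
pose I d := D d /\ forall y, D y -> reached (cut (y * d) g).
have D0 : D 0 by exact: subring0.
have cutG d : D d -> Gmax (cut d g) by move=> Dd; exact: cut_Gmax.
have hI : is_ideal D I.
  split; first by move=> x [].
  split.
    split=> // y Dy; rewrite mulr0; suff -> : cut 0 g = 0 by exact: reached0.
    apply: Gmax_ext; [exact: cutG|exact: (valueG0 hD)|].
    by move=> M a hM; rewrite cut_in //; exact: (max0 hM).
  split; last first.
    move=> a x Da [Dx hx]; split; first exact: subringM.
    by move=> y Dy; rewrite mulrA; apply: hx; exact: subringM.
  move=> x1 x2 [D1 h1] [D2 h2]; have D12 : D (x1 + x2) by exact: subringD.
  split=> // y Dy; set z := y * (x1 + x2); have Dz : D z by exact: subringM.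
  have Dz1 : D (z * x1) by exact: subringM.
  have Dz2 : D (z * x2) by exact: subringM.
  have Dz12 : D (z * x1 * x2) by exact: subringM.
  (* Inclusion and exclusion: a place not containing [z] does not contain [x1 + x2], so it misses
     [x1] or [x2], and the three cuts on the right combine to [g]. *)
  suff -> : cut z g = cut (z * x1) g + cut (z * x2) g - cut (z * x1 * x2) g.
    apply: reachedB; [apply: reachedD; [exact: h1|exact: h2]|].
    by apply: h2; exact: subringM.
  apply: Gmax_ext; first exact: cutG.
    by apply: (valueGB hD) => //; [apply: (valueGD hD) => //; exact: cutG|exact: cutG].
  move=> M a hM; rewrite !gamE.
  have [Mz|nz] := pselect (M z).
    rewrite !cut_in ?addr0 ?subr0 //; repeat apply: (maxMr hM) => //.
  have nx : ~ M x1 \/ ~ M x2.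
    have [M1|n1] := pselect (M x1); [right=> M2|by left].
    by apply: nz; apply: (maxM hM) => //; exact: (maxDD hM).
  have hz x : D x -> M (z * x) -> M x by move=> Dx /(max_or hM Dz Dx) [].
  rewrite (cut_out g a nz).
  have [M1|n1] := pselect (M x1).
    rewrite (cut_in g a (maxM hM Dz M1)) (cut_in g a (maxMr hM D2 (maxM hM Dz M1))).
    by rewrite cut_out ?add0r ?subr0 // => /(hz _ D2) M2; case: nx.
  have n1' : ~ M (z * x1) by move=> /(hz _ D1).
  have [M2|n2] := pselect (M x2).
    rewrite (cut_out g a n1') (cut_in g a (maxM hM Dz M2)) (cut_in g a (maxM hM Dz1 M2)).
    by rewrite addr0 subr0.
  have n2' : ~ M (z * x2) by move=> /(hz _ D2).
  rewrite !cut_out ?addrK // => /(max_or hM Dz1 D2) [] //.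
have gcut1 : cut (1 * 1) g = g.
  apply: Gmax_ext => //; first by apply: cutG; apply: subringM => //; exact: subring1.
  by move=> M a hM; rewrite mulr1 cut_out //; exact: (max1 hM).
suff : I 1 by move=> [_ /(_ 1 (subring1 hR))]; rewrite gcut1.
apply: (local_global hI) => M hM.
have trivial_near S : maxset D S -> extends_to D S -> S M ->
    (forall M a, S M -> g M a = 0) -> exists d, I d /\ ~ M d.
  move=> hS eS SM z; have [e [De [ne he]]] := open_zero hD hS eS hg z SM.
  exists e; split=> //; split=> // y Dy.
  suff -> : cut (y * e) g = 0 by exact: reached0.
  apply: Gmax_ext; [by apply: cutG; exact: subringM|exact: (valueG0 hD)|].
  move=> M' a hM'; rewrite /cut; case: asboolP => // nye; apply: he => M'e.
  by apply: nye; exact: (maxM hM').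
have [NM|nN] := pselect (N alpha (loc D M)).
  apply: (trivial_near stay) => //; [exact: maxset_stay|exact: extends_stay|].
  move=> M' a [_ NM']; apply: contrapT => /hsupp [v vw hv].
  exact: (level_not hv (va v vw) NM').
have UM : inU M by [].
have [g0|gn] := pselect (g M = 0).
  apply: (trivial_near (eq M)) => //; [exact: maxset1|exact: extendsU|].
  by move=> M' a <-; rewrite g0.
have [v vw hv] : exists2 v, lt v w & level M v.
  apply: contrapT => h; apply: gn; apply/funext => a; apply: contrapT => /hsupp h'.
  exact: h.
have hu := Gmax_local hM hg; have [hs hnear] := sec_near UM hu; have sM := sec_at UM hu.
have hdiff : Gmax (g - sec M (g M)) by exact: (valueGB hD).
(* The difference between [g] and the lift of its component vanishes at [M], hence on a
   neighbourhood of [M]. *)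
have [e [De [ne he]]] : exists e, D e /\ ~ M e /\
    forall M' a, ~ M' e -> (g - sec M (g M)) M' a = 0.
  apply: (open_zero hD (maxset1 hM) (extendsU UM) hdiff) => // M' a <-.
  by rewrite !gamE sM subrr.
have vge M' a : ~ M' e -> g M' a = sec M (g M) M' a.
  by move=> /(he M' a) /eqP; rewrite !gamE subr_eq0 => /eqP.
exists e; split=> //; split=> // y Dy; set d := y * e.
have Dd : D d by exact: subringM.
have small h : Gmax h -> (forall a, h M a = 0) ->
    (forall M' a, h M' a <> 0 -> sec M (g M) M' a <> 0) -> reached h.
  move=> hh hM0 hsec; apply: (ih v vw) => //; first by right; exact: va.
  move=> M' a hn; have nM' : M' <> M by move=> e'; apply: hn; rewrite e' hM0.
  have [u1 [u2 [k1 [k2 k3]]]] := hnear M' a nM' (hsec M' a hn).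
  by exists u1 => //; rewrite (level_uniq hv k2).
have ecut : cut d g = cut d (sec M (g M)).
  apply: Gmax_ext; [exact: cutG|exact: cut_Gmax|].
  move=> M' a hM'; rewrite /cut; case: asboolP => // nd; apply: vge => M'e.
  by apply: nd; exact: (maxM hM').
(* Either the cut removes [M], leaving lower levels only, or [cut d g] differs from the lift by a
   function supported on lower levels; induction at [v] covers both. *)
have [Md|nMd] := pselect (M d).
  apply: small; first exact: cutG.
    by move=> a; rewrite cut_in.
  by move=> M' a; rewrite ecut /cut; case: asboolP.
have -> : cut d g = sec M (g M) - (sec M (g M) - cut d g) by rewrite subKr.
apply: reachedB; first exact: reached_sec.
apply: small; first by apply: (valueGB hD) => //; exact: cutG.
  by move=> a; rewrite ecut !gamE cut_out // subrr.
move=> M' a hn h0; apply: hn; rewrite ecut !gamE /cut h0.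
by case: asboolP; rewrite subrr.
Qed.

Lemma reached_kernel g : Gmax g -> (forall M a, stay M -> g M a = 0) -> reached g.
Proof.
move=> hg h0; apply: (@reached_below alpha) => //; first by left.
move=> M a n0; have hM : maxideal D M.
  by apply: contrapT => nM; apply: n0; exact: Gmax_out.
by apply: inU_level; split=> // NM; apply: n0; exact: h0.
Qed.

Lemma local_classes M : inU M ->
  [/\ forall I, invertible (IntF (loc D M)) I -> valueG D (eq M) (class D (eq M) I),
    forall I J, invertible (IntF (loc D M)) I -> invertible (IntF (loc D M)) J ->
      (pic_eqv (IntF (loc D M)) I J <-> class D (eq M) I = class D (eq M) J),
    forall I J, invertible (IntF (loc D M)) I -> invertible (IntF (loc D M)) J ->
      class D (eq M) (prodI I J) = class D (eq M) I + class D (eq M) J /\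
      invertible (IntF (loc D M)) (prodI I J),
    invertible (IntF (loc D M)) (IntF (loc D M)) /\ class D (eq M) (IntF (loc D M)) = 0 &
    forall f, valueG D (eq M) f ->
      exists I, invertible (IntF (loc D M)) I /\ class D (eq M) I = f].
Proof.
move=> [hM _]; have h1 := maxset1 hM; rewrite -(capS1 M); split.
- by move=> I; exact: class_G.
- by move=> I J; exact: class_local.
- by move=> I J hI hJ; have [] := class_mul hD h1 hI hJ.
- exact: class_one.
- exact: valueG_class.
Qed.

Definition local_value (a : (K -> Prop) -> KX K -> Prop) M := class D (eq M) (a M) M.

Lemma local_value_carried a : sg_elem (s := SumPic D (N alpha)) a ->
  exists l, carries l (local_value a).
Proof.
(* The list supplied with an element of the direct sum may repeat entries or contain sets outside
   the index set. *)
move=> [ha [s hs]]; exists (undup [seq M <- s | `[< inU M >]]).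
split; first exact: undup_uniq.
split=> M; first by rewrite mem_undup mem_filter => /andP[/asboolP].
move=> UM; have [lG leqv _ [l1 l2] _] := local_classes UM; have haM := ha M UM.
split; first by exists (class D (eq M) (a M)) => //; exact: lG.
move=> n0; rewrite mem_undup mem_filter asboolT //=; apply: contrapT => ns.
apply: n0; rewrite /local_value.
have /leqv -> // : pic_eqv (IntF (loc D M)) (a M) (IntF (loc D M)).
  apply: hs => // hin; apply: ns; elim: s hin => //= x s ih [->|/ih h].
    exact: mem_head.
  by rewrite inE h orbT.
by rewrite l2.
Qed.
End Assembly.

(** * The two maps and exactness *)

Theorem theorem7p5 (K : fieldType) (D : K -> Prop) (W : Type)
    (lt : W -> W -> Prop) (N : W -> (K -> Prop) -> Prop) (alpha : W) :
  almost_dedekind D ->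
  well_order lt ->
  derived_seq D lt N ->
  (forall M, maxideal D M -> ~ N alpha (loc D M) -> Int_ext_eq D (loc D M)) ->
  Int_ext_eq D (Tint (N alpha)) ->
  exists (f : sg_car (SumPic D (N alpha)) -> sg_car (PicInt D))
         (g : sg_car (PicInt D) -> sg_car (PicInt (Tint (N alpha)))),
    short_exact f g.
Proof.
move=> hD hlt hN hU hT.
have hmax := @maxset_max K D; have hstay := @maxset_stay K D W N alpha.
have eqvD := class_eqv hD hmax; have mulD := class_mul hD hmax.
have [oneDi oneD] := class_one hD hmax; have GcD := valueG_class hD hmax.
have cGD I := class_G hD hmax (I := I).
rewrite (capS_max hD) in eqvD mulD oneDi oneD GcD cGD.
have eqvT := class_eqv hD hstay; have mulT := class_mul hD hstay.
have [oneTi oneT] := class_one hD hstay; have GcT := valueG_class hD hstay.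
have cGT I := class_G hD hstay (I := I).
rewrite -(Tint_stay alpha hN) in eqvT mulT oneTi oneT GcT cGT.
have loc1 M (UM : inU D N alpha M) := local_classes hD UM.
pose phi := local_value D.
have phi_carries a (ha : sg_elem (s := SumPic D (N alpha)) a) := local_value_carried hD ha.
(* Both maps are chosen on representatives, as any ideal with the prescribed class; outside the
   valid representatives the value is an arbitrary default. *)
have [f hf] : exists f : ((K -> Prop) -> KX K -> Prop) -> (KX K -> Prop), forall a,
    sg_elem (s := SumPic D (N alpha)) a -> invertible (IntF D) (f a) /\
    exists2 l, carries D N alpha l (phi a) &
      class D (maxideal D) (f a) = total hD hlt hN hU l (phi a).
  suff /choice[f hf] : forall a, exists I, sg_elem (s := SumPic D (N alpha)) a ->
      invertible (IntF D) I /\ exists2 l, carries D N alpha l (phi a) &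
        class D (maxideal D) I = total hD hlt hN hU l (phi a) by exists f.
  move=> a; have [ha|na] := pselect (sg_elem (s := SumPic D (N alpha)) a); last by exists (IntF D).
  have [l hl] := phi_carries a ha.
  have [I [hI eI]] := GcD _ (total_Gmax hD hlt hN hU hl).
  by exists I => _; split=> //; exists l.
pose res (h : (K -> Prop) -> K -> int) : (K -> Prop) -> K -> int :=
  fun M a => if `[< stay D N alpha M >] then h M a else 0.
have [g hg] : exists g : (KX K -> Prop) -> (KX K -> Prop), forall I,
    invertible (IntF D) I -> invertible (IntF (Tint (N alpha))) (g I) /\
      class D (stay D N alpha) (g I) = res (class D (maxideal D) I).
  suff /choice[g hg] : forall I, exists J, invertible (IntF D) I ->
      invertible (IntF (Tint (N alpha))) J /\
      class D (stay D N alpha) J = res (class D (maxideal D) I) by exists g.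
  move=> I; have [hI|nI] := pselect (invertible (IntF D) I); last by exists (IntF D).
  have [J hJ] := GcT _ (valueG_restrict hD hmax hstay (fun M h => h.1) (cGD I hI)).
  by exists J.
have resD h k : res (h + k) = res h + res k.
  apply/funext => M; apply/funext => a; rewrite !gamE /res.
  by case: asboolP => // _; rewrite addr0.
exists f, g; split; last split; last split; last split.
- split; first by move=> a /hf [].
  split.
    move=> a b ha hb hab; have [fa [l hl el]] := hf a ha; have [fb [k hk ek]] := hf b hb.
    apply/(eqvD _ _ fa fb); rewrite el ek.
    have hab' M : inU D N alpha M -> phi a M = phi b M.
      move=> UM; have [_ leqv _ _ _] := loc1 M UM; rewrite /phi /local_value.
      by have /leqv -> := hab M UM; [|exact: ha.1|exact: hb.1].
    have hl' : carries D N alpha l (phi b).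
      have [ul [lU hl1]] := hl; have [_ [_ hk1]] := hk; split=> //; split=> // M UM.
      have [_ h2] := hl1 M UM; have [h3 _] := hk1 M UM.
      by split=> //; rewrite -hab'.
    rewrite (total_indep hD hlt hN hU hk hl') /total; apply: eq_big_seq => M Ml.
    by rewrite hab' //; have [_ [lU _]] := hl; exact: lU.
  move=> a b ha hb; have [fa [l hl el]] := hf a ha; have [fb [k hk ek]] := hf b hb.
  have phiM M : inU D N alpha M -> phi (fun M => prodI (a M) (b M)) M = phi a M + phi b M.
    move=> UM; have [_ _ lm _ _] := loc1 M UM.
    by have [e _] := lm _ _ (ha.1 M UM) (hb.1 M UM); rewrite /phi /local_value e.
  have hab : sg_elem (s := SumPic D (N alpha)) (fun M => prodI (a M) (b M)).
    split; first by move=> M UM; have [_ _ lm _ _] := loc1 M UM;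
      have [] := lm _ _ (ha.1 M UM) (hb.1 M UM).
    have [s hs] := ha.2; have [t ht] := hb.2; exists (s ++ t) => M UM hin.
    have [_ leqv lm [l1 l2] _] := loc1 M UM; have haM := ha.1 M UM; have hbM := hb.1 M UM.
    have [e i] := lm _ _ haM hbM; apply/(leqv _ _ i l1); rewrite e l2.
    have /(leqv _ _ haM l1) -> := hs M UM (fun h => hin (List.in_or_app _ _ _ (or_introl h))).
    have /(leqv _ _ hbM l1) -> := ht M UM (fun h => hin (List.in_or_app _ _ _ (or_intror h))).
    by rewrite l2 addr0.
  have [fab [m hm em]] := hf _ hab; have [fm fme] := mulD _ _ fa fb.
  apply/(eqvD _ _ fab fm); rewrite fme em el ek.
  have [n hn <-] := total_add hD hlt hN hU hl hk.
  have hm' : carries D N alpha m (phi a + phi b).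
    have [um [mU hm1]] := hm; have [_ [_ hn1]] := hn; split=> //; split=> // M UM.
    have [_ h2] := hm1 M UM; have [h3 _] := hn1 M UM; split=> // h4; apply: h2.
    by rewrite phiM.
  rewrite -(total_indep hD hlt hN hU hm' hn) /total; apply: eq_big_seq => M Mm.
  by rewrite phiM //; have [_ [mU _]] := hm; exact: mU.
- split; first by move=> I /hg [].
  split.
    move=> I J hI hJ /(eqvD _ _ hI hJ) e; have [gI eI] := hg I hI; have [gJ eJ] := hg J hJ.
    by apply/(eqvT _ _ gI gJ); rewrite eI eJ e.
  move=> I J hI hJ; have [iIJ eIJ] := mulD _ _ hI hJ.
  have [gI eI] := hg I hI; have [gJ eJ] := hg J hJ; have [gIJ eg] := hg _ iIJ.
  have [iT eT] := mulT _ _ gI gJ.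
  by apply/(eqvT _ _ gIJ iT); rewrite eT eg eI eJ eIJ resD.
- move=> a ha; have [fa [l hl el]] := hf a ha.
  move=> /(eqvD _ _ fa oneDi); rewrite oneD el => /(total_inj hl) h0 /= M UM.
  have [lG leqv _ [l1 l2] _] := loc1 M UM; have haM := ha.1 M UM.
  apply/(leqv _ _ haM l1); rewrite l2; apply: (valueG_component UM.1); first exact: lG.
    by apply: (valueG0 hD); exact: maxset1 UM.1.
  exact: h0.
- move=> I hI; have [gI eI] := hg I hI; split.
    move=> /(eqvT _ _ gI oneTi); rewrite oneT eI => e0.
    have [|l [psi [hl el]]] := reached_kernel hD hlt hN hU hT (cGD I hI).
      move=> M a SM; have : res (class D (maxideal D) I) M a = 0 by rewrite e0.
      by rewrite /res asboolT.
    (* The kernel argument gives only local value functions [psi]; a family of ideals realising them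
       is assembled by choice. *)
    have [a ha] : exists a : (K -> Prop) -> KX K -> Prop, forall M, inU D N alpha M ->
        invertible (IntF (loc D M)) (a M) /\ phi a M = psi M.
      suff /choice[a ha] : forall M, exists I, inU D N alpha M ->
          invertible (IntF (loc D M)) I /\ class D (eq M) I M = psi M by exists a.
      move=> M; have [UM|nU] := pselect (inU D N alpha M); last by exists (IntF D).
      have [_ _ _ _ lGc] := loc1 M UM; have [_ [_ h]] := hl; have [[k hk ek] _] := h M UM.
      by have [J [hJ eJ]] := lGc k hk; exists J => _; rewrite eJ.
    have hae : sg_elem (s := SumPic D (N alpha)) a.
      split; first by move=> M /ha [].
      exists l => M UM nin; have [lG leqv _ [l1 l2] _] := loc1 M UM; have [iaM eaM] := ha M UM.
      apply/(leqv _ _ iaM l1); rewrite l2; apply: (valueG_component UM.1); first exact: lG.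
        by apply: (valueG0 hD); exact: maxset1 UM.1.
      rewrite -[LHS]/(phi a M) eaM; have [_ [_ h]] := hl; have [_ h2] := h M UM.
      apply: contrapT => /h2 Ml; apply: nin; elim: (l) Ml => //= x s ih.
      by rewrite inE => /orP[/eqP->|/ih]; [left|right].
    exists a; split=> //; have [fa [k hk ek]] := hf a hae.
    apply/(eqvD _ _ fa hI); rewrite ek -el.
    have hl' : carries D N alpha l (phi a).
      have [ul [lU h]] := hl; split=> //; split=> // M UM.
      by have [_ ->] := ha M UM; exact: h.
    rewrite (total_indep hD hlt hN hU hk hl') /total; apply: eq_big_seq => M Ml.
    by have [_ [lU _]] := hl; have [_ ->] := ha M (lU M Ml).
  move=> [a [ha]]; have [fa [l hl el]] := hf a ha.
  move=> /(eqvD _ _ fa hI) e; apply/(eqvT _ _ gI oneTi); rewrite oneT eI -e el.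
  apply/funext => M; apply/funext => x; rewrite /res; case: asboolP => // SM.
  exact: total_stay.
(* Surjectivity: the surviving places are separated, and the hypothesis on [Tint (N alpha)] supplies
   the denominators needed to lift. *)
- move=> J hJ; have [h [hh eh]] := lift_class hD hstay (extends_stay hD hN hT)
    (@separated_stay _ _ _ _ _ alpha hD hlt hN) (cGT J hJ).
  have [I [hI eI]] := GcD _ hh; exists I; split=> //; have [gI egI] := hg I hI.
  apply/(eqvT _ _ gI hJ); rewrite egI eI; apply/funext => M; apply/funext => a.
  rewrite /res; case: asboolP => [SM|nS]; first exact: eh.
  by have [J1 [J2 [_ ->]]] := cGT J hJ; rewrite norm_Phi_out // => -[].
Qed.
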